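(* Let $\mathcal{A},\mathcal{B},\mathcal{C}$ be $C^*$-algebras and let $G$, $E$, $F$ be a Hilbert $\mathcal{A}$-module, a Hilbert $\mathcal{B}$-module and a Hilbert $\mathcal{C}$-module, respectively. Extensions $$0\to G\xrightarrow{\;v\;}E\xrightarrow{\;u\;}F\to0$$ of Hilbert modules are in one-to-one correspondence with blockwise extensions (that is, all homomorphisms are blockwise) $$0\to\mathscr{K}\begin{pmatrix}\mathcal{A}_G \\ G\end{pmatrix}\xrightarrow{\;\Psi\;}\mathscr{K}\begin{pmatrix}\mathcal{B}_E \\ E\end{pmatrix}\xrightarrow{\;\Phi\;}\mathscr{K}\begin{pmatrix}\mathcal{C}_F \\ F\end{pmatrix}\to0$$ of the corresponding reduced linking algebras, via the requirement that the (co)restrictions of $\Phi$ and $\Psi$ to maps between the $21$-corners are $u$ and $v$, respectively.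
   Context: Hilbert modules are right modules with inner product linear in the second variable; they need not be full. Homomorphisms between $C^*$-algebras are $*$-homomorphisms. $\mathcal{B}_E=\overline{\mathrm{span}}\,\langle E,E\rangle$ is the range ideal of $E$ (similarly $\mathcal{A}_G$, $\mathcal{C}_F$). For $x\in E$, $x^*=\langle x,\cdot\rangle$, $E^*=\{x^*:x\in E\}$, $xy^*\colon z\mapsto x\langle y,z\rangle$, $\mathscr{K}(E)=\overline{\mathrm{span}}\,\{xy^*:x,y\in E\}$. The reduced linking algebra of $E$ is the $C^*$-algebra $\mathscr{K}\begin{pmatrix}\mathcal{B}_E \\ E\end{pmatrix}=\begin{pmatrix}\mathcal{B}_E & E^* \\ E & \mathscr{K}(E)\end{pmatrix}$ of compact operators on $\mathcal{B}_E\oplus E$, with $E$ as $21$-corner. A homomorphism between such matrix algebras is blockwise if it maps the $ij$-corner into the $ij$-corner for all $i,j$. A ternary homomorphism is a linear map $u\colon E\to F$ with $u(x\langle y,z\rangle)=(ux)\langle uy,uz\rangle$. A short sequence $0\to X\to Y\to Z\to0$ is exact if the range of each map equals the kernel of the next. An extension of Hilbert modules (of $F$ by $G$) is a short exact sequence $0\to G\xrightarrow{v}E\xrightarrow{u}F\to0$ of ternary homomorphisms; an extension of $C^*$-algebras is a short exact sequence of homomorphisms. *)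

(* Defs.v *)
From HB Require Import structures.
From mathcomp Require Import all_boot all_order all_algebra.
From mathcomp Require Import complex.
From mathcomp Require Import all_classical all_reals topology normedtype.

Set Implicit Arguments.
Unset Strict Implicit.
Unset Printing Implicit Defensive.

Import Order.TTheory GRing.Theory Num.Theory.
Import numFieldNormedType.Exports.

Local Open Scope classical_set_scope.
Local Open Scope ring_scope.
Local Open Scope complex_scope.

HB.mixin Record CompleteNormedModule_isCStarAlgebra (R : realType) A
    of CompleteNormedModule R[i] A := {
  cmul : A -> A -> A;
  cstar : A -> A;
  cmulA : associative cmul;
  cmulDl : left_distributive cmul +%R;
  cmulDr : right_distributive cmul +%R;
  cmulZl : forall (a : R[i]) (x y : A), cmul (a *: x) y = a *: cmul x y;
  cmulZr : forall (a : R[i]) (x y : A), cmul x (a *: y) = a *: cmul x y;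
  cstarK : involutive cstar;
  cstarD : {morph cstar : x y / x + y};
  cstarZ : forall (a : R[i]) (x : A), cstar (a *: x) = (a^*)%C *: cstar x;
  cstarM : forall x y : A, cstar (cmul x y) = cmul (cstar y) (cstar x);
  normr_cmul : forall x y : A, `|cmul x y| <= `|x| * `|y|;
  normr_cstar : forall x : A, `|cmul (cstar x) x| = `|x| ^+ 2
}.

#[short(type="cstarAlgType")]
HB.structure Definition CStarAlgebra (R : realType) :=
  {A of CompleteNormedModule_isCStarAlgebra R A & CompleteNormedModule R[i] A}.

(* Right modules with a B-valued inner product, linear in the second variable.
   Positivity and completeness are added in HilbertModule below: this level
   carries what is needed to speak of adjointable and compact operators. *)
HB.mixin Record Lmodule_isInnerProductModule (R : realType) (B : cstarAlgType R)
    H of GRing.Lmodule R[i] H := {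
  ract : H -> B -> H;
  inner : H -> H -> B;
  ractDl : forall x y b, ract (x + y) b = ract x b + ract y b;
  ractDr : forall x b c, ract x (b + c) = ract x b + ract x c;
  ractM : forall x b c, ract x (cmul b c) = ract (ract x b) c;
  ractZl : forall (a : R[i]) x b, ract (a *: x) b = a *: ract x b;
  ractZr : forall (a : R[i]) x b, ract x (a *: b) = a *: ract x b;
  innerDr : forall x y z, inner x (y + z) = inner x y + inner x z;
  innerZr : forall (a : R[i]) x y, inner x (a *: y) = a *: inner x y;
  inner_ract : forall x y b, inner x (ract y b) = cmul (inner x y) b;
  inner_star : forall x y, cstar (inner x y) = inner y x;
  inner_nondegenerate : forall x, (forall y, inner x y = 0) -> x = 0
}.

#[short(type="innerModType")]
HB.structure Definition InnerProductModule (R : realType) (B : cstarAlgType R) :=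
  {H of Lmodule_isInnerProductModule R B H & GRing.Lmodule R[i] H}.

HB.mixin Record InnerProductModule_isHilbert (R : realType) (B : cstarAlgType R)
    H of InnerProductModule R B H & CompleteNormedModule R[i] H := {
  inner_pos : forall x : H, exists b : B, inner x x = cmul (cstar b) b;
  normr_inner : forall x : H, `|x| ^+ 2 = `|inner x x : B|
}.

#[short(type="hilbertModType")]
HB.structure Definition HilbertModule (R : realType) (B : cstarAlgType R) :=
  {H of InnerProductModule_isHilbert R B H & InnerProductModule R B H
      & CompleteNormedModule R[i] H}.

Section InnerProductTheory.
Context (R : realType) (B : cstarAlgType R).

Lemma cmul0l (b : B) : cmul 0 b = 0.
Proof. by rewrite -[X in cmul X b](scale0r (0 : B)) cmulZl scale0r. Qed.

Lemma cmul0r (b : B) : cmul b 0 = 0.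
Proof. by rewrite -[X in cmul b X](scale0r (0 : B)) cmulZr scale0r. Qed.

Lemma normr_cstarE (b : B) : `|cstar b| = `|b|.
Proof.
suff le_star (c : B) : `|c| <= `|cstar c|.
  apply/eqP; rewrite eq_le le_star andbT.
  by have := le_star (cstar b); rewrite cstarK.
have [->|c0] := eqVneq c 0; first by rewrite normr0 normr_ge0.
have c_gt0 : 0 < `|c| by rewrite normr_gt0.
rewrite -(ler_pM2r c_gt0) -expr2 -normr_cstar.
exact: normr_cmul.
Qed.

Context (H : innerModType B).
Implicit Types x y z : H.

Lemma innerDl x y z : inner (x + y) z = inner x z + inner y z :> B.
Proof. by rewrite -inner_star innerDr cstarD !inner_star. Qed.

Lemma innerZl (a : R[i]) x y :
  inner (a *: x) y = (a^*)%C *: inner x y :> B.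
Proof. by rewrite -inner_star innerZr cstarZ inner_star. Qed.

Lemma inner_ractl x y (b : B) : inner (ract x b) y = cmul (cstar b) (inner x y).
Proof. by rewrite -inner_star inner_ract cstarM inner_star. Qed.

Lemma inner0r x : inner x 0 = 0 :> B.
Proof. by rewrite -(scale0r (0 : H)) innerZr scale0r. Qed.

Lemma inner0l x : inner 0 x = 0 :> B.
Proof. by rewrite -(scale0r (0 : H)) innerZl conjc0 scale0r. Qed.

Lemma ract0l (b : B) : ract (0 : H) b = 0.
Proof. by rewrite -[X in ract X b](scale0r (0 : H)) ractZl scale0r. Qed.

(* The Hilbert module norm, for modules without a normed module structure such
   as direct sums; its values are in R[i], like those of any norm over R[i]. *)
Definition hnorm x : R[i] := sqrtC `|inner x x : B|.

End InnerProductTheory.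

Lemma hnormE (R : realType) (B : cstarAlgType R) (E : hilbertModType B) (x : E) :
  hnorm x = `|x|.
Proof. by rewrite /hnorm -normr_inner sqrCK. Qed.

Section Adjointable.
Context (R : realType) (B : cstarAlgType R) (H : innerModType B).

Definition is_adjoint (T S : H -> H) :=
  forall x y, inner (T x) y = inner x (S y) :> B.

Definition adjointable_pred : {pred H -> H} :=
  fun T => `[< exists S, is_adjoint T S >].

Record adjointable := Adjointable {
  adjointable_val :> H -> H;
  _ : adjointable_val \in adjointable_pred }.

HB.instance Definition _ := [isSub for adjointable_val].
HB.instance Definition _ := [Choice of adjointable by <:].

Lemma adjointable_submod_closed : submod_closed adjointable_pred.
Proof.
split.
  by apply/asboolP; exists (fun=> 0) => x y; rewrite inner0r -[RHS](inner0l y).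
move=> a T T' /asboolP[S TS] /asboolP[S' TS']; apply/asboolP.
exists (fun y => (a^*)%C *: S y + S' y) => x y.
by rewrite [LHS]innerDl innerZl innerDr innerZr TS TS'.
Qed.

HB.instance Definition _ :=
  GRing.isSubmodClosed.Build _ _ adjointable_pred adjointable_submod_closed.
HB.instance Definition _ :=
  [SubChoice_isSubLmodule of adjointable by <:].

Lemma is_adjoint_adjointable (T S : H -> H) :
  is_adjoint T S -> T \in adjointable_pred.
Proof. by move=> TS; apply/asboolP; exists S. Qed.

Definition mk_adjointable (T S : H -> H) (TS : is_adjoint T S) : adjointable :=
  Adjointable (is_adjoint_adjointable TS).

Lemma is_adjoint_sym (T S : H -> H) : is_adjoint T S -> is_adjoint S T.
Proof. by move=> TS x y; rewrite -inner_star -TS inner_star. Qed.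

Lemma adjointableP (T : adjointable) : exists S, is_adjoint T S.
Proof. by apply/asboolP; exact: (valP T). Qed.

Definition adjop (T : adjointable) : adjointable :=
  mk_adjointable (is_adjoint_sym (svalP (cid (adjointableP T)))).

Lemma adjopP (T : adjointable) : is_adjoint T (adjop T).
Proof. exact: (svalP (cid (adjointableP T))). Qed.

Lemma is_adjoint_comp (T S : adjointable) :
  is_adjoint (T \o S) (adjop S \o adjop T).
Proof. by move=> x y /=; rewrite !adjopP. Qed.

Definition compop (T S : adjointable) : adjointable :=
  mk_adjointable (is_adjoint_comp T S).

Lemma is_adjoint_rank1 (x y : H) :
  is_adjoint (fun z => ract x (inner y z)) (fun z => ract y (inner x z)).
Proof.
by move=> z w; rewrite inner_ractl inner_ract inner_star.
Qed.

(* The operator x y^* *)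
Definition rank1 (x y : H) : adjointable :=
  mk_adjointable (is_adjoint_rank1 x y).

End Adjointable.

Definition lspan (K : pzRingType) (V : lmodType K) (X : set V) : set V :=
  [set v | exists n (a : 'I_n -> K) (x : 'I_n -> V),
    (forall i, X (x i)) /\ v = \sum_(i < n) a i *: x i].

(* The closure, in the operator norm, of the span of the operators x y^*:
   the bound on (T - S) z says that the operator norm of T - S is at most e. *)
Definition compact_ops (R : realType) (B : cstarAlgType R) (H : innerModType B) :
    set (adjointable H) :=
  [set T | forall e : R[i], 0 < e ->
    exists2 S : adjointable H,
      lspan [set rank1 p.1 p.2 | p in [set: H * H]] S &
      forall z : H, hnorm ((T - S) z) <= e * hnorm z].

Section Span.
Context (K : pzRingType) (V : lmodType K) (X : set V).

Lemma sub_lspan : X `<=` lspan X.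
Proof.
move=> x Xx; exists 1%N, (fun=> 1), (fun=> x); split=> //.
by rewrite big_ord1 scale1r.
Qed.

Lemma lspan0 : lspan X 0.
Proof. by exists 0%N, (fun=> 0), (fun=> 0); split=> [[]|]//; rewrite big_ord0. Qed.

Lemma lspanD (x y : V) : lspan X x -> lspan X y -> lspan X (x + y).
Proof.
move=> [n [a [u [Xu ->]]]] [m [b [v [Xv ->]]]].
pose ext T (f : 'I_n -> T) (g : 'I_m -> T) (i : 'I_(n + m)) :=
  match fintype.split i with inl j => f j | inr j => g j end.
exists (n + m)%N, (ext _ a b), (ext _ u v); split=> [i|].
  by rewrite /ext; case: (fintype.split i).
by rewrite big_split_ord; congr (_ + _); apply: eq_bigr => i _;
  rewrite /ext ?(unsplitK (inl _)) ?(unsplitK (inr _)).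
Qed.

Lemma lspanZ (k : K) (x : V) : lspan X x -> lspan X (k *: x).
Proof.
move=> [n [a [u [Xu ->]]]]; exists n, (fun i => k * a i), u; split=> //.
by rewrite scaler_sumr; apply: eq_bigr => i _; rewrite scalerA.
Qed.

Lemma lspan_sum n (a : 'I_n -> K) (x : 'I_n -> V) :
  (forall i, lspan X (x i)) -> lspan X (\sum_(i < n) a i *: x i).
Proof.
by move=> Xx; elim/big_ind: _ => [|u v|i _];
  [exact: lspan0|exact: lspanD|exact: lspanZ].
Qed.

End Span.

Lemma closure_normP (K : numFieldType) (V : normedModType K) (X : set V) (x : V) :
  closure X x <-> forall e : K, 0 < e -> exists2 y, X y & `|x - y| < e.
Proof.
split=> [Xx e e0|Xx U /nbhs_ballP[e /= e0 eU]].
  have [y [Xy]] := Xx _ (nbhsx_ballx x e e0).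
  by rewrite -ball_normE /= => xy; exists y.
have [y Xy xy] := Xx e e0; exists y; split=> //.
by apply: eU; rewrite -ball_normE.
Qed.

Lemma closure_lipschitz (K : numFieldType) (V W : normedModType K)
    (X : set V) (Y : set W) (f : V -> W) (c : K) : 0 <= c ->
  (forall x y, `|f x - f y| <= c * `|x - y|) -> (forall x, X x -> Y (f x)) ->
  forall x, closure X x -> closure Y (f x).
Proof.
move=> c0 fc fXY x /closure_normP Xx; apply/closure_normP => e e0.
have c1 : 0 < c + 1 by rewrite ltr_wpDl.
have [y Xy xy] := Xx (e / (c + 1)) (divr_gt0 e0 c1).
exists (f y); first exact: fXY.
apply: (le_lt_trans (fc x y)); apply: (@le_lt_trans _ _ ((c + 1) * `|x - y|)).
  by rewrite ler_wpM2r// lerDl.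
by rewrite mulrC -ltr_pdivlMr.
Qed.

Lemma closure_add (K : numFieldType) (V : normedModType K) (X : set V) :
  (forall x y, X x -> X y -> X (x + y)) ->
  forall x y, closure X x -> closure X y -> closure X (x + y).
Proof.
move=> XD x y /closure_normP Xx /closure_normP Xy; apply/closure_normP => e e0.
have e20 : 0 < e / 2 by rewrite divr_gt0.
have [x' Xx' xx'] := Xx _ e20; have [y' Xy' yy'] := Xy _ e20.
exists (x' + y'); first exact: XD.
rewrite opprD addrACA (le_lt_trans (ler_normD _ _))// [e]splitr.
exact: ltrD.
Qed.

Section RangeIdeal.
Context (R : realType) (B : cstarAlgType R) (E : hilbertModType B).

Definition inner_values : set B := [set inner p.1 p.2 | p in [set: E * E]].

Definition range_ideal_pred : {pred B} :=
  fun b => `[< closure (lspan inner_values) b >].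

Record range_ideal := RangeIdeal {
  range_ideal_val :> B;
  _ : range_ideal_val \in range_ideal_pred }.

HB.instance Definition _ := [isSub for range_ideal_val].
HB.instance Definition _ := [Choice of range_ideal by <:].

Lemma range_ideal_submod_closed : submod_closed range_ideal_pred.
Proof.
split; first by apply/asboolP/subset_closure/lspan0.
move=> a x y /asboolP xB /asboolP yB; apply/asboolP.
apply: closure_add => //; first exact: lspanD.
apply: (closure_lipschitz (c := `|a|) _ _ _ xB) => // [u v|u].
  by rewrite -scalerBr normrZ.
exact: lspanZ.
Qed.

HB.instance Definition _ :=
  GRing.isSubmodClosed.Build _ _ range_ideal_pred range_ideal_submod_closed.
HB.instance Definition _ :=
  [SubChoice_isSubLmodule of range_ideal by <:].

Lemma cmulBr (a b c : B) : cmul a (b - c) = cmul a b - cmul a c.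
Proof. by rewrite cmulDr -[- c]scaleN1r cmulZr scaleN1r. Qed.

Lemma cmulBl (a b c : B) : cmul (a - b) c = cmul a c - cmul b c.
Proof. by rewrite cmulDl -[- b]scaleN1r cmulZl scaleN1r. Qed.

Lemma cstarB (a b : B) : cstar (a - b) = cstar a - cstar b.
Proof.
by rewrite cstarD -[in LHS]scaleN1r cstarZ rmorphN1 scaleN1r.
Qed.

Lemma lspan_map (f : B -> B) (s : R[i] -> R[i]) :
    {morph f : x y / x + y} -> (forall a x, f (a *: x) = s a *: f x) ->
    s 0 = 0 -> (forall x, inner_values x -> inner_values (f x)) ->
  forall x, lspan inner_values x -> lspan inner_values (f x).
Proof.
move=> fD fZ s0 fX x [n [a [u [Xu ->]]]].
have f0 : f 0 = 0 by rewrite -(scale0r (0 : B)) fZ s0 !scale0r.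
exists n, (s \o a), (f \o u); split=> [i|]; first exact: fX.
by rewrite (big_morph f fD f0); apply: eq_bigr => i _; rewrite fZ.
Qed.

Lemma range_ideal_mulr (b c : B) :
  b \in range_ideal_pred -> cmul b c \in range_ideal_pred.
Proof.
move=> /asboolP bB; apply/asboolP.
apply: (closure_lipschitz (f := fun b => cmul b c) (c := `|c|) _ _ _ bB) => //.
  by move=> x y; rewrite -cmulBl mulrC normr_cmul.
apply: (@lspan_map _ id) => // [x y|a x|_ [[x y] _ <-]] /=.
- exact: cmulDl.
- exact: cmulZl.
- by exists (x, ract y c) => //=; rewrite inner_ract.
Qed.

Lemma range_ideal_star (b : B) :
  b \in range_ideal_pred -> cstar b \in range_ideal_pred.
Proof.
move=> /asboolP bB; apply/asboolP.
apply: (closure_lipschitz (c := 1) _ _ _ bB) => //.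
  by move=> x y; rewrite mul1r -cstarB normr_cstarE.
apply: (lspan_map (s := conjc)) => // [x y|a x||_ [[x y] _ <-]] /=.
- exact: cstarD.
- exact: cstarZ.
- exact: conjc0.
- by exists (y, x) => //=; rewrite inner_star.
Qed.

Lemma inner_in_range_ideal (x y : E) : (inner x y : B) \in range_ideal_pred.
Proof. by apply/asboolP/subset_closure/sub_lspan; exists (x, y). Qed.

Definition range_ideal_ract (b : range_ideal) (c : B) : range_ideal :=
  RangeIdeal (range_ideal_mulr c (valP b)).

Definition range_ideal_inner (b c : range_ideal) : B :=
  cmul (cstar (val b)) (val c).

Definition range_ideal_cstar (b : range_ideal) : range_ideal :=
  RangeIdeal (range_ideal_star (valP b)).

Definition innerI (x y : E) : range_ideal := RangeIdeal (inner_in_range_ideal x y).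

Fact range_ideal_ractDl x y b :
  range_ideal_ract (x + y) b = range_ideal_ract x b + range_ideal_ract y b.
Proof. by apply: val_inj; exact: cmulDl. Qed.

Fact range_ideal_ractDr x b c :
  range_ideal_ract x (b + c) = range_ideal_ract x b + range_ideal_ract x c.
Proof. by apply: val_inj; exact: cmulDr. Qed.

Fact range_ideal_ractM x b c :
  range_ideal_ract x (cmul b c) = range_ideal_ract (range_ideal_ract x b) c.
Proof. by apply: val_inj; exact: cmulA. Qed.

Fact range_ideal_ractZl (a : R[i]) x b :
  range_ideal_ract (a *: x) b = a *: range_ideal_ract x b.
Proof. by apply: val_inj; exact: cmulZl. Qed.

Fact range_ideal_ractZr (a : R[i]) x b :
  range_ideal_ract x (a *: b) = a *: range_ideal_ract x b.
Proof. by apply: val_inj; exact: cmulZr. Qed.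

Fact range_ideal_innerDr x y z :
  range_ideal_inner x (y + z) = range_ideal_inner x y + range_ideal_inner x z.
Proof. exact: cmulDr. Qed.

Fact range_ideal_innerZr (a : R[i]) x y :
  range_ideal_inner x (a *: y) = a *: range_ideal_inner x y.
Proof. exact: cmulZr. Qed.

Fact range_ideal_inner_ract x y b :
  range_ideal_inner x (range_ideal_ract y b) = cmul (range_ideal_inner x y) b.
Proof. exact: cmulA. Qed.

Fact range_ideal_inner_star x y :
  cstar (range_ideal_inner x y) = range_ideal_inner y x.
Proof. by rewrite /range_ideal_inner cstarM cstarK. Qed.

Fact range_ideal_nondegenerate x :
  (forall y, range_ideal_inner x y = 0) -> x = 0.
Proof.
move=> /(_ x) xx; apply: val_inj; apply/normr0_eq0/eqP.
have : `|val x| ^+ 2 == 0 :> R[i] by rewrite -normr_cstar [X in `|X|]xx normr0.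
by rewrite expf_eq0.
Qed.

HB.instance Definition _ :=
  @Lmodule_isInnerProductModule.Build R B range_ideal
    range_ideal_ract range_ideal_inner
    range_ideal_ractDl range_ideal_ractDr range_ideal_ractM
    range_ideal_ractZl range_ideal_ractZr range_ideal_innerDr
    range_ideal_innerZr range_ideal_inner_ract range_ideal_inner_star
    range_ideal_nondegenerate.

End RangeIdeal.

Section DirectSum.
Context (R : realType) (B : cstarAlgType R) (H1 H2 : innerModType B).

Definition dsum_ract (x : H1 * H2) (b : B) : H1 * H2 :=
  (ract x.1 b, ract x.2 b).

Definition dsum_inner (x y : H1 * H2) : B :=
  inner x.1 y.1 + inner x.2 y.2.

Fact dsum_ractDl x y b : dsum_ract (x + y) b = dsum_ract x b + dsum_ract y b.
Proof. by rewrite /dsum_ract !ractDl. Qed.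

Fact dsum_ractDr x b c : dsum_ract x (b + c) = dsum_ract x b + dsum_ract x c.
Proof. by rewrite /dsum_ract !ractDr. Qed.

Fact dsum_ractM x b c : dsum_ract x (cmul b c) = dsum_ract (dsum_ract x b) c.
Proof. by rewrite /dsum_ract !ractM. Qed.

Fact dsum_ractZl (a : R[i]) x b : dsum_ract (a *: x) b = a *: dsum_ract x b.
Proof. by rewrite /dsum_ract !ractZl. Qed.

Fact dsum_ractZr (a : R[i]) x b : dsum_ract x (a *: b) = a *: dsum_ract x b.
Proof. by rewrite /dsum_ract !ractZr. Qed.

Fact dsum_innerDr x y z : dsum_inner x (y + z) = dsum_inner x y + dsum_inner x z.
Proof. by rewrite /dsum_inner !innerDr addrACA. Qed.

Fact dsum_innerZr (a : R[i]) x y : dsum_inner x (a *: y) = a *: dsum_inner x y.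
Proof. by rewrite /dsum_inner !innerZr scalerDr. Qed.

Fact dsum_inner_ract x y b :
  dsum_inner x (dsum_ract y b) = cmul (dsum_inner x y) b.
Proof. by rewrite /dsum_inner !inner_ract cmulDl. Qed.

Fact dsum_inner_star x y : cstar (dsum_inner x y) = dsum_inner y x.
Proof. by rewrite /dsum_inner cstarD !inner_star. Qed.

Fact dsum_nondegenerate x : (forall y, dsum_inner x y = 0) -> x = 0.
Proof.
case: x => x1 x2 x0; congr pair; apply: (@inner_nondegenerate _ B) => y.
  by have := x0 (y, 0); rewrite /dsum_inner /= inner0r addr0.
by have := x0 (0, y); rewrite /dsum_inner /= inner0r add0r.
Qed.

HB.instance Definition _ :=
  @Lmodule_isInnerProductModule.Build R B (H1 * H2)%type
    dsum_ract dsum_inner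
    dsum_ractDl dsum_ractDr dsum_ractM dsum_ractZl dsum_ractZr dsum_innerDr
    dsum_innerZr dsum_inner_ract dsum_inner_star dsum_nondegenerate.

End DirectSum.

(* K(B_E (+) E): here B_E is a Hilbert B-module with <b, c> = b^* c. *)
Definition linking_algebra (R : realType) (B : cstarAlgType R)
    (E : hilbertModType B) : set (adjointable (range_ideal E * E)%type) :=
  compact_ops (H := (range_ideal E * E)%type).

Arguments linking_algebra {R B} E _.

Section Corners.
Context (R : realType) (B : cstarAlgType R) (E : hilbertModType B).
Local Notation BE := (range_ideal E * E)%type.

Definition entry11_fun (b : range_ideal E) (p : BE) : BE :=
  (range_ideal_ract b (val p.1), 0).
Definition entry12_fun (x : E) (p : BE) : BE := (innerI x p.2, 0).
Definition entry21_fun (x : E) (p : BE) : BE := (0, ract x (val p.1)).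
Definition entry22_fun (k : E -> E) (p : BE) : BE := (0, k p.2).

Lemma entry11_adjoint b :
  is_adjoint (entry11_fun b) (entry11_fun (range_ideal_cstar b)).
Proof.
move=> p q; rewrite /inner /= /dsum_inner /= inner0l inner0r.
by congr (_ + _); rewrite /inner /= /range_ideal_inner /= cstarM cmulA.
Qed.

Lemma entry12_adjoint x : is_adjoint (entry12_fun x) (entry21_fun x).
Proof.
move=> p q; rewrite /inner /= /dsum_inner /= inner0l inner0r addrC.
by congr (_ + _); rewrite inner_ract [LHS]/inner /= /range_ideal_inner /= inner_star.
Qed.

Lemma entry22_adjoint (k k' : E -> E) :
  is_adjoint k k' -> is_adjoint (entry22_fun k) (entry22_fun k').
Proof.
move=> kk' p q; rewrite /inner /= /dsum_inner /= inner0l inner0r.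
by rewrite kk'.
Qed.

(* The operators on B_E (+) E with a single nonzero matrix entry, namely
   b at 11, x^* at 12, x at 21 and k at 22. *)
Definition entry11 (b : range_ideal E) := mk_adjointable (entry11_adjoint b).
Definition entry12 (x : E) := mk_adjointable (entry12_adjoint x).
Definition entry21 (x : E) :=
  mk_adjointable (is_adjoint_sym (entry12_adjoint x)).
Definition entry22 (k : adjointable E) :=
  mk_adjointable (entry22_adjoint (adjopP k)).

Definition corner11 : set (adjointable BE) := range entry11.
Definition corner12 : set (adjointable BE) := range entry12.
Definition corner21 : set (adjointable BE) := range entry21.
Definition corner22 : set (adjointable BE) := entry22 @` compact_ops (H := E).

End Corners.

Arguments corner11 {R B} E _.
Arguments corner12 {R B} E _.
Arguments corner21 {R B} E _.
Arguments corner22 {R B} E _.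

(* A map defined on a set X of operators is a total function of which only
   the values on X matter. *)
Definition star_homomorphism (R : realType) (B C : cstarAlgType R)
    (H : innerModType B) (H' : innerModType C)
    (X : set (adjointable H)) (Y : set (adjointable H'))
    (f : adjointable H -> adjointable H') : Prop :=
  [/\ set_fun X Y f,
      forall (a : R[i]) S T, X S -> X T -> f (a *: S + T) = a *: f S + f T,
      forall S T, X S -> X T -> f (compop S T) = compop (f S) (f T) &
      forall T, X T -> f (adjop T) = adjop (f T)].

Definition blockwise (R : realType) (B C : cstarAlgType R)
    (E : hilbertModType B) (F : hilbertModType C)
    (f : adjointable (range_ideal E * E)%type ->
         adjointable (range_ideal F * F)%type) : Prop :=
  [/\ set_fun (corner11 E) (corner11 F) f,
      set_fun (corner12 E) (corner12 F) f,
      set_fun (corner21 E) (corner21 F) f &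
      set_fun (corner22 E) (corner22 F) f].

Definition short_exact (U V W : zmodType) (X : set U) (Y : set V) (Z : set W)
    (f : U -> V) (g : V -> W) : Prop :=
  [/\ [set x | X x /\ f x = 0] = [set 0],
      f @` X = [set y | Y y /\ g y = 0] &
      g @` Y = Z].

Definition ternary_homomorphism (R : realType) (B C : cstarAlgType R)
    (E : hilbertModType B) (F : hilbertModType C) (u : E -> F) : Prop :=
  linear u /\ forall x y z : E,
    u (ract x (inner y z : B)) = ract (u x) (inner (u y) (u z) : C).

Definition hilbert_extension (R : realType) (A B C : cstarAlgType R)
    (G : hilbertModType A) (E : hilbertModType B) (F : hilbertModType C)
    (v : G -> E) (u : E -> F) : Prop :=
  [/\ ternary_homomorphism v, ternary_homomorphism u &
      short_exact [set: G] [set: E] [set: F] v u].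

Definition blockwise_extension (R : realType) (A B C : cstarAlgType R)
    (G : hilbertModType A) (E : hilbertModType B) (F : hilbertModType C)
    (Psi : adjointable (range_ideal G * G)%type ->
           adjointable (range_ideal E * E)%type)
    (Phi : adjointable (range_ideal E * E)%type ->
           adjointable (range_ideal F * F)%type) : Prop :=
  [/\ star_homomorphism (linking_algebra G) (linking_algebra E) Psi,
      star_homomorphism (linking_algebra E) (linking_algebra F) Phi,
      blockwise Psi, blockwise Phi &
      short_exact (linking_algebra G) (linking_algebra E)
        (linking_algebra F) Psi Phi].

Definition restricts21 (R : realType) (B C : cstarAlgType R)
    (E : hilbertModType B) (F : hilbertModType C)
    (f : adjointable (range_ideal E * E)%type ->
         adjointable (range_ideal F * F)%type) (u : E -> F) : Prop :=
  forall x : E, f (entry21 x) = entry21 (u x).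

(* Main.v *)
(* A ternary homomorphism u : E -> F is contractive, so <x,y> |-> <ux,uy> extends
   to a homomorphism phi of the range ideals, and U = phi + u is a ternary
   homomorphism of the modules underlying the linking algebras. A ternary
   homomorphism U of Hilbert modules induces a homomorphism x y^* |-> (Ux)(Uy)^*
   of compact operators: on finite rank operators it is contractive because the
   norm of S^* S is the limit of the 2^k-th roots of those of its 2^k-th powers,
   and these are bounded up to a constant depending on S only. Such homomorphisms
   have closed range: T (1 + T^* T)^-1 has norm at most 1/2 and, when the image
   of T has norm at most 1, its image is within 1/2 of that of T. Exactness
   follows, since an operator T in the kernel is a limit of operators T Y T with Y
   of finite rank, and T x x'^* T = (T x)(T^* x')^* with T x and T^* x' in the
   kernel of U. A homomorphism of linking algebras is determined by its
   21-corner because multiplication by 21- and 12-corners separates points.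

   All order-theoretic facts on C^*-algebras are derived from norm estimates,
   without spectral theory, in the algebra of adjointable operators of a module;
   that algebra is unital, whereas the C^*-algebras need not be. *)
Require Import Defs.
From HB Require Import structures.
From mathcomp Require Import all_boot all_order all_algebra.
From mathcomp Require Import complex ring lra.
From mathcomp Require Import all_classical all_reals topology normedtype.

Set Implicit Arguments.
Unset Strict Implicit.
Unset Printing Implicit Defensive.

Import Order.TTheory GRing.Theory Num.Theory.
Import numFieldNormedType.Exports.

Local Open Scope classical_set_scope.
Local Open Scope ring_scope.
Local Open Scope complex_scope.

(** The circle is broken by the algebra as a module over itself, where Cauchy-Schwarz is
    submultiplicativity of the norm. The operator theory therefore takes Cauchy-Schwarz and
    completeness as hypotheses; it is applied to that module first and to all others afterwards. The
    assignments on generators x y^* and <x, y> are not visibly well defined on spans. They are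
    treated as relations, spans of pairs in a product, which turn out to be functions once they are
    shown to be contractive. Modules need not be full and algebras need no unit, so corner elements
    are reached only as limits: x of x b, and b of b c b with b, c in the range ideal. Both come
    from one estimate, |T (1 - T^* T)^n| <= 1 / sqrt n for |T| <= 1. *)

Lemma realCD (R : rcfType) (a b : R) : (a + b)%:C = a%:C + b%:C.
Proof. exact: rmorphD. Qed.

Lemma realCM (R : rcfType) (a b : R) : (a * b)%:C = a%:C * b%:C.
Proof. exact: rmorphM. Qed.

(** * Norms and adjointable operators *)

Section Modulus.
Context (R : rcfType).
Implicit Types (a : R[i]) (r : R).

(** Norms over [R[i]] are valued in [R[i]]. Real parts are taken so that estimates live in the
    ordered field [R], where [lra] and [nra] apply. *)
Definition modc a : R := complex.Re `|a|.

Lemma modcE a : `|a| = (modc a)%:C.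
Proof. by rewrite /modc RRe_real// ger0_real. Qed.

Lemma modc_ge0 a : 0 <= modc a.
Proof. by rewrite -ler0c -modcE. Qed.

Lemma modcR r : modc r%:C = `|r|.
Proof. by rewrite /modc normc_def /= expr0n /= addr0 sqrtr_sqr. Qed.

Lemma modcJ a : modc (a^*)%C = modc a.
Proof. by rewrite /modc normcJ. Qed.

End Modulus.

Section RealNorm.
Context (R : realType) (V : normedModType R[i]).
Implicit Types (x y : V).

Definition nrm x : R := complex.Re `|x|.

Lemma nrmE x : `|x| = (nrm x)%:C.
Proof. by rewrite /nrm RRe_real// ger0_real. Qed.

Lemma nrm_ge0 x : 0 <= nrm x.
Proof. by rewrite -ler0c -nrmE. Qed.

Lemma nrm0 : nrm 0 = 0.
Proof. by apply: complexI; rewrite -nrmE normr0. Qed.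

Lemma nrm_eq0 x : nrm x = 0 -> x = 0.
Proof. by move=> x0; apply/normr0_eq0; rewrite nrmE x0. Qed.

Lemma nrmD x y : nrm (x + y) <= nrm x + nrm y.
Proof. by rewrite -lecR realCD -!nrmE ler_normD. Qed.

Lemma nrmN x : nrm (- x) = nrm x.
Proof. by rewrite /nrm normrN. Qed.

Lemma nrmBC x y : nrm (x - y) = nrm (y - x).
Proof. by rewrite -nrmN opprB. Qed.

Lemma nrmZ (a : R[i]) x : nrm (a *: x) = modc a * nrm x.
Proof.
by apply: complexI; rewrite -nrmE normrZ realCM -nrmE modcE.
Qed.

End RealNorm.

Section CStarNorm.
Context (R : realType) (B : cstarAlgType R).
Implicit Types b c : B.

Lemma nrmM b c : nrm (cmul b c) <= nrm b * nrm c.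
Proof. by rewrite -lecR realCM -!nrmE normr_cmul. Qed.

Lemma nrm_star b : nrm (cstar b) = nrm b.
Proof. by rewrite /nrm normr_cstarE. Qed.

Lemma nrm_cstar b : nrm (cmul (cstar b) b) = nrm b ^+ 2.
Proof. by apply: complexI; rewrite -nrmE normr_cstar !expr2 realCM -nrmE. Qed.

End CStarNorm.

Section AdjointableAlgebra.
Context (R : realType) (B : cstarAlgType R) (H : innerModType B).
Implicit Types (x y z : H) (S T : adjointable H).

Lemma inner_inj x y : (forall z, inner z x = inner z y :> B) -> x = y.
Proof.
move=> xy; apply/eqP; rewrite -subr_eq0; apply/eqP.
apply: (@inner_nondegenerate _ B) => z.
rewrite -inner_star innerDr -[- y]scaleN1r innerZr scaleN1r xy subrr.
by rewrite -[X in cstar X](scale0r (0 : B)) cstarZ conjc0 scale0r.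
Qed.

Lemma adj_inj S T : (forall x, S x = T x) -> S = T.
Proof. by move=> ST; apply: val_inj; apply/funext. Qed.

Lemma addopE S T x : (S + T) x = S x + T x. Proof. by []. Qed.
Lemma oppopE T x : (- T) x = - T x. Proof. by []. Qed.
Lemma subopE S T x : (S - T) x = S x - T x. Proof. by []. Qed.
Lemma scaleopE (a : R[i]) T x : (a *: T) x = a *: T x. Proof. by []. Qed.
Lemma zeroopE x : (0 : adjointable H) x = 0. Proof. by []. Qed.

Lemma innerBr x y z : inner z (x - y) = inner z x - inner z y :> B.
Proof. by rewrite innerDr -[- y]scaleN1r innerZr scaleN1r. Qed.

Lemma innerBl x y z : inner (x - y) z = inner x z - inner y z :> B.
Proof. by rewrite innerDl -[- y]scaleN1r innerZl rmorphN1 scaleN1r. Qed.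

Lemma inner_adjr T x y : inner x (T y) = inner (adjop T x) y :> B.
Proof. by rewrite -inner_star adjopP inner_star. Qed.

(** Adjointable maps are bare functions; linearity is forced by the adjoint and nondegeneracy. *)
Lemma opD T x y : T (x + y) = T x + T y.
Proof. by apply: inner_inj => z; rewrite inner_adjr !innerDr !inner_adjr. Qed.

Lemma opZ T (a : R[i]) x : T (a *: x) = a *: T x.
Proof. by apply: inner_inj => z; rewrite inner_adjr !innerZr !inner_adjr. Qed.

Lemma op0 T : T 0 = 0.
Proof. by rewrite -(scale0r (0 : H)) opZ !scale0r. Qed.

Lemma op_ract T x (b : B) : T (ract x b) = ract (T x) b.
Proof. by apply: inner_inj => z; rewrite inner_adjr !inner_ract inner_adjr. Qed.

Lemma adjop_unique (T S : adjointable H) : is_adjoint T S -> adjop T = S.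
Proof.
move=> TS; apply: adj_inj => x; apply: inner_inj => z.
by rewrite -adjopP TS.
Qed.

Lemma adjopK T : adjop (adjop T) = T.
Proof. exact/adjop_unique/is_adjoint_sym/adjopP. Qed.

Lemma adjopD S T : adjop (S + T) = adjop S + adjop T.
Proof. by apply: adjop_unique => x y; rewrite innerDl innerDr !adjopP. Qed.

Lemma adjopZ (a : R[i]) T : adjop (a *: T) = (a^*)%C *: adjop T.
Proof. by apply: adjop_unique => x y; rewrite innerZl innerZr adjopP. Qed.

Lemma adjopN T : adjop (- T) = - adjop T.
Proof. by rewrite -scaleN1r adjopZ rmorphN1 scaleN1r. Qed.

Lemma adjopB S T : adjop (S - T) = adjop S - adjop T.
Proof. by rewrite adjopD adjopN. Qed.

Lemma adjop0 : adjop (0 : adjointable H) = 0.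
Proof. by rewrite -(scale0r (0 : adjointable H)) adjopZ conjc0 !scale0r. Qed.

Lemma adjop_comp S T : adjop (compop S T) = compop (adjop T) (adjop S).
Proof. by apply: adjop_unique => x y; rewrite /= !adjopP. Qed.

Lemma is_adjoint_id : is_adjoint (@id H) id.
Proof. by []. Qed.

Definition idop : adjointable H := mk_adjointable is_adjoint_id.

Fact compopA : associative (@compop R B H).
Proof. by move=> S T U; apply: adj_inj. Qed.

Fact compop1 : left_id idop (@compop R B H).
Proof. by move=> T; apply: adj_inj. Qed.

Fact comp1op : right_id idop (@compop R B H).
Proof. by move=> T; apply: adj_inj. Qed.

Fact compopDl : left_distributive (@compop R B H) +%R.
Proof. by move=> S T U; apply: adj_inj. Qed.

Fact compopDr : right_distributive (@compop R B H) +%R.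
Proof. by move=> S T U; apply: adj_inj => x /=; rewrite opD. Qed.

HB.instance Definition _ := GRing.Zmodule_isPzRing.Build (adjointable H)
  compopA compop1 comp1op compopDl compopDr.

Lemma mulopE S T x : (S * T) x = S (T x). Proof. by []. Qed.
Lemma oneopE x : (1 : adjointable H) x = x. Proof. by []. Qed.

Lemma scaleopAl (a : R[i]) S T : a *: (S * T) = (a *: S) * T.
Proof. by apply: adj_inj. Qed.

Lemma scaleopAr (a : R[i]) S T : a *: (S * T) = S * (a *: T).
Proof. by apply: adj_inj => x; rewrite !(mulopE, scaleopE) opZ. Qed.

Lemma adjopM S T : adjop (S * T) = adjop T * adjop S.
Proof. exact: adjop_comp. Qed.

Lemma adjop1 : adjop 1 = 1 :> adjointable H.
Proof. exact: adjop_unique. Qed.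

Lemma adjopX T n : adjop (T ^+ n) = adjop T ^+ n.
Proof.
elim: n => [|n IHn]; first by rewrite !expr0 adjop1.
by rewrite exprS adjopM IHn exprSr.
Qed.

End AdjointableAlgebra.

Definition hnrm (R : realType) (B : cstarAlgType R) (H : innerModType B)
  (x : H) : R := Num.sqrt (nrm (inner x x : B)).

(** Kept as a hypothesis of the operator theory: [self_cauchy_schwarz] obtains it from the norm
    alone, and [hpositive_cauchy_schwarz] from positivity, which rests on that operator theory. *)
Definition cauchy_schwarz (R : realType) (B : cstarAlgType R)
    (H : innerModType B) : Prop :=
  forall x y : H, nrm (inner x y : B) <= hnrm x * hnrm y.

(* The values of e need only be arbitrarily small: convergence rates below are
   used through bounds valid for all larger indices. *)
Definition vanishing (R : realType) (e : nat -> R) : Prop :=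
  forall d : R, 0 < d -> exists n, e n < d.

Definition hcomplete (R : realType) (B : cstarAlgType R)
    (H : innerModType B) : Prop :=
  forall (x : nat -> H) (e : nat -> R), vanishing e ->
    (forall m n, (n <= m)%N -> hnrm (x m - x n) <= e n) ->
    exists l, forall n, hnrm (l - x n) <= e n.

Section OperatorNorm.
Context (R : realType) (B : cstarAlgType R) (H : innerModType B).
Hypothesis cs : cauchy_schwarz H.
Implicit Types (x y z : H) (S T X Y Z : adjointable H) (c d : R).

Lemma hnrm_ge0 x : 0 <= hnrm x.
Proof. exact: sqrtr_ge0. Qed.

Lemma hnrm_sqr x : hnrm x ^+ 2 = nrm (inner x x : B).
Proof. by rewrite sqr_sqrtr// nrm_ge0. Qed.

Lemma hnrm0 : hnrm (0 : H) = 0.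
Proof. by rewrite /hnrm inner0r nrm0 sqrtr0. Qed.

Lemma hnrm_eq0 x : hnrm x = 0 -> x = 0.
Proof.
move=> x0; apply: (@inner_nondegenerate _ B) => y; apply: nrm_eq0.
by apply/eqP; rewrite eq_le nrm_ge0 andbT (le_trans (cs _ _))// x0 mul0r.
Qed.

Lemma hnrmZ (a : R[i]) x : hnrm (a *: x) = modc a * hnrm x.
Proof.
rewrite /hnrm innerZl innerZr !nrmZ mulrA modcJ sqrtrM ?mulr_ge0 ?modc_ge0//.
by rewrite -expr2 sqrtr_sqr ger0_norm ?modc_ge0.
Qed.

Lemma hnrmZR c x : hnrm (c%:C *: x) = `|c| * hnrm x.
Proof. by rewrite hnrmZ modcR. Qed.

Lemma hnrmN x : hnrm (- x) = hnrm x.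
Proof. by rewrite -scaleN1r -(rmorphN1 (real_complex R)) hnrmZR normrN1 mul1r. Qed.

Lemma hnrmBC x y : hnrm (x - y) = hnrm (y - x).
Proof. by rewrite -hnrmN opprB. Qed.

Lemma hnrmD x y : hnrm (x + y) <= hnrm x + hnrm y.
Proof.
rewrite -(ler_pXn2r (n := 2))// ?nnegrE ?addr_ge0 ?hnrm_ge0// hnrm_sqr.
rewrite innerDl !innerDr (le_trans (nrmD _ _))//.
have := nrmD (inner x x : B) (inner x y).
have := nrmD (inner y x : B) (inner y y).
have := cs x y; have := cs y x; rewrite -!hnrm_sqr => *.
rewrite sqrrD; nra.
Qed.

Lemma hnrm_ract x (b : B) : hnrm (ract x b) <= hnrm x * nrm b.
Proof.
rewrite -(ler_pXn2r (n := 2))// ?nnegrE ?mulr_ge0 ?nrm_ge0 ?hnrm_ge0//.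
rewrite hnrm_sqr inner_ract inner_ractl (le_trans (nrmM _ _))//.
rewrite exprMn hnrm_sqr expr2 mulrA ler_wpM2r ?nrm_ge0// mulrC.
by rewrite (le_trans (nrmM _ _))// nrm_star mulrC.
Qed.

(** Replaces the operator norm: an element of [adjointable] is not known to be bounded, so its norm
    need not exist as a real number. *)
Definition bnd T c : Prop := forall x, hnrm (T x) <= c * hnrm x.

Lemma bndW T c d : c <= d -> bnd T c -> bnd T d.
Proof. by move=> cd Tc x; rewrite (le_trans (Tc x))// ler_wpM2r ?hnrm_ge0. Qed.

Lemma bnd0 c : 0 <= c -> bnd 0 c.
Proof. by move=> c0 x; rewrite zeroopE hnrm0 mulr_ge0 ?hnrm_ge0. Qed.

Lemma bnd1 : bnd 1 1.
Proof. by move=> x; rewrite mul1r. Qed.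

Lemma bndD S T c d : bnd S c -> bnd T d -> bnd (S + T) (c + d).
Proof.
by move=> Sc Td x; rewrite (le_trans (hnrmD _ _))// mulrDl lerD ?Sc ?Td.
Qed.

Lemma bndN T c : bnd T c -> bnd (- T) c.
Proof. by move=> Tc x; rewrite oppopE hnrmN Tc. Qed.

Lemma bndB S T c d : bnd S c -> bnd T d -> bnd (S - T) (c + d).
Proof. by move=> Sc Td; apply: bndD => //; exact: bndN. Qed.

Lemma bndBC S T c : bnd (S - T) c -> bnd (T - S) c.
Proof. by move=> /bndN; rewrite opprB. Qed.

Lemma bndZ (a : R[i]) T c : bnd T c -> bnd (a *: T) (modc a * c).
Proof.
by move=> Tc x; rewrite scaleopE hnrmZ -mulrA ler_wpM2l ?modc_ge0 ?Tc.
Qed.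

Lemma bndZR d T c : bnd T c -> bnd (d%:C *: T) (`|d| * c).
Proof. by move=> /(bndZ d%:C); rewrite modcR. Qed.

Lemma bndM S T c d : 0 <= c -> bnd S c -> bnd T d -> bnd (S * T) (c * d).
Proof.
move=> c0 Sc Td x; rewrite mulopE (le_trans (Sc _))// -mulrA.
by rewrite ler_wpM2l.
Qed.

Lemma bndX T c n : 0 <= c -> bnd T c -> bnd (T ^+ n) (c ^+ n).
Proof.
move=> c0 Tc; elim: n => [|n IHn]; first by rewrite !expr0; exact: bnd1.
by rewrite !exprS; exact: bndM.
Qed.

Lemma bnd_eps T c : (forall e, 0 < e -> bnd T (c + e)) -> bnd T c.
Proof.
move=> Tc x; apply/ler_addgt0Pr => e e0.
have x1 : 0 < hnrm x + 1 by rewrite ltr_wpDl ?hnrm_ge0.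
rewrite (le_trans (Tc (e / (hnrm x + 1)) (divr_gt0 e0 x1) x))// mulrDl lerD2l.
by rewrite mulrAC ler_pdivrMr// ler_pM2l// lerDl.
Qed.

Lemma bnd0_eq0 T : bnd T 0 -> T = 0.
Proof.
move=> T0; apply: adj_inj => x; apply: hnrm_eq0.
by apply/eqP; rewrite eq_le hnrm_ge0 andbT; have := T0 x; rewrite mul0r.
Qed.

(** By Cauchy-Schwarz |T^* x|^2 = |<T T^* x, x>| <= c |T^* x| |x|, and one factor cancels. *)
Lemma bnd_adjop T c : 0 <= c -> bnd T c -> bnd (adjop T) c.
Proof.
move=> c0 Tc x; have [->|x0] := eqVneq (hnrm (adjop T x)) 0.
  by rewrite mulr_ge0 ?hnrm_ge0.
have xgt0 : 0 < hnrm (adjop T x) by rewrite lt_def x0 hnrm_ge0.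
rewrite -(ler_pM2l xgt0) -expr2 hnrm_sqr -adjopP (le_trans (cs _ _))//.
by rewrite mulrA ler_wpM2r ?hnrm_ge0// mulrC.
Qed.

Lemma hnrm_cstar T x : hnrm (T x) ^+ 2 <= hnrm x * hnrm ((adjop T * T) x).
Proof. by rewrite hnrm_sqr adjopP cs. Qed.

Lemma bnd_cstar T c : 0 <= c -> bnd (adjop T * T) (c ^+ 2) -> bnd T c.
Proof.
move=> c0 Tc x; rewrite -(ler_pXn2r (n := 2))// ?nnegrE ?mulr_ge0 ?hnrm_ge0//.
rewrite (le_trans (hnrm_cstar T x))// exprMn mulrC expr2 mulrA.
by rewrite ler_wpM2r ?hnrm_ge0.
Qed.

End OperatorNorm.

Lemma vanishing_le0 (R : realType) (e : nat -> R) (a c : R) :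
  vanishing e -> 0 <= c -> (forall n, a <= e n * c) -> a <= 0.
Proof.
move=> e0 c0 ae; rewrite leNgt; apply/negP => a0.
have c1 : 0 < c + 1 by rewrite ltr_wpDl.
have [n en] := e0 _ (divr_gt0 a0 c1).
have : a < a; last by rewrite ltxx.
apply: le_lt_trans (ae n) _; apply: (@le_lt_trans _ _ (a / (c + 1) * c)).
  by rewrite ler_wpM2r// ltW.
by rewrite mulrAC ltr_pdivrMr// ltr_pM2l// ltrDl.
Qed.

Lemma vanishingM (R : realType) (e : nat -> R) (c : R) :
  vanishing e -> 0 <= c -> vanishing (fun n => e n * c).
Proof.
move=> e0 c0 d d0; have c1 : 0 < c + 1 by rewrite ltr_wpDl.
have [n en] := e0 _ (divr_gt0 d0 c1); exists n.
apply: (@le_lt_trans _ _ (d / (c + 1) * c)); first by rewrite ler_wpM2r// ltW.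
by rewrite mulrAC ltr_pdivrMr// ltr_pM2l// ltrDl.
Qed.

Lemma bernoulli (R : realType) (d : R) n : 0 <= d -> 1 + n%:R * d <= (1 + d) ^+ n.
Proof.
move=> d0; elim: n => [|n IHn]; first by rewrite mul0r addr0 expr0.
rewrite exprS -natr1; have n0 : 0 <= n%:R :> R by rewrite ler0n.
have : 0 <= (1 + d) ^+ n by rewrite exprn_ge0// addr_ge0.
nra.
Qed.

(** If a = 1 + d with d > 0, Bernoulli at 2^k and one squaring give a^(2^(k+1)) >= (2^k d)^2,
    quadratic in 2^k against a linear bound. *)
Lemma pow2_le1 (R : realType) (a M : R) : 0 <= a ->
  (forall k, a ^+ (2 ^ k) <= M * (2 ^ k)%:R) -> a <= 1.
Proof.
move=> a0 aM; rewrite leNgt; apply/negP => a1.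
pose d := a - 1; have d0 : 0 < d by rewrite subr_gt0.
have bound k : (2 ^ k)%:R * d ^+ 2 <= 2 * M.
  have n0 : 0 < (2 ^ k)%:R :> R by rewrite ltr0n expn_gt0.
  have := aM k.+1; rewrite expnSr exprM natrM => aMk.
  have := @bernoulli _ d (2 ^ k) (ltW d0); rewrite (_ : 1 + d = a); last by rewrite /d addrC subrK.
  move=> ber.
  have : ((2 ^ k)%:R * d) ^+ 2 <= (a ^+ (2 ^ k)) ^+ 2.
    have nd0 : 0 <= (2 ^ k)%:R * d by rewrite mulr_ge0 ?ltW.
    apply: lerXn2r; rewrite ?nnegrE ?exprn_ge0//.
    by apply: le_trans ber; rewrite lerDr.
  move=> /le_trans/(_ aMk); rewrite exprMn.
  move: n0; set q : R := (2 ^ k)%:R => n0 h.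
  by rewrite -(ler_pM2l n0); nra.
have := archi_boundP (divr_ge0 (normr_ge0 (2 * M)) (sqr_ge0 d)).
set k := Num.bound _; rewrite ltr_pdivrMr ?exprn_gt0// => Mk.
have := le_lt_trans (ler_norm _) Mk; rewrite ltNge => /negP; apply.
apply: le_trans (bound k); rewrite ler_wpM2r ?sqr_ge0// ler_nat.
by rewrite ltnW// ltn_expl.
Qed.

(** * Limits of operators and square roots by iteration *)

Section Operators.
Context (R : realType) (B : cstarAlgType R) (H : innerModType B).
Hypotheses (cs : cauchy_schwarz H) (cH : hcomplete H).
Implicit Types (x y z : H) (S T X Y Z W : adjointable H) (c d : R).

Lemma bnd_vanishing T (e : nat -> R) c : vanishing e -> 0 <= c ->
  (forall n, bnd T (e n * c)) -> T = 0.
Proof.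
move=> e0 c0 Te; apply: adj_inj => x; apply: (hnrm_eq0 cs).
apply/eqP; rewrite eq_le hnrm_ge0 andbT.
apply: (vanishing_le0 (c := c * hnrm x) e0); first by rewrite mulr_ge0 ?hnrm_ge0.
by move=> n; rewrite mulrA Te.
Qed.

(** The adjoints satisfy the same Cauchy estimate by [bnd_adjop], and the two pointwise limits are
    adjoint to each other. *)
Lemma op_complete (T : nat -> adjointable H) (e : nat -> R) :
    vanishing e -> (forall n, 0 <= e n) ->
    (forall m n, (n <= m)%N -> bnd (T m - T n) (e n)) ->
  exists L : adjointable H, forall n, bnd (L - T n) (e n).
Proof.
move=> e0 e_ge0 Te.
have lim (S : nat -> adjointable H) :
    (forall m n, (n <= m)%N -> bnd (S m - S n) (e n)) ->
    exists L : H -> H, forall x n, hnrm (L x - S n x) <= e n * hnrm x.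
  move=> Se.
  have /choice[L LS] : forall x, exists l, forall n, hnrm (l - S n x) <= e n * hnrm x.
    move=> x; apply: (cH (e := fun n => e n * hnrm x)).
      by apply: vanishingM => //; exact: hnrm_ge0.
    by move=> m n nm; rewrite -subopE Se.
  by exists L.
have [L LT] := lim T Te.
have [S ST] : exists S : H -> H,
    forall x n, hnrm (S x - adjop (T n) x) <= e n * hnrm x.
  apply: (lim (fun n => adjop (T n))) => m n nm.
  by rewrite -adjopB; apply: bnd_adjop => //; exact: Te.
have LS : is_adjoint L S.
  move=> x y; apply/eqP; rewrite -subr_eq0; apply/eqP; apply: nrm_eq0.
  apply/eqP; rewrite eq_le nrm_ge0 andbT.
  apply: (vanishing_le0 (c := hnrm x * hnrm y *+ 2) e0).
    by rewrite mulrn_wge0 ?mulr_ge0 ?hnrm_ge0.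
  move=> n; rewrite -(subrK (inner x (adjop (T n) y)) (inner (L x) y)).
  rewrite -{1}(adjopP (T n)) -innerBl -addrA -innerBr (le_trans (nrmD _ _))//.
  rewrite mulr2n mulrDr; apply: lerD; apply: le_trans (cs _ _) _.
    by rewrite mulrA ler_wpM2r ?hnrm_ge0.
  by rewrite mulrCA ler_wpM2l ?hnrm_ge0// hnrmBC.
by exists (mk_adjointable LS) => n x; exact: LT.
Qed.

Definition bounded_op T := exists2 c, 0 < c & bnd T c.

Lemma bounded_opD S T : bounded_op S -> bounded_op T -> bounded_op (S + T).
Proof.
move=> [c c0 Sc] [d d0 Td]; exists (c + d); first exact: addr_gt0.
exact: bndD.
Qed.

Lemma bounded_opN T : bounded_op T -> bounded_op (- T).
Proof. by move=> [c c0 Tc]; exists c => //; exact: bndN. Qed.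

Lemma bounded_opB S T : bounded_op S -> bounded_op T -> bounded_op (S - T).
Proof. by move=> Sb Tb; apply: bounded_opD => //; exact: bounded_opN. Qed.

Lemma bounded_opM S T : bounded_op S -> bounded_op T -> bounded_op (S * T).
Proof.
move=> [c c0 Sc] [d d0 Td]; exists (c * d); first exact: mulr_gt0.
by apply: bndM => //; exact: ltW.
Qed.

Lemma bounded_op_bnd T c : bnd T c -> bounded_op T.
Proof.
move=> Tc; exists (`|c| + 1); first by rewrite ltr_wpDl.
by apply: bndW Tc; rewrite (le_trans (ler_norm c))// lerDl.
Qed.

Lemma bounded_opZ (a : R[i]) T : bounded_op T -> bounded_op (a *: T).
Proof. by move=> [c c0 Tc]; apply: bounded_op_bnd (bndZ a Tc). Qed.

Lemma bounded_adjop T : bounded_op T -> bounded_op (adjop T).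
Proof. by move=> [c c0 Tc]; exists c => //; apply: bnd_adjop => //; exact: ltW. Qed.

Lemma scaleopM (a b : R[i]) S T : (a *: S) * (b *: T) = (a * b) *: (S * T).
Proof. by rewrite -scaleopAl -scaleopAr scalerA. Qed.

Lemma comm_scale (a : R[i]) S T : GRing.comm S T -> GRing.comm S (a *: T).
Proof. by move=> ST; rewrite /GRing.comm -scaleopAr -scaleopAl ST. Qed.

Local Notation "t %:O" := (t%:C *: (1 : adjointable H)) (at level 2).

Lemma comm_scalar T c : GRing.comm T c%:O.
Proof. by apply: comm_scale; exact: commr1. Qed.

Lemma adjop_scale c T : adjop T = T -> adjop (c%:C *: T) = c%:C *: T.
Proof. by move=> TT; rewrite adjopZ conjc_real TT. Qed.

Lemma adjop_scalar c : adjop c%:O = c%:O.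
Proof. by apply: adjop_scale; exact: adjop1. Qed.

Lemma bnd_scalar c : 0 <= c -> bnd c%:O c.
Proof. by move=> c0 x; rewrite hnrmZR ger0_norm. Qed.

(** A fixed point Y satisfies 2 Y = X + Y^2, that is (1 - Y)^2 = 1 - X. The same iteration on
    scalars with X = 1, [sqrt_rate], majorises both the iterates and their increments. *)
Fixpoint sqrt_iter X n : adjointable H :=
  if n is n'.+1 then (2^-1)%:C *: (X + sqrt_iter X n' * sqrt_iter X n') else 0.

Fixpoint sqrt_rate n : R :=
  if n is n'.+1 then 2^-1 * (1 + sqrt_rate n' * sqrt_rate n') else 0.

Lemma sqrt_rate_bounds n : 0 <= sqrt_rate n <= 1.
Proof. elim: n => [|n /= /andP[r0 r1]]; apply/andP; split => /=; nra. Qed.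

Lemma sqrt_rate_homo m n : (n <= m)%N -> sqrt_rate n <= sqrt_rate m.
Proof.
elim: m => [|m IHm]; first by rewrite leqn0 => /eqP ->.
rewrite leq_eqVlt => /predU1P[->//|]; rewrite ltnS => /IHm /le_trans; apply.
have /andP[/= r0 r1] := sqrt_rate_bounds m; nra.
Qed.

(** With s = 1 - r the recursion reads s' = s - s^2 / 2: while s stays at least d, each step loses
    at least d^2 / 2. *)
Lemma sqrt_rate_vanishing : vanishing (fun n => 1 - sqrt_rate n).
Proof.
move=> d d0; apply: contrapT => /forallNP nd.
have big n : d <= 1 - sqrt_rate n by rewrite leNgt; apply/negP/nd.
have bound n : 1 - sqrt_rate n <= 1 - n%:R * (2^-1 * d ^+ 2).
  elim: n => [|n IHn]; first by rewrite /= mul0r.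
  have := big n; move: IHn; rewrite -(natr1 n) /=; set r := sqrt_rate n => IHn dr.
  have : d ^+ 2 <= (1 - r) ^+ 2 by apply: lerXn2r => //; rewrite nnegrE; lra.
  nra.
have e0 : 0 < 2^-1 * d ^+ 2 by rewrite mulr_gt0 ?invr_gt0 ?exprn_gt0.
have := archi_boundP (ltW (divr_gt0 (@ltr01 R) e0)).
set n := Num.bound _; rewrite ltr_pdivrMr// => n1.
have := bound n; have := big n; move: n1 d0; lra.
Qed.

Lemma sqrt_iter_adjop X n : adjop X = X -> adjop (sqrt_iter X n) = sqrt_iter X n.
Proof.
move=> XX; elim: n => [|n IHn] /=; first exact: adjop0.
by rewrite adjop_scale// adjopD XX adjopM IHn.
Qed.

Lemma sqrt_iter_comm X Z n : GRing.comm Z X -> GRing.comm Z (sqrt_iter X n).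
Proof.
move=> ZX; elim: n => [|n IHn] /=; first exact: commr0.
by apply: comm_scale; apply: commrD => //; exact: commrM.
Qed.

Lemma sqrt_iter_bnd X n : bnd X 1 -> bnd (sqrt_iter X n) (sqrt_rate n).
Proof.
move=> X1; elim: n => [|n IHn] /=; first exact: bnd0.
have /andP[r0 _] := sqrt_rate_bounds n.
rewrite -[X in bnd _ (X * _)]ger0_norm ?invr_ge0//.
by apply: bndZR; apply: (bndD cs) => //; exact: bndM.
Qed.

Lemma sub_sqr S T : S * S - T * T = S * (S - T) + (S - T) * T.
Proof. by rewrite mulrBr mulrBl addrA subrK. Qed.

(** S^2 - T^2 = S (S - T) + (S - T) T propagates the bound exactly as in the scalar iteration. *)
Lemma sqrt_iter_step X n : bnd X 1 ->
  bnd (sqrt_iter X n.+1 - sqrt_iter X n) (sqrt_rate n.+1 - sqrt_rate n).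
Proof.
move=> X1; elim: n => [|n IHn].
  by rewrite !subr0; exact: (sqrt_iter_bnd 1).
have /andP[r0 _] := sqrt_rate_bounds n.
have /andP[r0' _] := sqrt_rate_bounds n.+1.
have dr := sqrt_rate_homo (leqnSn n).
rewrite [sqrt_iter X n.+2]/= [sqrt_iter X n.+1 in X in bnd (_ - X)]/=.
rewrite -scalerBr opprD addrACA subrr add0r sub_sqr.
apply: (@bndW _ _ _ _ (`|2^-1| * (sqrt_rate n.+1 * (sqrt_rate n.+1 - sqrt_rate n)
   + (sqrt_rate n.+1 - sqrt_rate n) * sqrt_rate n))).
  have r1E : sqrt_rate n.+1 = 2^-1 * (1 + sqrt_rate n * sqrt_rate n) by [].
  have r2E : sqrt_rate n.+2 = 2^-1 * (1 + sqrt_rate n.+1 * sqrt_rate n.+1) by [].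
  rewrite ger0_norm ?invr_ge0// r2E; move: r1E; clear.
  by set r1 := sqrt_rate n.+1; set r := sqrt_rate n => r1E; nra.
apply: bndZR; apply: (bndD cs); apply: (bndM _) => //.
- exact: (sqrt_iter_bnd n.+1).
- by rewrite subr_ge0.
- exact: sqrt_iter_bnd.
Qed.

Lemma sqrt_iter_cauchy X m n : bnd X 1 -> (n <= m)%N ->
  bnd (sqrt_iter X m - sqrt_iter X n) (1 - sqrt_rate n).
Proof.
move=> X1 nm; have /andP[_ r1] := sqrt_rate_bounds m.
apply: (@bndW _ _ _ _ (sqrt_rate m - sqrt_rate n)); first by rewrite lerD2r.
elim: m nm {r1} => [|m IHm].
  by rewrite leqn0 => /eqP ->; rewrite !subrr; exact: bnd0.
rewrite leq_eqVlt => /predU1P[->|]; first by rewrite !subrr; exact: bnd0.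
rewrite ltnS => /IHm {}IHm; have := bndD cs (sqrt_iter_step m X1) IHm.
by rewrite !addrA !subrK.
Qed.

(** W = 1 - Y for the limit Y of the iteration. The bound on 1 - W makes W positive in the sense of
    [posop] below, and commutation passes to the limit because Z is bounded. *)
Lemma sqrt_one_sub X : adjop X = X -> bnd X 1 ->
  exists W, [/\ adjop W = W, bnd (1 - W) 1, W * W = 1 - X &
    forall Z, bounded_op Z -> GRing.comm Z X -> GRing.comm Z W].
Proof.
move=> XX X1; have rv := sqrt_rate_vanishing.
have r_ge0 n : 0 <= 1 - sqrt_rate n.
  by have /andP[_ r1] := sqrt_rate_bounds n; rewrite subr_ge0.
have [Y YX] := op_complete rv r_ge0 (fun m n nm => sqrt_iter_cauchy X1 nm).
have Y1 : bnd Y 1 by have := YX 0%N; rewrite /= !subr0.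
have YY : adjop Y = Y.
  apply/eqP; rewrite -subr_eq0; apply/eqP.
  apply: (bnd_vanishing (c := 2) rv) => // n.
  rewrite -(subrK (sqrt_iter X n) (adjop Y)) -addrA mulr_natr mulr2n.
  apply: (bndD cs); last by apply: bndBC => //; exact: YX.
  by rewrite -{1}(sqrt_iter_adjop n XX) -adjopB; apply: bnd_adjop.
have YE : Y = (2^-1)%:C *: (X + Y * Y).
  apply/eqP; rewrite -subr_eq0; apply/eqP.
  apply: (bnd_vanishing (c := 2) rv) => // n.
  rewrite -{1}(subrK (sqrt_iter X n.+1) Y) -addrA mulr_natr mulr2n.
  apply: (bndD cs).
    apply: (bndW _ (YX n.+1)); rewrite lerD2l lerN2.
    exact: sqrt_rate_homo.
  rewrite /= -scalerBr opprD addrACA subrr add0r sub_sqr.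
  have /andP[r0 r1] := sqrt_rate_bounds n.
  apply: (@bndW _ _ _ _ (`|2^-1| * (1 * (1 - sqrt_rate n) + (1 - sqrt_rate n) * 1))).
    by rewrite ger0_norm ?invr_ge0//; lra.
  apply: bndZR; apply: (bndD cs); apply: bndM => //.
  + by apply: (bndW r1); exact: sqrt_iter_bnd.
  + by apply: bndBC => //; exact: YX.
  + by apply: bndBC => //; exact: YX.
exists (1 - Y); split.
- by rewrite adjopB adjop1 YY.
- by rewrite opprB addrC subrK.
- have YYE : X + Y * Y = Y + Y.
    rewrite [in RHS]YE -scalerDl -realCD (_ : 2^-1 + 2^-1 = 1 :> R) ?scale1r//.
    lra.
  rewrite mulrBl mul1r mulrBr mulr1 opprB -addrA; congr (_ + _).
  have -> : X = Y + Y - Y * Y by rewrite -YYE addrK.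
  by rewrite opprB addrCA -opprD.
- move=> Z [c c0 Zc] ZX; apply: commrB; first exact: commr1.
  apply/eqP; rewrite -subr_eq0; apply/eqP.
  apply: (bnd_vanishing (c := c * 2) rv); first by rewrite mulr_ge0 ?ltW.
  move=> n; rewrite (_ : _ - _ = Z * (Y - sqrt_iter X n) - (Y - sqrt_iter X n) * Z).
    rewrite (_ : _ * (c * 2) = c * (1 - sqrt_rate n) + (1 - sqrt_rate n) * c).
      by apply: (bndB cs); apply: bndM => //; exact: ltW.
    by rewrite mulr_natr mulr2n mulrDr [c * _]mulrC.
  by rewrite mulrBr mulrBl (sqrt_iter_comm n ZX) opprB addrA subrK.
Qed.

End Operators.

Lemma sqr_iM (R : rcfType) : 'i%C * 'i%C = -1 :> R[i].
Proof. by rewrite -expr2 sqr_i. Qed.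

(** * Positive operators *)

Section Positivity.
Context (R : realType) (B : cstarAlgType R) (H : innerModType B).
Hypotheses (cs : cauchy_schwarz H) (cH : hcomplete H).
Implicit Types (x y z : H) (S T X Y Z W : adjointable H) (c d t : R).

Local Notation "t %:O" := (t%:C *: (1 : adjointable H)) (at level 2).

(* For self-adjoint X this is positivity, in the form for which sums are immediate. *)
Definition posop X := adjop X = X /\ exists2 t, 0 < t & bnd (t%:O - X) t.

Lemma posop_adjop X : posop X -> adjop X = X. Proof. by case. Qed.

Lemma posop_bounded X : posop X -> bounded_op X.
Proof.
move=> [_ [t t0 Xt]]; have := bndB cs (bnd_scalar (ltW t0)) Xt.
by rewrite opprB addrC subrK; exact: bounded_op_bnd.
Qed.

Lemma posopD X Y : posop X -> posop Y -> posop (X + Y).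
Proof.
move=> [XX [t t0 Xt]] [YY [s s0 Ys]]; split; first by rewrite adjopD XX YY.
exists (t + s); first exact: addr_gt0.
by rewrite realCD scalerDl opprD addrACA; exact: bndD.
Qed.

Lemma posopZ c X : 0 < c -> posop X -> posop (c%:C *: X).
Proof.
move=> c0 [XX [t t0 Xt]]; split; first exact: adjop_scale.
exists (c * t); first exact: mulr_gt0.
by rewrite realCM -scalerA -scalerBr -{2}(ger0_norm (ltW c0)); exact: bndZR.
Qed.

Lemma posop_sub_bnd c X : adjop X = X -> 0 <= c -> bnd X c -> posop (c%:O - X).
Proof.
move=> XX c0 Xc; split; first by rewrite adjopB adjop_scalar XX.
exists (1 + c); first by rewrite ltr_pwDl.
rewrite realCD scalerDl opprB addrA addrAC addrK scale1r.
by apply: (bndD cs) => //; exact: bnd1.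
Qed.

Lemma posop1 : posop 1.
Proof.
split; first exact: adjop1; exists 1 => //.
by rewrite scale1r subrr; exact: bnd0.
Qed.

Lemma posop0 : posop 0.
Proof.
split; first exact: adjop0; exists 1 => //.
by rewrite scale1r subr0; exact: bnd1.
Qed.

Lemma sqrt_sub c X : adjop X = X -> 0 < c -> bnd X c ->
  exists W, [/\ posop W, W * W = c%:O - X &
    forall Z, bounded_op Z -> GRing.comm Z X -> GRing.comm Z W].
Proof.
move=> XX c0 Xc; have ci0 : 0 <= c^-1 by rewrite invr_ge0 ltW.
have [||W [WW W1 WE Wcomm]] := @sqrt_one_sub _ _ _ cs cH (c^-1%:C *: X).
- exact: adjop_scale.
- have := bndZR (c^-1) Xc; rewrite ger0_norm// mulVf// gt_eqF//.
have sc0 : 0 < Num.sqrt c by rewrite sqrtr_gt0.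
exists ((Num.sqrt c)%:C *: W); split.
- by apply: posopZ => //; split=> //; exists 1 => //; rewrite scale1r.
- rewrite scaleopM -realCM -expr2 sqr_sqrtr ?(ltW c0)// WE scalerBr scalerA.
  by rewrite -realCM divff ?gt_eqF// scale1r.
- by move=> Z Zb ZX; apply/comm_scale/Wcomm => //; exact: comm_scale.
Qed.

Lemma posop_sqrt X : posop X ->
  exists S, [/\ posop S, S * S = X &
    forall Z, bounded_op Z -> GRing.comm Z X -> GRing.comm Z S].
Proof.
move=> [XX [t t0 Xt]].
have [|S [Sp SE Sc]] := sqrt_sub _ t0 Xt; first by rewrite adjopB adjop_scalar XX.
exists S; split=> //; first by rewrite SE opprB addrC subrK.
by move=> Z Zb ZX; apply: Sc => //; apply: commrB => //; exact: comm_scalar.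
Qed.

(* S + iW is c times a unitary, and S is its real part. *)
Lemma bnd_sum_sqr c S W : 0 <= c -> adjop S = S -> adjop W = W ->
  GRing.comm S W -> S * S + W * W = (c ^+ 2)%:O -> bnd S c.
Proof.
move=> c0 SS WW SW SWc; pose U := S + 'i%C *: W.
have US : adjop U = S - 'i%C *: W.
  rewrite adjopD adjopZ SS WW -scaleNr; congr (_ + _ *: _).
  by apply/eqP; rewrite eq_complex /= oppr0 !eqxx.
have Uc : bnd U c.
  apply: (bnd_cstar cs) => //; rewrite US mulrDr !mulrBl -!scaleopAl -!scaleopAr.
  rewrite SW scalerA sqr_iM scaleN1r opprK addrA subrK SWc.
  by apply: bnd_scalar; rewrite exprn_ge0.
have Uc' : bnd (adjop U) c by exact: bnd_adjop.
have -> : S = (2^-1)%:C *: (U + adjop U).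
  rewrite US /U addrACA subrr addr0 scalerDr -scalerDl -realCD.
  by rewrite (_ : 2^-1 + 2^-1 = 1) ?scale1r//; lra.
apply: (@bndW _ _ _ _ (`|2^-1| * (c + c))).
  by rewrite ger0_norm ?invr_ge0//; lra.
by apply: bndZR; exact: (bndD cs).
Qed.

(** c^2 - S^2 = W^2 with W commuting with S, so W + iS is c times a unitary and its real part W has
    norm at most c. *)
Lemma bnd_sub_sqr c S : adjop S = S -> 0 < c -> bnd S c ->
  bnd ((c ^+ 2)%:O - S * S) (c ^+ 2).
Proof.
move=> SS c0 Sc; have c20 : 0 < c ^+ 2 by rewrite exprn_gt0.
have [||W [Wp WE Wc]] := @sqrt_sub _ (S * S) _ c20.
- by rewrite adjopM SS.
- by rewrite expr2; apply: bndM => //; exact: ltW.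
rewrite -WE expr2; apply: bndM; [exact: ltW| |].
all: apply: (@bnd_sum_sqr _ _ S (ltW c0)) => //; rewrite ?(posop_adjop Wp)//.
all: try by rewrite WE subrK.
all: by apply/commr_sym/Wc; [exists c|exact: commrM].
Qed.

Lemma posop_sqr S : adjop S = S -> bounded_op S -> posop (S * S).
Proof.
move=> SS [c c0 Sc]; split; first by rewrite adjopM SS.
by exists (c ^+ 2); [rewrite exprn_gt0|exact: bnd_sub_sqr].
Qed.

(** The definition of [posop] gives such a bound for one t only; the square root S of X, with |S|^2
    <= c, gives it for every bound c of X. *)
Lemma posop_bnd_sub c X : posop X -> 0 < c -> bnd X c -> bnd (c%:O - X) c.
Proof.
move=> Xp c0 Xc; have [S [Sp SE _]] := posop_sqrt Xp.
have c20 : Num.sqrt c ^+ 2 = c by rewrite sqr_sqrtr// ltW.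
rewrite -SE -{1 2}c20; apply: bnd_sub_sqr; rewrite ?sqrtr_gt0//.
  exact: posop_adjop.
apply: (bnd_cstar cs); first exact: sqrtr_ge0.
by rewrite (posop_adjop Sp) SE c20.
Qed.

(** The square roots commute with each other as well, so X Y is the square of their self-adjoint
    product. *)
Lemma posop_comm_mul X Y : posop X -> posop Y -> GRing.comm X Y -> posop (X * Y).
Proof.
move=> Xp Yp XY; have [S [Sp SE Sc]] := posop_sqrt Xp.
have [T [Tp TE Tc]] := posop_sqrt Yp.
have ST : GRing.comm S T.
  apply: Tc; first exact: posop_bounded.
  by apply/commr_sym/Sc; [exact: posop_bounded|exact: commr_sym].
rewrite -SE -TE (_ : _ * _ = (S * T) * (S * T)).
  apply: posop_sqr; first by rewrite adjopM !posop_adjop// ST.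
  by apply: bounded_opM; exact: posop_bounded.
by rewrite -!mulrA; congr (_ * _); rewrite !mulrA ST.
Qed.

(** X and c - X have commuting square roots whose squares add up to c; [bnd_sum_sqr] bounds the
    first by sqrt c. *)
Lemma posop_bnd c X : 0 <= c -> posop X -> posop (c%:O - X) -> bnd X c.
Proof.
move=> c0 Xp cXp; have [S [Sp SE Sc]] := posop_sqrt Xp.
have [T [Tp TE Tc]] := posop_sqrt cXp.
have ST : GRing.comm S T.
  apply: Tc; first exact: posop_bounded.
  apply: commrB; first exact: comm_scalar.
  by apply/commr_sym/Sc; [exact: posop_bounded|].
have c20 : Num.sqrt c ^+ 2 = c by rewrite sqr_sqrtr.
have Sb : bnd S (Num.sqrt c).
  apply: (bnd_sum_sqr _ _ _ ST); rewrite ?sqrtr_ge0 ?posop_adjop//.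
  by rewrite SE TE c20 addrC subrK.
by rewrite -SE -c20 expr2; apply: bndM => //; exact: sqrtr_ge0.
Qed.

Lemma posop_bnd_add c X Y : 0 <= c -> posop X -> posop Y -> bnd (X + Y) c -> bnd X c.
Proof.
move=> c0 Xp Yp XYc; apply: posop_bnd => //.
rewrite (_ : _ - X = c%:O - (X + Y) + Y); last by rewrite opprD addrA subrK.
apply: posopD => //; apply: posop_sub_bnd => //.
by rewrite adjopD !posop_adjop.
Qed.

Lemma posop_opp_eq0 X : posop X -> posop (- X) -> X = 0.
Proof.
move=> Xp NXp; apply: (bnd0_eq0 cs); apply: posop_bnd => //.
by rewrite scale0r sub0r.
Qed.

(** Iterates |V x|^2 <= |x| |V^2 x| for V = S^(2^k), in a form free of division by |x|. *)
Lemma power_iter S x k : adjop S = S ->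
  hnrm (S x) ^+ (2 ^ k) * hnrm x <= hnrm x ^+ (2 ^ k) * hnrm ((S ^+ (2 ^ k)) x).
Proof.
move=> SS; elim: k => [|k IHk]; first by rewrite expn0 !expr1 mulrC.
have [x0|x0] := eqVneq (hnrm x) 0.
  by rewrite x0 mulr0 expr0n expn_eq0 /= mul0r.
have xp : 0 < hnrm x by rewrite lt_def x0 hnrm_ge0.
set n := (2 ^ k)%N in IHk *; rewrite expnSr !exprM -/n.
rewrite -(ler_pM2r xp) -mulrA -expr2 -exprMn.
have := hnrm_cstar cs (S ^+ n) x; rewrite adjopX SS -expr2 => cst.
apply: (@le_trans _ _ ((hnrm x ^+ n * hnrm ((S ^+ n) x)) ^+ 2)).
  by apply: lerXn2r; rewrite ?nnegrE ?mulr_ge0 ?exprn_ge0 ?hnrm_ge0.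
rewrite [leLHS]exprMn -[leRHS]mulrA; apply: ler_wpM2l.
  by rewrite !exprn_ge0 ?hnrm_ge0.
by rewrite [leRHS]mulrC.
Qed.

(* Stands in for the spectral radius formula. *)
Lemma power_trick S d M : adjop S = S -> 0 <= d -> 0 <= M ->
  (forall k, bnd (S ^+ (2 ^ k)) (M * (2 ^ k)%:R * d ^+ (2 ^ k))) -> bnd S d.
Proof.
move=> SS d0 M0 SM; apply: bnd_eps => e e0 x.
have de0 : 0 < d + e by rewrite ltr_wpDl.
have [x0|x0] := eqVneq (hnrm x) 0.
  by rewrite (hnrm_eq0 cs x0) op0 hnrm0 mulr0.
have xp : 0 < hnrm x by rewrite lt_def x0 hnrm_ge0.
have dx0 : 0 < (d + e) * hnrm x by rewrite mulr_gt0.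
rewrite -[leRHS]mul1r -ler_pdivrMr//.
apply: (@pow2_le1 _ _ M); first by rewrite divr_ge0 ?hnrm_ge0 ?ltW.
move=> k; rewrite expr_div_n ler_pdivrMr ?exprn_gt0// -(ler_pM2r xp).
apply: le_trans (power_iter x k SS) _.
rewrite [in leRHS]exprMn -!mulrA [leRHS](_ : _ =
  hnrm x ^+ (2 ^ k) * (M * (2 ^ k)%:R * (d + e) ^+ (2 ^ k) * hnrm x)); last by ring.
apply: ler_wpM2l; first by rewrite exprn_ge0 ?hnrm_ge0.
apply: le_trans (SM k x) _; apply: ler_wpM2r; first exact: hnrm_ge0.
apply: ler_wpM2l; first by rewrite mulr_ge0.
by apply: lerXn2r; rewrite ?nnegrE ?(ltW de0)// lerDl ltW.
Qed.

(* With X = T^* T and Y = T T^*, (t - X)^(n+1) = t (t - X)^n - T^* (t - Y)^n T,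
   so (t - X)^n has norm at most (n + 1) t^n. *)
Lemma posop_adjopM_swap T : bounded_op T -> posop (T * adjop T) -> posop (adjop T * T).
Proof.
move=> [c c0 Tc] Yp; have t0 : 0 < c ^+ 2 by rewrite exprn_gt0.
set t := c ^+ 2 in t0 *; set X := adjop T * T; set Y := T * adjop T in Yp.
have XX : adjop X = X by rewrite adjopM adjopK.
have Tc' : bnd (adjop T) c by apply: bnd_adjop => //; exact: ltW.
have Yt : bnd (t%:O - Y) t.
  apply: posop_bnd_sub => //; rewrite /t expr2; apply: bndM => //; exact: ltW.
have pow n : (t%:O - X) ^+ n * adjop T = adjop T * (t%:O - Y) ^+ n.
  elim: n => [|n IHn]; first by rewrite !expr0 mul1r mulr1.
  rewrite !exprSr mulrA -IHn -!mulrA; congr (_ * _).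
  by rewrite mulrBl mulrBr comm_scalar mulrA.
split=> //; exists t => //.
apply: (@power_trick _ _ 2) => //; [|exact: ltW|].
  by rewrite adjopB adjop_scalar XX.
have bound n : bnd ((t%:O - X) ^+ n) ((1 + n%:R) * t ^+ n).
  elim: n => [|n IHn]; first by rewrite !expr0 addr0 mul1r; exact: bnd1.
  rewrite exprSr mulrBr mulrA pow -scaleopAr mulr1.
  apply: (@bndW _ _ _ _ (`|t| * ((1 + n%:R) * t ^+ n) + c * t ^+ n * c)).
    rewrite ger0_norm ?(ltW t0)// -natr1 exprS [X in _ + X <= _]mulrAC -expr2 -/t.
    by rewrite le_eqVlt; apply/orP; left; apply/eqP; ring.
  apply: (bndB cs); first exact: bndZR.
  apply: bndM => //; first by rewrite mulr_ge0 ?exprn_ge0 ?ltW.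
  by apply: bndM => //; [exact: ltW|apply: bndX => //; exact: ltW].
move=> k; apply: bndW (bound (2 ^ k)%N).
apply: ler_wpM2r; first by rewrite exprn_ge0// ltW.
have : 1 <= (2 ^ k)%:R :> R by rewrite ler1n expn_gt0.
lra.
Qed.

(* The argument of Kelley and Vaught: D = |X| - X is twice the negative part
   of X = T^* T, and C = T D satisfies C^* C = D X D = - D |X| D. *)
Lemma posop_adjopM T : bounded_op T -> posop (adjop T * T).
Proof.
move=> Tb; set X := adjop T * T.
have XX : adjop X = X by rewrite adjopM adjopK.
have Xb : bounded_op X by apply: bounded_opM => //; exact: bounded_adjop.
have [A [Ap AE Ac]] := posop_sqrt (posop_sqr XX Xb).
have XA : GRing.comm X A by apply: Ac => //; exact: commrM.
pose D := A - X.
have AA := posop_adjop Ap.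
have Ab := posop_bounded Ap.
have DD : adjop D = D by rewrite adjopB XX AA.
have Db : bounded_op D by exact: bounded_opB.
have XD : X * D = - (A * D).
  by rewrite /D !mulrBr XA AE opprB.
have [S [Sp SE Sc]] := posop_sqrt Ap.
have SS := posop_adjop Sp; have Sb := posop_bounded Sp.
have DS : GRing.comm D S.
  apply: Sc => //; apply/commr_sym/commrB; first exact: commr_refl.
  exact: commr_sym.
pose C := T * D.
have Cb : bounded_op C by exact: bounded_opM.
have CC : adjop C * C = - ((S * D) * (S * D)).
  rewrite adjopM DD -mulrA [adjop T * _]mulrA -/X XD mulrN -SE; congr (- _).
  by rewrite !mulrA DS.
have SDsa : adjop (S * D) = S * D by rewrite adjopM SS DD DS.
have SDb : bounded_op (S * D) by exact: bounded_opM.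
have NCC : posop (- (adjop C * C)) by rewrite CC opprK; exact: posop_sqr.
(* Twice C^* C + C C^* is the sum of the squares of the self-adjoint operators C + C^* and i C - i
   C^*, hence positive. Adding - C^* C twice and halving leaves C C^*. *)
have CCp : posop (adjop C * C + C * adjop C + (adjop C * C + C * adjop C)).
  have Cb' := bounded_adjop cs Cb.
  have -> : adjop C * C + C * adjop C + (adjop C * C + C * adjop C) =
    (C + adjop C) * (C + adjop C) +
    ('i%C *: (C - adjop C)) * ('i%C *: (C - adjop C)).
    rewrite scaleopM sqr_iM scaleN1r !(mulrDl, mulrDr, mulrBl, mulrBr).
    rewrite !(mulNr, mulrN, opprB, opprD, opprK).
    by rewrite [RHS](AC ((2*2)*(2*2)) ((3*2)*(7*6)*((1*5)*(4*8))))/= !subrr !addr0.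
  have saC1 : adjop (C + adjop C) = C + adjop C by rewrite adjopD adjopK addrC.
  have saC2 : adjop ('i%C *: (C - adjop C)) = 'i%C *: (C - adjop C).
    rewrite adjopZ adjopB adjopK -[C - _]opprB scalerN -scaleNr; congr (_ *: _).
    by apply/eqP; rewrite eq_complex /= oppr0 !eqxx.
  apply: posopD; apply: posop_sqr => //; first exact: bounded_opD.
  by apply: bounded_opZ; exact: bounded_opB.
have {}CCp : posop (C * adjop C).
  have half : 0 < 2^-1 :> R by rewrite invr_gt0.
  have := posopZ half (posopD (posopD CCp NCC) NCC).
  rewrite -addrA -opprD addrACA [_ + _ + (_ + _)]addrC addrK scalerDr -scalerDl -realCD.
  by rewrite (_ : 2^-1 + 2^-1 = 1) ?scale1r//; lra.
(* C C^* is positive, hence C^* C is too; its negative was positive already. *)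
have CC0 := posop_opp_eq0 (posop_adjopM_swap Cb CCp) NCC.
have SD0 : S * D = 0.
  apply: (bnd0_eq0 cs); apply: (bnd_cstar cs) => //.
  by rewrite SDsa -[S * D * _]opprK -CC CC0 oppr0; apply: bnd0; rewrite expr0n.
(* D^2 = A D - X D = 2 A D = 2 S (S D) = 0, so X equals its absolute value A. *)
have D0 : D = 0.
  apply: (bnd0_eq0 cs); apply: (bnd_cstar cs) => //.
  rewrite DD {1}/D mulrBl XD -SE -!mulrA SD0 mulr0 oppr0 subrr.
  by apply: bnd0; rewrite expr0n.
by move: Ap; rewrite -(subrK X A) -/D D0 add0r.
Qed.

Lemma posop_exp X n : posop X -> posop (X ^+ n).
Proof.
move=> Xp; elim: n => [|n IHn]; first by rewrite expr0; exact: posop1.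
rewrite exprS; apply: posop_comm_mul => //; exact/commrX/commr_refl.
Qed.

Lemma posop_sum (I : Type) (r : seq I) (P : pred I) (F : I -> adjointable H) :
  (forall i, P i -> posop (F i)) -> posop (\sum_(i <- r | P i) F i).
Proof.
by move=> Fp; elim/big_ind: _ => //; [exact: posop0|exact: posopD].
Qed.

Lemma geometric_telescope X n : \sum_(i < n) (1 - X) * X ^+ i = 1 - X ^+ n.
Proof.
elim: n => [|n IHn]; first by rewrite big_ord0 expr0 subrr.
by rewrite big_ord_recr /= IHn mulrBl mul1r -exprS addrA subrK.
Qed.

(** Since X^m <= X^i for i < m, the operator m (1 - X) X^m is dominated by the sum of the (1 - X)
    X^i, which telescopes to 1 - X^m. *)
Lemma bnd_sub_mul_exp X m : posop X -> posop (1 - X) ->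
  bnd (((1 - X) * X ^+ m) *+ m) 1.
Proof.
move=> Xp X1; have comm n : GRing.comm (1 - X) (X ^+ n).
  by apply/commrX/commr_sym/commrB; [exact: commr1|exact: commr_refl].
have powp n : posop (1 - X ^+ n).
  rewrite -geometric_telescope; apply: posop_sum => i _.
  by apply: posop_comm_mul => //; exact: posop_exp.
have Xm1 : bnd (1 - X ^+ m) 1.
  apply: posop_bnd => //; rewrite scale1r opprB addrC subrK.
  exact: posop_exp.
have tp : posop (((1 - X) * X ^+ m) *+ m).
  rewrite -[X in _ *+ X](card_ord m) -sumr_const; apply: posop_sum => i _.
  by apply: posop_comm_mul => //; exact: posop_exp.
apply: (posop_bnd_add _ tp (Y := \sum_(i < m) ((1 - X) * X ^+ i) * (1 - X ^+ (m - i)))) => //.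
  apply: posop_sum => i _; apply: posop_comm_mul => //.
    by apply: posop_comm_mul => //; exact: posop_exp.
  apply: commrB; first exact: commr1.
  by apply/commrX/commr_sym/commrM; [exact/commr_sym/(comm 1%N)|exact/commrX/commr_refl].
rewrite -[X in _ *+ X](card_ord m) -sumr_const -big_split /=.
rewrite (eq_bigr (fun i : 'I_m => (1 - X) * X ^+ i)) ?geometric_telescope// => i _.
by rewrite mulrBr mulr1 -mulrA -exprD subnKC 1?ltnW// addrC subrK.
Qed.

(** With X = T^* T the squared norm is that of X (1 - X)^(2n+2), and [bnd_sub_mul_exp] at 1 - X
    bounds X (1 - X)^(n+1) by 1/(n+1). Thus T is a limit of products T p(T^* T) with p a polynomial
    without constant term, which is an approximate unit for T. *)
Lemma bnd_mul_exp_one_sub T n : bnd T 1 ->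
  bnd ((T * (1 - adjop T * T) ^+ n.+1)) (Num.sqrt n.+1%:R^-1).
Proof.
move=> T1; set X := adjop T * T.
have Xp : posop X by apply: posop_adjopM; exact: bounded_op_bnd T1.
have X1 : bnd X 1 by rewrite -[1]mulr1; apply: bndM => //; exact: bnd_adjop.
have Yp : posop (1 - X).
  by rewrite -[1]scale1r; apply: posop_sub_bnd => //; exact: posop_adjop.
have Y1 : bnd (1 - X) 1.
  by have := posop_bnd_sub Xp ltr01 X1; rewrite scale1r.
have n0 : 0 <= n.+1%:R^-1 :> R by rewrite invr_ge0.
apply: (bnd_cstar cs); first exact: sqrtr_ge0.
rewrite sqr_sqrtr// adjopM adjopX (posop_adjop Yp) mulrA -[_ * adjop T * T]mulrA -/X.
have -> : (1 - X) ^+ n.+1 * X * (1 - X) ^+ n.+1 =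
    (1 - X) ^+ n.+1 * (n.+1%:R^-1%:C *: ((X * (1 - X) ^+ n.+1) *+ n.+1)).
  rewrite -[(X * _) *+ _]scaler_nat scalerA (_ : _ * n.+1%:R = 1).
    by rewrite scale1r -[LHS]mulrA.
  by rewrite -(rmorph_nat (real_complex R)) -realCM mulVf// pnatr_eq0.
rewrite -[n.+1%:R^-1]mul1r; apply: bndM => //.
  by have := bndX n.+1 ler01 Y1; rewrite expr1n.
rewrite mul1r -[X in bnd _ X]mulr1 -{2}(ger0_norm n0); apply: bndZR.
rewrite -[X in bnd (X * _ *+ _)](subKr 1); apply: bnd_sub_mul_exp => //.
by rewrite subKr.
Qed.

End Positivity.

Lemma nrm_complete (R : realType) (V : completeNormedModType R[i])
    (x : nat -> V) (e : nat -> R) : vanishing e ->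
    (forall m n, (n <= m)%N -> nrm (x m - x n) <= e n) ->
  exists l, forall n, nrm (l - x n) <= e n.
Proof.
move=> e0 xe.
have /cauchy_cvg/cvg_ex[l xl] : cauchy (x @ \oo).
  apply: cauchy_exP => d d_gt0.
  have dE : (complex.Re d)%:C = d by rewrite RRe_real// gtr0_real.
  have d0 : 0 < complex.Re d by rewrite -ltcR dE.
  have [n en] := e0 _ d0; exists (x n); exists n => // m /= nm.
  rewrite -ball_normE /ball_ /= nrmE -dE ltcR nrmBC.
  exact: le_lt_trans (xe _ _ nm) en.
exists l => n; apply/ler_addgt0Pl => d d0.
have dC : 0 < d%:C by rewrite ltcR.
move/cvgrPdist_lt/(_ _ dC) : xl => [N _ xN].
have := xN (maxn N n) (leq_maxl _ _); rewrite /= nrmE ltcR => lN.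
rewrite -(subrK (x (maxn N n)) l) -addrA (le_trans (nrmD _ _))//.
by apply: lerD; [exact: ltW|apply: xe; exact: leq_maxr].
Qed.

(** * Order on a C^*-algebra and Hilbert modules *)

Section SelfModule.
Context (R : realType) (B : cstarAlgType R).

(** B as a Hilbert module over itself, under a separate name for its module structure. Left
    multiplication embeds B, which may lack a unit, in a unital algebra of operators. *)
Definition selfmod : Type := B.

HB.instance Definition _ := GRing.Lmodule.copy selfmod B.

Definition self_inner (b c : selfmod) : B := cmul (cstar (b : B)) (c : B).

Fact self_innerDr b c d : self_inner b (c + d) = self_inner b c + self_inner b d.
Proof. exact: cmulDr. Qed.

Fact self_innerZr (a : R[i]) b c : self_inner b (a *: c) = a *: self_inner b c.
Proof. exact: cmulZr. Qed.

Fact self_inner_ract b c d : self_inner b (cmul (c : B) d) = cmul (self_inner b c) d.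
Proof. exact: cmulA. Qed.

Fact self_inner_star b c : cstar (self_inner b c) = self_inner c b.
Proof. by rewrite /self_inner cstarM cstarK. Qed.

Fact self_nondegenerate b : (forall c, self_inner b c = 0) -> b = 0.
Proof.
move=> /(_ b) bb; apply: (@nrm_eq0 R B); apply/eqP.
by rewrite -sqrf_eq0 -nrm_cstar [X in nrm X]bb nrm0.
Qed.

HB.instance Definition _ :=
  @Lmodule_isInnerProductModule.Build R B selfmod
    (fun b c => cmul (b : B) c) self_inner (@cmulDl R B) (@cmulDr R B)
    (fun x b c => cmulA (x : B) b c) (@cmulZl R B)
    (fun a x b => cmulZr a (x : B) b) self_innerDr self_innerZr
    self_inner_ract self_inner_star self_nondegenerate.

Lemma hnrm_self (b : selfmod) : hnrm b = nrm (b : B).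
Proof. by rewrite /hnrm nrm_cstar sqrtr_sqr ger0_norm ?nrm_ge0. Qed.

Lemma self_cauchy_schwarz : cauchy_schwarz selfmod.
Proof. by move=> b c; rewrite !hnrm_self (le_trans (nrmM _ _))// nrm_star. Qed.

Lemma self_complete : hcomplete selfmod.
Proof.
move=> x e e0 xe; have [|l lx] := @nrm_complete R B x e e0.
  by move=> m n nm; rewrite -hnrm_self; exact: xe.
by exists l => n; rewrite hnrm_self lx.
Qed.

Lemma is_adjoint_lmul (b : B) :
  @is_adjoint R B selfmod (fun c => cmul b (c : B)) (fun c => cmul (cstar b) (c : B)).
Proof. by move=> x y; rewrite /inner/= /self_inner cstarM cmulA. Qed.

Definition lmulop (b : B) : adjointable selfmod := mk_adjointable (is_adjoint_lmul b).

Lemma lmulopE b c : lmulop b c = cmul b (c : B) :> B. Proof. by []. Qed.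

Lemma lmulopD b c : lmulop (b + c) = lmulop b + lmulop c.
Proof. by apply: adj_inj => x; exact: cmulDl. Qed.

Lemma lmulopZ (a : R[i]) b : lmulop (a *: b) = a *: lmulop b.
Proof. by apply: adj_inj => x; exact: cmulZl. Qed.

Lemma lmulop0 : lmulop 0 = 0.
Proof. by rewrite -[X in lmulop X](scale0r (0 : B)) lmulopZ scale0r. Qed.

Lemma lmulopB b c : lmulop (b - c) = lmulop b - lmulop c.
Proof. by rewrite lmulopD -[- c]scaleN1r lmulopZ scaleN1r. Qed.

Lemma lmulopM b c : lmulop (cmul b c) = lmulop b * lmulop c.
Proof. by apply: adj_inj => x; rewrite mulopE; exact/esym/cmulA. Qed.

Lemma adjop_lmulop b : adjop (lmulop b) = lmulop (cstar b).
Proof. by apply: adjop_unique => x y; exact: is_adjoint_lmul. Qed.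

Lemma lmulop_bnd b : bnd (lmulop b) (nrm b).
Proof. by move=> x; rewrite !hnrm_self nrmM. Qed.

(** Tested on the vector b^*, since |b b^*| = |b|^2. *)
Lemma nrm_le_lmulop b c : 0 <= c -> bnd (lmulop b) c -> nrm b <= c.
Proof.
move=> c0 bc; have [->//|b0] := eqVneq (nrm b) 0.
have b_gt0 : 0 < nrm b by rewrite lt_def b0 nrm_ge0.
rewrite -(ler_pM2r b_gt0) -expr2 -[in leLHS]nrm_star -nrm_cstar cstarK -nrm_star.
by have := bc (cstar b); rewrite !hnrm_self nrm_star nrm_star lmulopE.
Qed.

Definition cpos (b : B) := posop (lmulop b).

Lemma cpos_cstar b : cpos (cmul (cstar b) b).
Proof.
rewrite /cpos lmulopM -adjop_lmulop.
apply: (posop_adjopM self_cauchy_schwarz self_complete).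
exact: bounded_op_bnd (lmulop_bnd b).
Qed.

Lemma cposD b c : cpos b -> cpos c -> cpos (b + c).
Proof. by rewrite /cpos lmulopD; exact/posopD/self_cauchy_schwarz. Qed.

Lemma cpos_nrm_le b c : cpos b -> cpos c -> nrm b <= nrm (b + c).
Proof.
move=> bp cp; apply: nrm_le_lmulop; first exact: nrm_ge0.
apply: (posop_bnd_add self_cauchy_schwarz self_complete (nrm_ge0 _) bp cp).
by rewrite -lmulopD; exact: lmulop_bnd.
Qed.

(** With S the square root of m - p, the element is (S a)^* (S a). S is only an operator on
    [selfmod B], but S a belongs to B. *)
Lemma cpos_conj_sub (p a : B) m : cpos p -> 0 <= m -> nrm p <= m ->
  cpos (m%:C *: cmul (cstar a) a - cmul (cstar a) (cmul p a)).
Proof.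
move=> pp m0 pm.
have [] := posop_sqrt self_cauchy_schwarz self_complete
  (posop_sub_bnd self_cauchy_schwarz (posop_adjop pp) m0 (bndW pm (lmulop_bnd p))).
move=> S [Sp SE _].
have -> : m%:C *: cmul (cstar a) a - cmul (cstar a) (cmul p a) =
    cmul (cstar (S a : B)) (S a : B); last exact: cpos_cstar.
have := adjopP S a (S a); rewrite (posop_adjop Sp) -mulopE SE subopE scaleopE oneopE.
by rewrite innerBr innerZr => h; exact: esym h.
Qed.

End SelfModule.

Section Hilbertian.
Context (R : realType) (B : cstarAlgType R) (H : innerModType B).

Definition hpositive := forall x : H, cpos (inner x x : B).

Definition hilbertian := hpositive /\ hcomplete H.

Hypothesis pos : hpositive.

Lemma hpositive_cauchy_schwarz : cauchy_schwarz H.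
Proof.
move=> x y; set p := inner x x : B; set a := inner x y : B.
(* The elements m a^* a, <z, z> for z = x a - m y, and m a^* a - a^* p a are positive and add up to
   m^2 <y, y>, whose norm therefore dominates that of the first. *)
have key m : 0 < m -> nrm p <= m -> nrm a ^+ 2 <= m * nrm (inner y y : B).
  move=> m0 pm; set q := inner y y : B.
  have zp := pos (ract x a - m%:C *: y).
  have wp := cpos_conj_sub a (pos x) (ltW m0) pm.
  have ap : cpos (m%:C *: cmul (cstar a) a).
    by rewrite /cpos lmulopZ; apply: posopZ => //; exact: cpos_cstar.
  have := cpos_nrm_le ap (cposD zp wp).
  have -> : m%:C *: cmul (cstar a) a + (inner (ract x a - m%:C *: y)
      (ract x a - m%:C *: y) + (m%:C *: cmul (cstar a) a - cmul (cstar a) (cmul p a)))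
      = (m ^+ 2)%:C *: q.
    rewrite innerBl !innerBr !innerZr !innerZl conjc_real !inner_ract !inner_ractl.
    rewrite -/p -/a -/q -[inner y x]inner_star -/a cmulA scalerA -realCM -expr2.
    rewrite opprB !addrA.
    set u := _ *: cmul (cstar a) a; set v := cmul _ a.
    by rewrite [LHS](AC (1*1*1*1*1*1*1) (4*((2*7)*(1*3)*(6*5))))/= !subrr !addr0.
  rewrite !nrmZ !modcR !ger0_norm ?exprn_ge0 ?(ltW m0)// nrm_cstar expr2 -mulrA.
  by rewrite ler_pM2l.
rewrite -(ler_pXn2r (n := 2))// ?nnegrE ?nrm_ge0 ?mulr_ge0 ?hnrm_ge0//.
rewrite exprMn !hnrm_sqr -/p.
(* [key] is used with m the norm of p; when that norm is 0, with arbitrarily small m > 0. *)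
have [p0|p0] := eqVneq (nrm p) 0; last first.
  by apply: key => //; rewrite lt_def p0 nrm_ge0.
apply/ler_addgt0Pr => d d0; set q := nrm (inner y y : B) in key *.
have q0 : 0 < q + 1 by rewrite ltr_wpDl ?nrm_ge0.
have dq : 0 < d / (q + 1) by rewrite divr_gt0.
rewrite p0 mul0r add0r (le_trans (key _ dq _))// ?p0 ?ltW//.
by rewrite mulrAC ltr_pdivrMr// ltr_pM2l// ltrDl.
Qed.

End Hilbertian.

Lemma hilbertian_cs (R : realType) (B : cstarAlgType R) (H : innerModType B) :
  hilbertian H -> cauchy_schwarz H.
Proof. by case=> pos _; exact: hpositive_cauchy_schwarz. Qed.

Lemma self_hilbertian (R : realType) (B : cstarAlgType R) : hilbertian (selfmod B).
Proof. by split; [exact: cpos_cstar|exact: self_complete]. Qed.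

Section HilbertModules.
Context (R : realType) (B : cstarAlgType R) (E : hilbertModType B).

Lemma hnrm_hilbert (x : E) : hnrm x = nrm x.
Proof.
have -> : nrm x = Num.sqrt (nrm x ^+ 2) by rewrite sqrtr_sqr ger0_norm ?nrm_ge0.
rewrite /hnrm; congr Num.sqrt; apply: complexI; rewrite -nrmE -normr_inner.
by rewrite !expr2 realCM -nrmE.
Qed.

Lemma hilbert_hilbertian : hilbertian E.
Proof.
split=> [x|x e e0 xe].
  by have [b ->] := inner_pos x; exact: cpos_cstar.
have [|l lx] := @nrm_complete R E x e e0.
  by move=> m n nm; rewrite -hnrm_hilbert; exact: xe.
by exists l => n; rewrite hnrm_hilbert lx.
Qed.

Lemma hnorm_hnrm (H : innerModType B) (x : H) : hnorm x = (hnrm x)%:C.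
Proof.
by rewrite /hnorm nrmE -hnrm_sqr expr2 realCM -expr2 sqrCK// ler0c hnrm_ge0.
Qed.

Lemma range_idealP (b : B) :
  b \in range_ideal_pred E <->
  forall e : R, 0 < e -> exists2 c, lspan (@inner_values R B E) c & nrm (b - c) <= e.
Proof.
split=> [/asboolP/closure_normP bE e e0|bE].
  have [|c cE bc] := bE e%:C; first by rewrite ltcR.
  by exists c => //; move: bc; rewrite nrmE ltcR => /ltW.
apply/asboolP/closure_normP => e e0.
have eE : (complex.Re e)%:C = e by rewrite RRe_real// gtr0_real.
have e20 : 0 < complex.Re e / 2 by rewrite divr_gt0// -ltcR eE.
have [c cE bc] := bE _ e20; exists c => //.
by rewrite nrmE -eE ltcR (le_lt_trans bc)// ltr_pdivrMr// ltr_pMr ?ltr1n// -ltcR eE.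
Qed.

Lemma hnrm_range_ideal (b : range_ideal E) : hnrm b = nrm (val b).
Proof. by rewrite /hnrm nrm_cstar sqrtr_sqr ger0_norm ?nrm_ge0. Qed.

Lemma range_ideal_closed (b : B) :
  (forall e : R, 0 < e -> exists2 c, c \in range_ideal_pred E & nrm (b - c) <= e) ->
  b \in range_ideal_pred E.
Proof.
move=> bE; apply/range_idealP => e e0; have e20 : 0 < e / 2 by rewrite divr_gt0.
have [c /range_idealP cE bc] := bE _ e20; have [d dE cd] := cE _ e20.
exists d => //; rewrite -(subrK c b) -addrA (le_trans (nrmD _ _))//.
by rewrite [e]splitr lerD.
Qed.

Lemma range_ideal_hilbertian : hilbertian (range_ideal E).
Proof.
split=> [x|x e e0 xe]; first exact: cpos_cstar.
have [|l lx] := @nrm_complete R B (fun n => val (x n)) e e0.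
  by move=> m n /xe; rewrite hnrm_range_ideal.
have lE : l \in range_ideal_pred E.
  apply: range_ideal_closed => d d0; have [n en] := e0 _ d0.
  by exists (val (x n)); [exact: valP|rewrite (le_trans (lx n))// ltW].
by exists (RangeIdeal lE) => n; rewrite hnrm_range_ideal lx.
Qed.

End HilbertModules.

Section DirectSumHilbertian.
Context (R : realType) (B : cstarAlgType R) (H1 H2 : innerModType B).
Hypotheses (h1 : hilbertian H1) (h2 : hilbertian H2).
Implicit Type p : (H1 * H2)%type.

Lemma dsum_innerE p q : inner p q = inner p.1 q.1 + inner p.2 q.2 :> B.
Proof. by []. Qed.

Lemma hnrm_fst p : hnrm p.1 <= hnrm p.
Proof.
by rewrite ler_wsqrtr// dsum_innerE cpos_nrm_le//; [exact: h1.1|exact: h2.1].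
Qed.

Lemma hnrm_snd p : hnrm p.2 <= hnrm p.
Proof.
by rewrite ler_wsqrtr// dsum_innerE addrC cpos_nrm_le//; [exact: h2.1|exact: h1.1].
Qed.

Lemma hnrm_inl (x : H1) : hnrm ((x, 0) : (H1 * H2)%type) = hnrm x.
Proof. by rewrite /hnrm dsum_innerE /= inner0r addr0. Qed.

Lemma hnrm_inr (x : H2) : hnrm ((0, x) : (H1 * H2)%type) = hnrm x.
Proof. by rewrite /hnrm dsum_innerE /= inner0r add0r. Qed.

Lemma dsum_hpositive : hpositive (H1 * H2)%type.
Proof. by move=> p; rewrite dsum_innerE; apply: cposD; [exact: h1.1|exact: h2.1]. Qed.

Lemma dsum_complete : hcomplete (H1 * H2)%type.
Proof.
have cs := hpositive_cauchy_schwarz dsum_hpositive.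
move=> x e e0 xe.
have [m n nm|l lx] := h1.2 (fun n => (x n).1) e e0.
  exact: le_trans (hnrm_fst (x m - x n)) (xe _ _ nm).
have [m n nm|k kx] := h2.2 (fun n => (x n).2) e e0.
  exact: le_trans (hnrm_snd (x m - x n)) (xe _ _ nm).
(* Adding the component rates would double e n. Passing through a later index r, where the error is
   at most d, recovers the rate e n itself. *)
exists (l, k) => n; apply/ler_addgt0Pl => d d0.
have d40 : 0 < d / 4 by rewrite divr_gt0.
have [m em] := e0 _ d40; pose r := maxn m n.
have nr : (n <= r)%N by exact: leq_maxr.
have mr : (m <= r)%N by exact: leq_maxl.
rewrite -(subrK (x r) (l, k)) -addrA (le_trans (hnrmD cs _ _))//.
apply: lerD; last exact: xe.
rewrite -(subrK (x m) (l, k)) -addrA (le_trans (hnrmD cs _ _))//.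
have xmr : hnrm (x m - x r) <= e m by rewrite hnrmBC; exact: xe.
have : hnrm ((l, k) - x m) <= e m + e m.
  rewrite (_ : _ - _ = (l - (x m).1, 0) + (0, k - (x m).2)); last first.
    by congr pair; rewrite /= ?addr0 ?add0r.
  by rewrite (le_trans (hnrmD cs _ _))// hnrm_inl hnrm_inr lerD.
move: (hnrm (x m - x r)) (hnrm ((l, k) - x m)) xmr => a b.
by move: em; lra.
Qed.

Lemma dsum_hilbertian : hilbertian (H1 * H2)%type.
Proof. by split; [exact: dsum_hpositive|exact: dsum_complete]. Qed.

End DirectSumHilbertian.

(** By Bernoulli q^n n (1 - q) <= (q (2 - q))^n <= 1. *)
Lemma vanishing_geometric (R : realType) (q : R) : 0 <= q -> q < 1 ->
  vanishing (fun n => q ^+ n).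
Proof.
move=> q0 q1 d d0; have p0 : 0 < 1 - q by rewrite subr_gt0.
have bound n : q ^+ n * (n%:R * (1 - q)) <= 1.
  apply: (@le_trans _ _ ((q * (1 + (1 - q))) ^+ n)); last first.
    by apply: exprn_ile1; nra.
  rewrite exprMn ler_wpM2l ?exprn_ge0// (le_trans _ (bernoulli n (ltW p0)))//.
  by rewrite lerDr.
have := archi_boundP (ltW (divr_gt0 (@ltr01 R) (mulr_gt0 d0 p0))).
set n := Num.bound _; rewrite ltr_pdivrMr ?mulr_gt0// => nd.
have np : 0 < n%:R * (1 - q).
  rewrite mulr_gt0// ltr0n lt0n; apply: contraTneq nd => ->.
exists n; rewrite -(ltr_pM2r np) (le_lt_trans (bound n))//.
by rewrite mulrCA.
Qed.

Lemma vanishing_harmonic (R : realType) (c : R) : 0 <= c ->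
  vanishing (fun n => c / n.+1%:R).
Proof.
move=> c0 d d0; have := archi_boundP (divr_ge0 c0 (ltW d0)).
set n := Num.bound _; rewrite ltr_pdivrMr// => cn; exists n.
rewrite ltr_pdivrMr// mulrC (lt_le_trans cn)// ler_wpM2r ?(ltW d0)//.
by rewrite ler_nat.
Qed.

(** * Homomorphisms of operator algebras *)

Section Series.
Context (R : realType) (B : cstarAlgType R) (H : innerModType B).
Hypothesis hH : hilbertian H.
Let cs := hilbertian_cs hH.

Lemma op_series (F : nat -> adjointable H) (a q : R) : 0 <= a -> 0 <= q -> q < 1 ->
    (forall k, bnd (F k) (a * q ^+ k)) ->
  exists L, forall n, bnd (L - \sum_(k < n) F k) (q ^+ n * (a / (1 - q))).
Proof.
move=> a0 q0 q1 Fq; have p0 : 0 < 1 - q by rewrite subr_gt0.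
have ap0 : 0 <= a / (1 - q) by rewrite divr_ge0// ltW.
have diff m n : (n <= m)%N ->
    bnd (\sum_(k < m) F k - \sum_(k < n) F k) ((q ^+ n - q ^+ m) * (a / (1 - q))).
  elim: m => [|m IHm].
    by rewrite leqn0 => /eqP ->; rewrite !subrr mul0r; exact: bnd0.
  rewrite leq_eqVlt => /predU1P[->|].
    by rewrite !subrr mul0r; exact: bnd0.
  rewrite ltnS => /IHm {}IHm; rewrite big_ord_recr /= addrAC.
  apply: bndW (bndD cs IHm (Fq m)); rewrite exprS le_eqVlt; apply/orP; left.
  apply/eqP; field; exact: lt0r_neq0.
apply: (op_complete cs hH.2).
- by apply: vanishingM => //; exact: vanishing_geometric.
- by move=> n; rewrite mulr_ge0// exprn_ge0.
- move=> m n /diff; apply: bndW; rewrite ler_wpM2r// gerBl exprn_ge0//.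
Qed.

(** The partial sums are kept with their rate because an algebraic homomorphism acts on polynomials,
    not on the inverse. *)
Lemma op_neumann Q (q : R) : 0 <= q -> q < 1 -> bnd Q q ->
  exists (L : adjointable H) (K : R), [/\ 0 <= K, L * (1 - Q) = 1, (1 - Q) * L = 1 &
    forall n, bnd (L - \sum_(k < n) Q ^+ k) (q ^+ n * K)].
Proof.
move=> q0 q1 Qq.
have [|L LQ] := @op_series (fun k => Q ^+ k) 1 q ler01 q0 q1.
  by move=> k; rewrite mul1r; exact: bndX.
have rate0 : 0 <= 1 / (1 - q) by rewrite divr_ge0// subr_ge0 ltW.
move: (1 / (1 - q)) rate0 LQ => K K0 LQ.
have tele n : (\sum_(k < n) Q ^+ k) * (1 - Q) = 1 - Q ^+ n.
  rewrite -geometric_telescope mulr_suml; apply: eq_bigr => k _.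
  by apply/commr_sym/commrX/commr_sym/commrB; [exact: commr1|exact: commr_refl].
have tele' n : (1 - Q) * (\sum_(k < n) Q ^+ k) = 1 - Q ^+ n.
  by rewrite -geometric_telescope mulr_sumr.
have vq := vanishing_geometric q0 q1.
have d1 : bnd (1 - Q) (1 + q) by apply: (bndB cs) => //; exact: bnd1.
have qn0 n : 0 <= q ^+ n by rewrite exprn_ge0.
have Kd0 : 0 <= K * (1 + q) + 1 by rewrite addr_ge0 ?mulr_ge0 ?addr_ge0.
have LQ1 : L * (1 - Q) = 1.
  apply/eqP; rewrite -subr_eq0; apply/eqP; apply: (bnd_vanishing cs vq Kd0) => n.
  rewrite (_ : _ - 1 = (L - \sum_(k < n) Q ^+ k) * (1 - Q) - Q ^+ n).
    rewrite (_ : q ^+ n * _ = q ^+ n * K * (1 + q) + q ^+ n); last by ring.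
    apply: (bndB cs); last exact: bndX.
    by apply: bndM => //; exact: mulr_ge0.
  by rewrite mulrBl tele opprB addrA addrAC addrK.
have QL1 : (1 - Q) * L = 1.
  apply/eqP; rewrite -subr_eq0; apply/eqP; apply: (bnd_vanishing cs vq Kd0) => n.
  rewrite (_ : _ - 1 = (1 - Q) * (L - \sum_(k < n) Q ^+ k) - Q ^+ n).
    rewrite (_ : q ^+ n * _ = (1 + q) * (q ^+ n * K) + q ^+ n); last by ring.
    apply: (bndB cs); last exact: bndX.
    by apply: bndM => //; rewrite addr_ge0.
  by rewrite mulrBr tele' opprB addrA addrAC addrK.
by exists L, K.
Qed.

(* T1 = T (1 + T^* T)^-1; writing z = y + T^* T y one has T1 z = T y and
   <z, z> = <y - T^* T y, y - T^* T y> + 4 <T y, T y>. *)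
Lemma op_resolvent T : bounded_op T ->
  exists (T1 : adjointable H) (Q : adjointable H) (a b : R),
    [/\ T1 + T1 * (adjop T * T) = T, bnd T1 2^-1,
      Q = a%:C *: (b%:C *: (1 : adjointable H) - adjop T * T) &
      forall e, 0 < e -> exists n, bnd (T1 - a%:C *: (T * \sum_(k < n) Q ^+ k)) e].
Proof.
move=> [c c0 Tc]; set X := adjop T * T; set b := c ^+ 2.
have b0 : 0 < b by rewrite exprn_gt0.
have Xb : bnd X b.
  by rewrite /b expr2; apply: bndM; rewrite ?ltW//; apply: bnd_adjop => //; exact: ltW.
have Xp : posop X by apply: (posop_adjopM cs hH.2); exists c.
(* Chosen so that a (1 + X) = 1 - Q with |Q| <= a b < 1: the Neumann series applies however large X
   is. *)
pose a := (b + 1)^-1; have a0 : 0 < a by rewrite invr_gt0 addr_gt0.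
pose q := a * b; have q0 : 0 <= q by rewrite mulr_ge0 ?ltW.
have q1 : q < 1 by rewrite /q /a mulrC ltr_pdivrMr ?mul1r ?ltrDl ?addr_gt0.
pose Q := a%:C *: (b%:C *: (1 : adjointable H) - X).
have Qq : bnd Q q.
  rewrite /q -[a in a * b]ger0_norm ?ltW//; apply: bndZR.
  exact: (posop_bnd_sub cs hH.2).
have [L [K [K0 LQ1 QL1 LQ]]] := op_neumann q0 q1 Qq.
have vq := vanishing_geometric q0 q1.
have Q1 : 1 - Q = a%:C *: (1 + X).
  rewrite /Q scalerBr scalerA opprB addrCA -[1 in X in _ + (X - _)]scale1r.
  rewrite -scalerBl scalerDr addrC -realCM -[1%R in X in X - _]/(1%:C).
  rewrite -rmorphB; congr (_ *: _ + _); congr (_%:C).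
  by rewrite /a; field; apply: lt0r_neq0; rewrite addr_gt0.
exists (a%:C *: (T * L)), Q, a, b; split=> //.
- rewrite -[X in X + _]mulr1 -mulrDr -scaleopAl scaleopAr -Q1 -mulrA LQ1.
  exact: mulr1.
- move=> z; have [y zE ->] : exists2 y, z = y + X y & (a%:C *: (T * L)) z = T y.
    exists (a%:C *: L z); last by rewrite opZ.
    rewrite opZ -scalerDr -[z in LHS]oneopE -QL1 mulopE Q1 scaleopE addopE.
    by rewrite oneopE.
  have TyX : inner y (X y) = inner (T y) (T y) :> B by rewrite adjopP.
  have XyT : inner (X y) y = inner (T y) (T y) :> B.
    by rewrite -inner_star TyX inner_star.
  have zz : inner z z = inner (2%:C *: T y) (2%:C *: T y) +
      inner (y - X y) (y - X y) :> B.
    rewrite {1 2}zE !(innerBl, innerBr, innerDl, innerDr) TyX XyT.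
    rewrite innerZl innerZr conjc_real scalerA -realCM.
    rewrite (_ : 2 * 2 = 1 + 1 + 1 + 1 :> R); last by ring.
    rewrite !realCD !scalerDl !scale1r opprB.
    by rewrite [RHS](AC (4*(2*2)) ((5*1)*(2*7)*((3*6)*(4*8))))/= !subrr !addr0.
  have := cpos_nrm_le (hH.1 (2%:C *: T y)) (hH.1 (y - X y)).
  rewrite -zz -!hnrm_sqr hnrmZR ger0_norm// ler_pXn2r ?nnegrE ?mulr_ge0 ?hnrm_ge0//.
  by lra.
- move=> e e0; have [|n ne] := vanishingM (c := a * c * K) vq _ e0.
    by apply: mulr_ge0 => //; apply: mulr_ge0; exact: ltW.
  exists n; rewrite -scalerBr -mulrBr; apply: bndW (ltW ne) _.
  rewrite (_ : q ^+ n * _ = `|a| * (c * (q ^+ n * K))).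
    by apply: bndZR; apply: bndM => //; exact: ltW.
  by rewrite ger0_norm ?ltW//; ring.
Qed.

End Series.

(* An algebraic *-homomorphism between *-algebras of operators, given by its
   graph. In [op_graph_factor] the constant depends only on S: this is what
   S having finite rank gives. *)
Record op_graph (R : realType) (B C : cstarAlgType R) (H : innerModType B)
    (K : innerModType C) (Gr : adjointable H -> adjointable K -> Prop) : Prop := {
  op_graph0 : Gr 0 0;
  op_graphD : forall S S' T T', Gr S S' -> Gr T T' -> Gr (S + T) (S' + T');
  op_graphZ : forall (a : R[i]) S S', Gr S S' -> Gr (a *: S) (a *: S');
  op_graphM : forall S S' T T', Gr S S' -> Gr T T' -> Gr (S * T) (S' * T');
  op_graph_adjop : forall S S', Gr S S' -> Gr (adjop S) (adjop S');
  op_graph_bounded : forall S S', Gr S S' -> bounded_op S /\ bounded_op S';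
  op_graph_factor : forall S S', Gr S S' -> exists2 c, 0 <= c &
    forall T T' d, 0 <= d -> Gr T T' -> bnd T d -> bnd (T' * S') (d * c) }.

(** * Contractivity, closed graphs and closed range *)

Section OpGraph.
Context (R : realType) (B C : cstarAlgType R) (H : innerModType B).
Context (K : innerModType C) (hH : hilbertian H) (hK : hilbertian K).
Context (Gr : adjointable H -> adjointable K -> Prop) (GrP : op_graph Gr).
Let csH := hilbertian_cs hH.
Let csK := hilbertian_cs hK.

Lemma op_graph_contractive S S' (e : R) : Gr S S' -> 0 <= e -> bnd S e -> bnd S' e.
Proof.
move=> SS'; suff pos_case d : 0 < d -> bnd S d -> bnd S' d.
  move=> e0 Se; apply: bnd_eps => d d0; apply: pos_case; first by rewrite ltr_wpDl.
  by apply: bndW Se; rewrite lerDl ltW.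
move=> d0 Sd; have [c c0 Sc] := op_graph_factor GrP SS'.
pose X := adjop S * S; pose X' := adjop S' * S'.
have XX' : Gr X X' by apply: (op_graphM GrP) => //; exact: op_graph_adjop.
have Xd : bnd X (d ^+ 2).
  by rewrite expr2; apply: bndM => //; [exact: ltW|apply: bnd_adjop => //; exact: ltW].
apply: (bnd_cstar csK); first exact: ltW.
(* X'^(n+1) = Z' S' where Z' is the image of a product Z of 2n + 1 factors S or S^*, so |Z' S'| <= c
   d^(2n+1). The missing factor d goes into the constant c / d. *)
apply: (@power_trick _ _ _ csK _ _ (c / d)).
- by rewrite adjopM adjopK.
- by rewrite exprn_ge0 ?ltW.
- by apply: divr_ge0 => //; exact: ltW.
move=> k; have : (0 < 2 ^ k)%N by rewrite expn_gt0.
case: (2 ^ k)%N => // n _.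
have [Z [Z' [ZZ' Zd ZE]]] : exists Z Z', [/\ Gr Z Z', bnd Z (d ^+ 2 ^+ n * d) &
    X' ^+ n.+1 = Z' * S'].
  elim: n => [|n [Z [Z' [ZZ' Zd ZE]]]].
    exists (adjop S), (adjop S'); rewrite expr0 mul1r; split=> //.
      exact: op_graph_adjop.
    by apply: bnd_adjop => //; exact: ltW.
  exists (X * Z), (X' * Z'); split; first exact: op_graphM.
    by rewrite exprS -mulrA; apply: bndM => //; rewrite exprn_ge0// ltW.
  by rewrite exprS ZE mulrA.
rewrite ZE; have dn : 0 <= d ^+ 2 ^+ n by rewrite !exprn_ge0 ?ltW.
apply: bndW (Sc _ _ _ _ ZZ' Zd); last by rewrite mulr_ge0// ltW.
rewrite [d ^+ 2 ^+ n.+1]exprS [leRHS](_ : _ = (d ^+ 2 ^+ n * d * c) * n.+1%:R).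
  by rewrite ler_peMr ?ler1n// !mulr_ge0// ltW.
by field; exact: lt0r_neq0.
Qed.

(** Extension by continuity on relations: contractivity makes the closed graph functional,
    completeness makes it defined on the closure of its domain. *)
Definition graph_closure T T' := forall e : R, 0 < e ->
  exists S S', [/\ Gr S S', bnd (T - S) e & bnd (T' - S') e].

Local Notation cl := graph_closure.

Lemma graph_closure_sub S S' : Gr S S' -> cl S S'.
Proof.
by move=> SS' e e0; exists S, S'; split=> //; rewrite subrr; apply: bnd0; exact: ltW.
Qed.

Lemma graph_closureD S S' T T' : cl S S' -> cl T T' -> cl (S + T) (S' + T').
Proof.
move=> ST TT e e0; have e20 : 0 < e / 2 by rewrite divr_gt0.
have [S1 [S1' [Gr1 S1e S1e']]] := ST _ e20.
have [T1 [T1' [Gr2 T1e T1e']]] := TT _ e20.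
exists (S1 + T1), (S1' + T1'); split; first exact: op_graphD.
  by rewrite opprD addrACA [e]splitr; exact: bndD.
by rewrite opprD addrACA [e]splitr; exact: bndD.
Qed.

Lemma graph_closureZ (a : R[i]) T T' : cl T T' -> cl (a *: T) (a *: T').
Proof.
move=> TT e e0; have a1 : 0 < modc a + 1 by rewrite ltr_wpDl ?modc_ge0.
have [S [S' [SS Se Se']]] := TT _ (divr_gt0 e0 a1).
have ae : modc a * (e / (modc a + 1)) <= e.
  by rewrite mulrCA ler_piMr ?(ltW e0)// ler_pdivrMr// mul1r lerDl.
exists (a *: S), (a *: S'); split; first exact: op_graphZ.
  by rewrite -scalerBr; apply: bndW ae _; exact: bndZ.
by rewrite -scalerBr; apply: bndW ae _; exact: bndZ.
Qed.

Lemma graph_closureN T T' : cl T T' -> cl (- T) (- T').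
Proof. by rewrite -[- T]scaleN1r -[- T']scaleN1r; exact: graph_closureZ. Qed.

Lemma graph_closureB S S' T T' : cl S S' -> cl T T' -> cl (S - T) (S' - T').
Proof. by move=> ? ?; apply: graph_closureD => //; exact: graph_closureN. Qed.

Lemma graph_closure_adjop T T' : cl T T' -> cl (adjop T) (adjop T').
Proof.
move=> TT e e0; have [S [S' [SS Se Se']]] := TT _ e0.
exists (adjop S), (adjop S'); split; first exact: op_graph_adjop.
  by rewrite -adjopB; apply: bnd_adjop => //; exact: ltW.
by rewrite -adjopB; apply: bnd_adjop => //; exact: ltW.
Qed.

Lemma graph_closure_bounded T T' : cl T T' -> bounded_op T /\ bounded_op T'.
Proof.
move=> TT; have [S [S' [/(op_graph_bounded GrP)[Sb Sb'] Se Se']]] := TT _ ltr01.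
split; first by rewrite -(subrK S T); apply: bounded_opD => //; exists 1.
by rewrite -(subrK S' T'); apply: bounded_opD => //; exists 1.
Qed.

Lemma graph_closureM S S' T T' : cl S S' -> cl T T' -> cl (S * T) (S' * T').
Proof.
move=> SS TT; have [[c c0 Tc] [c' c'0 Tc']] := graph_closure_bounded TT.
move=> e e0; pose k := c + c' + 1; have k0 : 0 < k by rewrite !addr_gt0.
have e1 : 0 < e / 2 / k by rewrite !divr_gt0.
(* S is approximated first: the precision required for T depends on bounds of the chosen [S1] and
   [S1']. *)
have [S1 [S1' [Gr1 S1e S1e']]] := SS _ e1.
have [[d d0 Sd] [d' d'0 Sd']] := op_graph_bounded GrP Gr1.
pose l := d + d' + 1; have l0 : 0 < l by rewrite !addr_gt0.
have e2 : 0 < e / 2 / l by rewrite !divr_gt0.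
have [T1 [T1' [Gr2 T1e T1e']]] := TT _ e2.
have dec (A1 A2 : cstarAlgType R) (V : innerModType A1) (X Y Z W : adjointable V) :
  X * Y - Z * W = (X - Z) * Y + Z * (Y - W) by rewrite mulrBl mulrBr addrA subrK.
have ek : e / 2 / k * k = e / 2 by rewrite divfK ?gt_eqF.
have el : l * (e / 2 / l) = e / 2 by rewrite mulrC divfK ?gt_eqF.
exists (S1 * T1), (S1' * T1'); split; first exact: op_graphM.
  rewrite dec// [e]splitr -{1}ek -{2}el; apply: (bndD csH); apply: bndM => //.
  - exact: ltW.
  - by apply: bndW Tc; rewrite /k -addrA lerDl addr_ge0 ?ltW.
  - exact: ltW.
  - by apply: bndW Sd; rewrite /l -addrA lerDl addr_ge0 ?ltW.
rewrite dec// [e]splitr -{1}ek -{2}el; apply: (bndD csK); apply: bndM => //.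
- exact: ltW.
- by apply: bndW Tc'; rewrite /k addrAC lerDr addr_ge0 ?ltW.
- exact: ltW.
- by apply: bndW Sd'; rewrite /l addrAC lerDr addr_ge0 ?ltW.
Qed.

Lemma graph_closure_contractive T T' (e : R) : cl T T' -> 0 <= e -> bnd T e -> bnd T' e.
Proof.
move=> TT e0 Te; apply: bnd_eps => d d0; have d20 : 0 < d / 2 by rewrite divr_gt0.
have [S [S' [SS Sd Sd']]] := TT _ d20.
have Se : bnd S (e + d / 2).
  rewrite -(subrK T S) addrC; apply: (bndD csH) => //; exact: bndBC.
rewrite -(subrK S' T') [d]splitr addrA addrC; apply: (bndD csK) => //.
by apply: (op_graph_contractive SS) => //; rewrite addr_ge0// ltW.
Qed.

Lemma graph_closure_closed T T' :
  (forall e, 0 < e -> exists S S', [/\ cl S S', bnd (T - S) e & bnd (T' - S') e]) ->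
  cl T T'.
Proof.
move=> TT e e0; have e20 : 0 < e / 2 by rewrite divr_gt0.
have [S [S' [SS Se Se']]] := TT _ e20.
have [S1 [S1' [SS1 S1e S1e']]] := SS _ e20.
exists S1, S1'; split=> //; rewrite [e]splitr.
  by rewrite -(subrK S T) -addrA; exact: bndD.
by rewrite -(subrK S' T') -addrA; exact: bndD.
Qed.

Lemma graph_closure_functional T T1 T2 : cl T T1 -> cl T T2 -> T1 = T2.
Proof.
move=> /graph_closureB TT /TT; rewrite subrr => TT0.
apply/eqP; rewrite -subr_eq0; apply/eqP/(bnd0_eq0 csK).
by apply: (graph_closure_contractive TT0) => //; exact: bnd0.
Qed.

Lemma graph_closure_total T :
  (forall e, 0 < e -> exists S S', cl S S' /\ bnd (T - S) e) -> exists T', cl T T'.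
Proof.
move=> TS; pose e n : R := n.+1%:R^-1; have e0 n : 0 < e n by rewrite invr_gt0.
have /choice[f fP] : forall n, exists SS : adjointable H * adjointable K,
    cl SS.1 SS.2 /\ bnd (T - SS.1) (e n).
  by move=> n; have [S [S' [SS Se]]] := TS _ (e0 n); exists (S, S').
have ve : vanishing (fun n => 2 / n.+1%:R : R) by exact: vanishing_harmonic.
have [||T' TT'] := @op_complete _ _ _ csK hK.2 (fun n => (f n).2) _ ve.
- by move=> n; rewrite divr_ge0.
- move=> m n nm; have [cm Tm] := fP m; have [cn Tn] := fP n.
  apply: (graph_closure_contractive (graph_closureB cm cn)); first by rewrite divr_ge0.
  rewrite -(subrK T (f m).1) -addrA mulrDl mul1r; apply: (bndD csH) => //.
  by apply: bndBC; apply: bndW Tm; rewrite lef_pV2 ?posrE ?ltr0n// ler_nat ltnS.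
exists T'; apply: graph_closure_closed => d d0; have [n nd] := ve _ d0.
have [cn Tn] := fP n; exists (f n).1, (f n).2; split=> //.
  apply: bndW Tn; apply: le_trans (ltW nd); rewrite /e ler_peMl ?invr_ge0//.
  by rewrite ler1n.
by apply: bndW (TT' n); exact: ltW.
Qed.

(** The resolvent T is a limit of polynomials in S and S^* without constant term, so it has an image
    T', and functionality gives S' = T' + T' S'^* S'. Contractivity bounds T' by 1/2, hence also S'
    - T'. *)
Lemma graph_closure_resolvent S S' : cl S S' -> bnd S' 1 ->
  exists T T', [/\ cl T T', bnd T 2^-1 & bnd (S' - T') 2^-1].
Proof.
move=> SS Sb'; have [Sb _] := graph_closure_bounded SS.
have [T [Q [a [b [TS T2 QE TQ]]]]] := op_resolvent hH Sb.
have XX : cl (adjop S * S) (adjop S' * S').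
  by apply: graph_closureM => //; exact: graph_closure_adjop.
pose Q' := a%:C *: (b%:C *: (1 : adjointable K) - adjop S' * S').
have pow n : cl (S * Q ^+ n) (S' * Q' ^+ n).
  elim: n => [|n IHn]; first by rewrite !expr0 !mulr1.
  rewrite !exprSr !mulrA; move: IHn; move: (S * Q ^+ n) (S' * Q' ^+ n) => Z Z' ZZ.
  rewrite QE /Q' -!scaleopAr !mulrBr -!scaleopAr !mulr1.
  apply/graph_closureZ/graph_closureB; first exact: graph_closureZ.
  exact: graph_closureM.
have sum n : cl (a%:C *: (S * \sum_(k < n) Q ^+ k)) (a%:C *: (S' * \sum_(k < n) Q' ^+ k)).
  apply: graph_closureZ; elim: n => [|n IHn].
    by rewrite !big_ord0 !mulr0; apply/graph_closure_sub/(op_graph0 GrP).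
  by rewrite !big_ord_recr !mulrDr; apply: graph_closureD.
have [T' TT'] : exists T', cl T T'.
  apply: graph_closure_total => e e0; have [n Tn] := TQ _ e0.
  by exists (a%:C *: (S * \sum_(k < n) Q ^+ k)), (a%:C *: (S' * \sum_(k < n) Q' ^+ k)).
have SE' : S' = T' + T' * (adjop S' * S').
  apply: (graph_closure_functional SS); rewrite -[X in cl X]TS.
  by apply: graph_closureD => //; exact: graph_closureM.
exists T, T'; split=> //; rewrite [X in X - T']SE' addrC addKr.
have h0 : 0 <= 2^-1 :> R by rewrite invr_ge0.
have T2' : bnd T' 2^-1 by apply: (graph_closure_contractive TT').
have X1 := bndM ler01 (bnd_adjop csK ler01 Sb') Sb'.
by have := bndM h0 T2' X1; rewrite !mulr1.
Qed.

Definition range_closure T' := forall e : R, 0 < e ->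
  exists S S', cl S S' /\ bnd (T' - S') e.

Lemma range_closure_step T' (c : R) : 0 < c -> range_closure T' -> bnd T' c ->
  exists S S', [/\ cl S S', bnd S c & bnd (T' - S') (c * (3 / 4))].
Proof.
move=> c0 rT Tc; have c8 : 0 < c / 8 by rewrite divr_gt0.
have [S [S' [SS TS]]] := rT _ c8.
(* S' is only near T', so it becomes a contraction after division by d = 9c/8. The lift d T1 has
   norm at most 9c/16 <= c, and the error is at most c/8 + 9c/16 <= 3c/4. *)
pose d := c + c / 8; have d0 : 0 < d by rewrite addr_gt0.
have Sd : bnd S' d.
  by rewrite -(subrK T' S') addrC; apply: (bndD csK) => //; exact: bndBC.
have d1 : d * d^-1 = 1 by rewrite divff// gt_eqF.
have Sd1 : bnd (d^-1%:C *: S') 1.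
  by have := bndZR d^-1 Sd; rewrite ger0_norm ?invr_ge0 ?(ltW d0)// mulrC d1.
have [T1 [T1' [TT T1b T1b']]] :=
  graph_closure_resolvent (graph_closureZ d^-1%:C SS) Sd1.
have dd : `|d| = d by rewrite ger0_norm// ltW.
exists (d%:C *: T1), (d%:C *: T1'); split; first exact: graph_closureZ.
  by apply: bndW (bndZR d T1b); rewrite dd /d; move: c0; lra.
have -> : T' - d%:C *: T1' = (T' - S') + d%:C *: (d^-1%:C *: S' - T1').
  by rewrite scalerBr scalerA -realCM d1 scale1r addrA subrK.
apply: bndW (bndD csK TS (bndZR d T1b')); rewrite dd /d; move: c0; lra.
Qed.

(** As in the open mapping theorem: lifting a remainder leaves one with 3/4 of its bound, and the
    lifts are dominated by a geometric series. *)
Lemma range_closure_closed T' : bounded_op T' -> range_closure T' -> exists T, cl T T'.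
Proof.
move=> [c c0 Tc] rT.
(* Guarded by its hypotheses, so that one choice function serves all pairs; elsewhere its value (0,
   0) is arbitrary. *)
pose good (r : adjointable K) (d : R) (SS : adjointable H * adjointable K) :=
  0 < d -> range_closure r -> bnd r d ->
  [/\ cl SS.1 SS.2, bnd SS.1 d & bnd (r - SS.2) (d * (3 / 4))].
have /choice[f fP] : forall rd : adjointable K * R, exists SS, good rd.1 rd.2 SS.
  move=> [r d]; have [[d0 rr rd]|no] := pselect [/\ 0 < d, range_closure r & bnd r d].
    by have [S [S' SS]] := range_closure_step d0 rr rd; exists (S, S').
  by exists (0, 0) => d0 rr rd; case: no.
pose q : R := 3 / 4; have q0 : 0 < q by rewrite divr_gt0.
have q1 : q < 1 by rewrite ltr_pdivrMr// mul1r ltr_nat.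
pose fix r n := if n is n'.+1 then r n' - (f (r n', c * q ^+ n')).2 else T'.
pose F n := f (r n, c * q ^+ n).
have cq n : 0 < c * q ^+ n by rewrite mulr_gt0// exprn_gt0.
have inv n : range_closure (r n) /\ bnd (r n) (c * q ^+ n).
  elim: n => [|n [rn rb]]; first by rewrite expr0 mulr1.
  have [FF Fb rF] := fP (r n, c * q ^+ n) (cq n) rn rb.
  split; last by rewrite exprSr mulrA.
  move=> e e0; have [S [S' [SS Se]]] := rn _ e0.
  exists (S - (F n).1), (S' - (F n).2); split; first exact: graph_closureB.
  by rewrite /= opprB addrA subrK.
have FP n : [/\ cl (F n).1 (F n).2, bnd (F n).1 (c * q ^+ n) & _] :=
  fP (r n, c * q ^+ n) (cq n) (inv n).1 (inv n).2.
have [|T TF] := op_series hH (ltW c0) (ltW q0) q1 (F := fun n => (F n).1).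
  by move=> n; have [] := FP n.
have rE n : r n = T' - \sum_(k < n) (F k).2.
  elim: n => [|n IHn]; first by rewrite big_ord0 subr0.
  by rewrite big_ord_recr opprD addrA -IHn.
have sum n : cl (\sum_(k < n) (F k).1) (\sum_(k < n) (F k).2).
  elim: n => [|n IHn].
    by rewrite !big_ord0; apply/graph_closure_sub/(op_graph0 GrP).
  by rewrite !big_ord_recr; apply: graph_closureD => //; have [] := FP n.
exists T; apply: graph_closure_closed => e e0.
pose k := c + c / (1 - q).
have k0 : 0 <= c / (1 - q) by rewrite divr_ge0 ?subr_ge0 ?ltW.
have [|n ne] := vanishingM (c := k) (vanishing_geometric (ltW q0) q1) _ e0.
  by rewrite addr_ge0// ltW.
have qn : 0 <= q ^+ n by rewrite exprn_ge0 ?ltW.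
exists (\sum_(k < n) (F k).1), (\sum_(k < n) (F k).2); split=> //.
  apply: bndW (TF n); apply: le_trans (ltW ne); rewrite ler_wpM2l// /k lerDr.
  exact: ltW.
rewrite -rE; apply: bndW (inv n).2; apply: le_trans (ltW ne).
by rewrite mulrC ler_wpM2l// /k lerDl.
Qed.

End OpGraph.

(** * Ternary homomorphisms and compact operators *)

Section LspanInduction.
Context (K : pzRingType) (V W : lmodType K).

Lemma lspan_ind (X : set V) (P : V -> Prop) : P 0 ->
    (forall x y, P x -> P y -> P (x + y)) -> (forall (a : K) x, X x -> P (a *: x)) ->
  forall v, lspan X v -> P v.
Proof.
move=> P0 PD PX v [n [a [x [Xx ->]]]].
by elim/big_ind: _ => // i _; exact: PX.
Qed.

Lemma lspan_image (X : set V) (Y : set W) (f : V -> W) :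
    (forall (a : K) x y, f (a *: x + y) = a *: f x + f y) ->
    (forall x, X x -> lspan Y (f x)) ->
  forall v, lspan X v -> lspan Y (f v).
Proof.
move=> lf XY; have f0 : f 0 = 0.
  by have := lf (-1) 0 0; rewrite addr0 scaler0 scaleN1r addNr.
apply: lspan_ind => [|x y fx fy|a x Xx]; first by rewrite f0; exact: lspan0.
  by rewrite -[x]scale1r lf scale1r; exact: lspanD.
by rewrite -[_ *: x]addr0 lf f0 addr0; apply/lspanZ/XY.
Qed.

End LspanInduction.

Section OpGraphSpan.
Context (R : realType) (B C : cstarAlgType R) (H : innerModType B).
Context (K : innerModType C) (hH : hilbertian H) (hK : hilbertian K).
Context (X : set (adjointable H * adjointable K)).

(** For the factor condition, T ranges over the whole span while only S is decomposed, so the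
    constants of the generators add up. *)
Lemma op_graph_lspan :
    (forall S S', X (S, S') -> lspan X (adjop S, adjop S')) ->
    (forall S S' T T', X (S, S') -> X (T, T') -> lspan X (S * T, S' * T')) ->
    (forall S S', X (S, S') -> bounded_op S /\ bounded_op S') ->
    (forall S S', X (S, S') -> exists2 c : R, 0 <= c & forall T T' d, 0 <= d ->
      lspan X (T, T') -> bnd T d -> bnd (T' * S') (d * c)) ->
  op_graph (fun S S' => lspan X (S, S')).
Proof.
have csH := hilbertian_cs hH; have csK := hilbertian_cs hK.
move=> Xs XM Xb Xf; split.
- exact: lspan0.
- by move=> S S' T T'; exact: lspanD.
- by move=> a S S'; exact: lspanZ.
- move=> S S' T T' XS XT.
  pose P (p : adjointable H * adjointable K) := lspan X (p.1 * T, p.2 * T').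
  apply: (@lspan_ind _ _ X P _ _ _ (S, S')) => // [|x y|a [U U'] XU]; rewrite /P /=.
  + by rewrite !mul0r; exact: lspan0.
  + by rewrite !mulrDl; exact: lspanD.
  rewrite -!scaleopAl; apply: (@lspanZ _ _ _ a (_, _)).
  pose Q (p : adjointable H * adjointable K) := lspan X (U * p.1, U' * p.2).
  apply: (@lspan_ind _ _ X Q _ _ _ (T, T')) => // [|x y|b [Z Z'] XZ]; rewrite /Q /=.
  + by rewrite !mulr0; exact: lspan0.
  + by rewrite !mulrDr; exact: lspanD.
  by rewrite -!scaleopAr; apply: (@lspanZ _ _ _ b (_, _)); exact: XM.
- move=> S S'; pose P (p : adjointable H * adjointable K) := lspan X (adjop p.1, adjop p.2).
  apply: (@lspan_ind _ _ X P) => [|x y|a [U U'] XU]; rewrite /P /=.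
  + by rewrite !adjop0; exact: lspan0.
  + by rewrite !adjopD; exact: lspanD.
  by rewrite !adjopZ; apply: (@lspanZ _ _ _ _ (_, _)); exact: Xs.
- move=> S S'; pose P (p : adjointable H * adjointable K) := bounded_op p.1 /\ bounded_op p.2.
  apply: (@lspan_ind _ _ X P) => [|x y [? ?] [? ?]|a [U U'] XU]; rewrite /P /=.
  + by split; apply: (@bounded_op_bnd _ _ _ _ 0); exact: bnd0.
  + by split; exact: bounded_opD.
  by have [? ?] := Xb _ _ XU; split; exact: bounded_opZ.
- move=> S S'; pose P (p : adjointable H * adjointable K) := exists2 c : R, 0 <= c &
    forall T T' d, 0 <= d -> lspan X (T, T') -> bnd T d -> bnd (T' * p.2) (d * c).
  apply: (@lspan_ind _ _ X P) => [|x y [c c0 xc] [d d0 yd]|a [U U'] XU]; rewrite /P /=.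
  + exists 0 => // T T' d d0 XT Td; rewrite mulr0; apply: bnd0.
    by rewrite mulr0.
  + exists (c + d); first exact: addr_ge0.
    move=> T T' e e0 XT Te; rewrite mulrDr (mulrDr e); apply: (bndD csK).
      exact: xc XT Te.
    exact: yd XT Te.
  have [c c0 Uc] := Xf _ _ XU; exists (modc a * c); first by rewrite mulr_ge0 ?modc_ge0.
  move=> T T' d d0 XT Td; rewrite -scaleopAr mulrCA; apply: bndZ.
  exact: Uc XT Td.
Qed.

End OpGraphSpan.

(** [ternary_homomorphism] for mere inner product modules: the direct sums underlying the linking
    algebras carry no [hilbertModType] structure. *)
Definition ternary_map (R : realType) (B C : cstarAlgType R) (H : innerModType B)
    (K : innerModType C) (U : H -> K) : Prop :=
  linear U /\ forall x y z : H,
    U (ract x (inner y z : B)) = ract (U x) (inner (U y) (U z) : C).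

Section TernaryMap.
Context (R : realType) (B C : cstarAlgType R) (H : innerModType B).
Context (K : innerModType C) (hH : hilbertian H) (hK : hilbertian K).
Context (U : H -> K) (tU : ternary_map U).
Let csH := hilbertian_cs hH.
Let csK := hilbertian_cs hK.
Implicit Types x y z p q : H.

Lemma ternary_linear (a : R[i]) x y : U (a *: x + y) = a *: U x + U y.
Proof. exact: tU.1. Qed.

Lemma ternary0 : U 0 = 0.
Proof. by have := ternary_linear (-1) 0 0; rewrite addr0 scaler0 scaleN1r addNr. Qed.

Lemma ternaryD x y : U (x + y) = U x + U y.
Proof. by rewrite -[x in LHS]scale1r ternary_linear scale1r. Qed.

Lemma ternaryZ (a : R[i]) x : U (a *: x) = a *: U x.
Proof. by rewrite -[a *: x]addr0 ternary_linear ternary0 addr0. Qed.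

Lemma ternaryB x y : U (x - y) = U x - U y.
Proof. by rewrite ternaryD -scaleN1r ternaryZ scaleN1r. Qed.

Lemma rank1E (A : cstarAlgType R) (V : innerModType A) (x y z : V) :
  rank1 x y z = ract x (inner y z : A).
Proof. by []. Qed.

Lemma ternary_rank1 x y z : U (rank1 x y z) = rank1 (U x) (U y) (U z).
Proof. exact: tU.2. Qed.

Lemma adjop_rank1 (A : cstarAlgType R) (V : innerModType A) (x y : V) :
  adjop (rank1 x y) = rank1 y x.
Proof. by apply: adjop_unique; exact: is_adjoint_rank1. Qed.

Lemma mul_rank1 (A : cstarAlgType R) (V : innerModType A) (T : adjointable V) (x y : V) :
  T * rank1 x y = rank1 (T x) y.
Proof. by apply: adj_inj => z; rewrite mulopE !rank1E op_ract. Qed.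

Lemma rank1_mul (A : cstarAlgType R) (V : innerModType A) (T : adjointable V) (x y : V) :
  rank1 x y * T = rank1 x (adjop T y).
Proof. by apply: adj_inj => z; rewrite mulopE !rank1E inner_adjr. Qed.

Lemma bnd_rank1 (A : cstarAlgType R) (V : innerModType A) (x y : V) :
  cauchy_schwarz V -> bnd (rank1 x y) (hnrm x * hnrm y).
Proof.
move=> csV z; rewrite rank1E (le_trans (hnrm_ract _ _))// -mulrA.
by rewrite ler_wpM2l ?hnrm_ge0.
Qed.

(* If |x| < |Ux| = 1, solve y - X^2 y = x with X = x x^*. Then w = U y and the
   positive contraction G = X'^2, X' = (Ux)(Ux)^*, satisfy Ux = (1 - G) w, so
   G^n (Ux) tends to 0, although its norm is at least 1 for n a power of 2. *)
Lemma ternary_contractive x : hnrm (U x) <= hnrm x.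
Proof.
suff key y : hnrm (U y) = 1 -> hnrm y < 1 -> False.
  rewrite leNgt; apply/negP => xU; have U0 := le_lt_trans (hnrm_ge0 _) xU.
  pose t := (hnrm (U x))^-1; have t0 : 0 < t by rewrite invr_gt0.
  apply: (key (t%:C *: x)); rewrite ?ternaryZ hnrmZR ger0_norm ?(ltW t0)//.
    by rewrite mulVf// gt_eqF.
  by rewrite mulrC ltr_pdivrMr// mul1r.
move=> U1 y1; set x' := U y in U1; pose X := rank1 y y; pose X' := rank1 x' x'.
have y0 := hnrm_ge0 y; have q0 : 0 <= hnrm y * hnrm y by rewrite mulr_ge0.
have q1 : hnrm y * hnrm y < 1 by nra.
have Xq : bnd (X * X) (hnrm y * hnrm y).
  apply: (bndW _ (bndM q0 (bnd_rank1 y y csH) (bnd_rank1 y y csH))).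
  by rewrite ler_piMl// ltW.
have [L [_ [_ _ XL _]]] := op_neumann hH q0 q1 Xq.
pose w := U (L y); pose G := X' * X'.
have wE : x' = (1 - G) w.
  rewrite subopE oneopE mulopE /X' -!ternary_rank1 -ternaryB /x'; congr U.
  exact/esym/(congr1 (fun T : adjointable H => T y) XL).
have X'1 : bnd X' 1 by have := bnd_rank1 x' x' csK; rewrite U1 mulr1.
have X'sa : adjop X' = X' by rewrite adjop_rank1.
have Gp : posop G.
  by apply: (posop_sqr csK hK.2) => //; exact: bounded_op_bnd X'1.
have G1 : bnd G 1 by have := bndM ler01 X'1 X'1; rewrite mulr1.
have G1p : posop (1 - G).
  by rewrite -[1]scale1r; apply: posop_sub_bnd => //; exact: posop_adjop.
(* G^n x' = (1 - G) G^n w, whose norm [bnd_sub_mul_exp] bounds by |w| / n. *)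
have small n : n%:R * hnrm ((G ^+ n) x') <= hnrm w.
  have comm : (1 - G) * G ^+ n = G ^+ n * (1 - G).
    by apply/commrX/commr_sym/commrB; [exact: commr1|exact: commr_refl].
  have := bnd_sub_mul_exp csK hK.2 n Gp G1p w; rewrite mul1r.
  rewrite comm -scaler_nat -(rmorph_nat (real_complex R)) hnrmZR.
  by rewrite ger0_norm// wE.
have big : 1 <= hnrm (X' x').
  have := csK x' (X' x'); rewrite U1 mul1r; apply: le_trans.
  by rewrite rank1E inner_ract -{1}inner_star nrm_cstar -hnrm_sqr U1 !expr1n.
(* By [power_iter] with |x'| = 1, the norm of G^(2^k) x' = X'^(2^(k+1)) x' is at least a power of
   |X' x'| >= 1. *)
have bound k : (2 ^ k)%:R <= hnrm w.
  apply: le_trans (small (2 ^ k)%N); rewrite ler_peMr//.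
  have := power_iter csK x' k.+1 X'sa; rewrite U1 mulr1 expr1n mul1r.
  rewrite (_ : X' ^+ _ = G ^+ (2 ^ k)); last by rewrite expnS exprM expr2.
  by apply: le_trans; exact: exprn_ege1.
have := archi_boundP (hnrm_ge0 w); set n := Num.bound _ => wn.
have n2 : n%:R <= (2 ^ n)%:R :> R by rewrite ler_nat ltnW// ltn_expl.
by have := le_lt_trans (le_trans n2 (bound n)) wn; rewrite ltxx.
Qed.

(** A finite rank operator has many expressions as a sum of operators x y^*; pairs avoid choosing
    one before contractivity shows that the image is independent of it. *)
Definition op_rank1_graph : set (adjointable H * adjointable K) :=
  [set (rank1 p.1 p.2, rank1 (U p.1) (U p.2)) | p in [set: H * H]].

Definition op_graph_of (S : adjointable H) (S' : adjointable K) :=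
  lspan op_rank1_graph (S, S').

Lemma op_graph_rank1 x y : op_graph_of (rank1 x y) (rank1 (U x) (U y)).
Proof. by apply: sub_lspan; exists (x, y). Qed.

Lemma op_graph_intertwine (S : adjointable H) S' :
  op_graph_of S S' -> forall x, S' (U x) = U (S x).
Proof.
pose P (p : adjointable H * adjointable K) := forall x, p.2 (U x) = U (p.1 x).
move=> SS'; apply: (lspan_ind _ _ _ SS' (P := P)) => [x|p q pU qU x|a _ [[y z] _ <-] x].
- by rewrite !zeroopE ternary0.
- by rewrite !addopE ternaryD pU qU.
- by rewrite !scaleopE ternaryZ ternary_rank1.
Qed.

(** For the factor condition, T' (U x)(U y)^* = U(T x)(U y)^* by intertwining, and
    [ternary_contractive] bounds this by |T x| |y|; the constant |x| |y| involves neither T nor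
    T'. *)
Lemma op_graph_ofP : op_graph op_graph_of.
Proof.
apply: (op_graph_lspan hH hK).
- move=> S S' [[x y] _ [<- <-]]; rewrite !adjop_rank1; exact: op_graph_rank1.
- move=> S S' T T' [[x y] _ [<- <-]] [[z w] _ [<- <-]] /=.
  by rewrite !mul_rank1 -ternary_rank1; exact: op_graph_rank1.
- move=> S S' [[x y] _ [<- <-]] /=.
  by split; apply: bounded_op_bnd; exact: bnd_rank1.
- move=> S S' [[x y] _ [_ <-]] /=; exists (hnrm x * hnrm y).
    by rewrite mulr_ge0 ?hnrm_ge0.
  move=> T T' d d0 TT Td; rewrite mul_rank1 (op_graph_intertwine TT).
  apply: bndW (bnd_rank1 _ _ csK); rewrite mulrA.
  apply: ler_pM; rewrite ?hnrm_ge0 ?ternary_contractive//.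
  exact: le_trans (ternary_contractive _) (Td x).
Qed.

Definition compact_rel := graph_closure op_graph_of.

Lemma compact_rel_intertwine (T : adjointable H) T' :
  compact_rel T T' -> forall x, T' (U x) = U (T x).
Proof.
move=> TT x; apply/eqP; rewrite -subr_eq0; apply/eqP/(hnrm_eq0 csK).
apply/eqP; rewrite eq_le hnrm_ge0 andbT; apply/ler_addgt0Pr => e e0; rewrite add0r.
pose k := hnrm x + hnrm x + 1; have k0 : 0 < k by rewrite ltr_wpDl ?addr_ge0 ?hnrm_ge0.
have ek0 : 0 < e / k by rewrite divr_gt0.
have [S [S' [SS Se Se']]] := TT _ ek0.
rewrite -(subrK (S' (U x)) (T' (U x))) -addrA (op_graph_intertwine SS) -ternaryB.
apply: le_trans (hnrmD csK _ _) _.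
apply: (@le_trans _ _ (e / k * hnrm x + e / k * hnrm x)).
  apply: lerD.
    rewrite -(op_graph_intertwine SS) -subopE.
    apply: le_trans (Se' _) _; apply: ler_wpM2l; first exact: ltW.
    exact: ternary_contractive.
  apply: le_trans (ternary_contractive _) _; rewrite hnrmBC; exact: Se.
by rewrite -mulrDr mulrAC ler_pdivrMr// ler_pM2l// lerDl.
Qed.

Lemma bnd_hnorm (A : cstarAlgType R) (V : innerModType A) (T : adjointable V) (e : R) :
  (forall v : V, hnorm (T v) <= e%:C * hnorm v) <-> bnd T e.
Proof. by split=> Te z; have := Te z; rewrite !hnorm_hnrm -realCM lecR. Qed.

Lemma compact_opsP (A : cstarAlgType R) (V : innerModType A) (T : adjointable V) :
  compact_ops T <-> forall e : R, 0 < e -> exists2 S : adjointable V,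
    lspan [set rank1 p.1 p.2 | p in [set: V * V]] S & bnd (T - S) e.
Proof.
split=> cT e e0.
  by have [|S SX Se] := cT e%:C; [rewrite ltcR|exists S => //; exact/bnd_hnorm].
have eE : (complex.Re e)%:C = e by rewrite RRe_real// gtr0_real.
have [|S SX Se] := cT (complex.Re e); first by rewrite -ltcR eE.
by exists S => //; rewrite -eE; exact/bnd_hnorm.
Qed.

Lemma lspan_op_graph (S : adjointable H) :
  lspan [set rank1 p.1 p.2 | p in [set: H * H]] S -> exists S', op_graph_of S S'.
Proof.
apply: (@lspan_ind _ _ _ (fun S => exists S', op_graph_of S S'))
  => [|x y [x' xx] [y' yy]|a _ [[x y] _ <-]].
- by exists 0; exact: op_graph0 op_graph_ofP.
- by exists (x' + y'); exact: op_graphD op_graph_ofP _ _ _ _ xx yy.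
- by exists (a *: rank1 (U x) (U y)); apply: (@lspanZ _ _ _ a (_, _)); exact: op_graph_rank1.
Qed.

Lemma op_graph_lspan_fst (S : adjointable H) S' : op_graph_of S S' ->
  lspan [set rank1 p.1 p.2 | p in [set: H * H]] S.
Proof.
move=> SS; apply: (lspan_image _ _ SS (f := fst)) => [//|_ [[x y] _ <-]].
by apply: sub_lspan; exists (x, y).
Qed.

Lemma op_graph_lspan_snd (S : adjointable H) S' : op_graph_of S S' ->
  lspan [set rank1 p.1 p.2 | p in [set: K * K]] S'.
Proof.
move=> SS; apply: (lspan_image _ _ SS (f := snd)) => [//|_ [[x y] _ <-]].
by apply: sub_lspan; exists (U x, U y).
Qed.

Lemma compact_rel_fst (T : adjointable H) T' : compact_rel T T' -> compact_ops T.
Proof.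
move=> TT; apply/compact_opsP => e e0; have [S [S' [SS Se _]]] := TT _ e0.
by exists S => //; exact: op_graph_lspan_fst SS.
Qed.

Lemma compact_rel_snd (T : adjointable H) T' : compact_rel T T' -> compact_ops T'.
Proof.
move=> TT; apply/compact_opsP => e e0; have [S [S' [SS _ Se]]] := TT _ e0.
by exists S' => //; exact: op_graph_lspan_snd SS.
Qed.

Lemma compact_rel_total (T : adjointable H) :
  compact_ops T -> exists T', compact_rel T T'.
Proof.
move=> /compact_opsP cT; apply: (graph_closure_total hH hK op_graph_ofP) => e e0.
have [S /lspan_op_graph[S' SS] Se] := cT _ e0; exists S, S'; split=> //.
exact: graph_closure_sub.
Qed.

End TernaryMap.

(** Z = 1 - (1 - T0^* T0)^(n+1), with T0 = T / c a contraction, is a polynomial in T^* T without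
    constant term; [P] abstracts a set containing such polynomials. By [bnd_mul_exp_one_sub] the
    error is at most c / sqrt (n+1). *)
Lemma op_approx (R : realType) (B : cstarAlgType R) (H : innerModType B)
    (hH : hilbertian H) (T : adjointable H) (P : adjointable H -> Prop) :
    bounded_op T -> P (adjop T * T) ->
    (forall (a : R[i]) Y Z, P Y -> P Z -> P (a *: Y + Z)) ->
    (forall Z, P Z -> P (adjop T * T * Z)) ->
  forall e : R, 0 < e -> exists2 Z, P Z & bnd (T - T * Z) e.
Proof.
have cs := hilbertian_cs hH; move=> [c c0 Tc] PX PD PM e e0.
have PZ (a : R[i]) Z : P Z -> P (a *: Z).
  by move=> Zp; rewrite -[a](subrK 1) scalerDl scale1r; exact: PD.
have cc : c * c^-1 = 1 by rewrite divff ?gt_eqF.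
pose T0 := c^-1%:C *: T; have T1 : bnd T0 1.
  by have := bndZR c^-1 Tc; rewrite ger0_norm ?invr_ge0 ?(ltW c0)// mulrC cc.
have TE : T = c%:C *: T0 by rewrite scalerA -realCM cc scale1r.
have X0E : adjop T0 * T0 = (c^-1 * c^-1)%:C *: (adjop T * T).
  by rewrite adjopZ conjc_real scaleopM realCM.
have pow n : exists2 Z, P Z & (1 - adjop T0 * T0) ^+ n.+1 = 1 - Z.
  elim: n => [|n [Z Zp ZE]].
    by exists (adjop T0 * T0); rewrite ?expr1// X0E; exact: PZ.
  exists ((-1) *: (adjop T0 * T0 * Z) + (1 *: Z + adjop T0 * T0)).
    apply: (PD); last by apply: (PD) => //; rewrite X0E; exact: PZ.
    by rewrite X0E -scaleopAl; apply: PZ; exact: PM.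
  rewrite exprS ZE mulrBl mul1r mulrBr mulr1 scale1r scaleN1r.
  by rewrite !opprD !opprK [RHS](AC (1*(1*2)) (1*3*(4*2))).
have [n ne] := vanishing_harmonic (exprn_ge0 2 (ltW c0)) (exprn_gt0 2 e0).
have [Z Zp ZE] := pow n; exists Z => //.
have -> : T - T * Z = c%:C *: (T0 * (1 - adjop T0 * T0) ^+ n.+1).
  by rewrite ZE mulrBr mulr1 scalerBr scaleopAl -TE.
apply: bndW (bndZR c (bnd_mul_exp_one_sub cs hH.2 n T1)).
rewrite ger0_norm ?(ltW c0)// -(ler_pXn2r (n := 2))// ?nnegrE ?(ltW e0)//.
  by rewrite exprMn sqr_sqrtr ?invr_ge0// ltW.
by rewrite mulr_ge0 ?sqrtr_ge0 ?(ltW c0).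
Qed.

Section LmulopClosed.
Context (R : realType) (B : cstarAlgType R).

Lemma lmulop_inj : injective (@lmulop R B).
Proof.
move=> b c bc; apply/eqP; rewrite -subr_eq0; apply/eqP/nrm_eq0.
apply/eqP; rewrite eq_le nrm_ge0 andbT nrm_le_lmulop// lmulopB bc subrr.
exact: bnd0.
Qed.

(** Left multiplication is isometric, so its range is closed; [P] is carried along to place the
    limit in the range ideal. *)
Lemma lmulop_closed (T : adjointable (selfmod B)) (P : B -> Prop) :
    (forall e : R, 0 < e -> exists2 b, P b & bnd (T - lmulop b) e) ->
  exists2 b, T = lmulop b & forall e : R, 0 < e -> exists2 c, P c & nrm (b - c) <= e.
Proof.
have cs := @self_cauchy_schwarz R B; move=> TP.
have e0 n : 0 < n.+1%:R^-1 :> R by rewrite invr_gt0.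
have /choice[f fP] : forall n, exists b, P b /\ bnd (T - lmulop b) (n.+1%:R^-1).
  by move=> n; have [b Pb Tb] := TP _ (e0 n); exists b.
have v2 := @vanishing_harmonic R 2 (ler0n _ _).
have diff m n : (n <= m)%N -> nrm (f m - f n) <= 2 / n.+1%:R.
  move=> nm; apply: nrm_le_lmulop; first by rewrite divr_ge0.
  rewrite lmulopB -(subrK T (lmulop (f m))) -addrA mulrDl mul1r.
  apply: (bndD cs); last exact: (fP n).2.
  apply: bndBC; apply: bndW (fP m).2.
  by rewrite lef_pV2 ?posrE ?ltr0n// ler_nat ltnS.
have [l lf] := nrm_complete v2 diff; exists l.
  apply/eqP; rewrite -subr_eq0; apply/eqP.
  apply: (bnd_vanishing cs v2 (c := 2)) => // n.
  rewrite -(subrK (lmulop (f n)) T) -addrA mulr_natr mulr2n.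
  apply: (bndD cs).
    by apply: bndW (fP n).2; rewrite ler_peMl ?invr_ge0// ler1n.
  rewrite -lmulopB; apply: bndW (lmulop_bnd _); rewrite nrmBC; exact: lf.
move=> e e1; have [n ne] := v2 _ e1; exists (f n); first exact: (fP n).1.
exact: le_trans (lf n) (ltW ne).
Qed.

End LmulopClosed.

(** * Range ideals *)

Section RangeIdealMap.
Context (R : realType) (B C : cstarAlgType R).
Context (E : hilbertModType B) (F : hilbertModType C).
Context (u : E -> F) (tu : ternary_homomorphism u).
Let hE := hilbert_hilbertian E.
Let hF := hilbert_hilbertian F.
Let csF := hilbertian_cs hF.
Let csE := hilbertian_cs hE.
Let tmu : ternary_map u := tu.
Let hB := @self_hilbertian R B.
Let hC := @self_hilbertian R C.

Definition inner_graph : set (adjointable (selfmod B) * adjointable (selfmod C)) :=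
  [set (lmulop (inner p.1 p.2), lmulop (inner (u p.1) (u p.2))) | p in [set: E * E]].

Definition inner_graph_of (S : adjointable (selfmod B)) (S' : adjointable (selfmod C)) :=
  lspan inner_graph (S, S').

Lemma inner_graph_mem x y :
  inner_graph_of (lmulop (inner x y)) (lmulop (inner (u x) (u y))).
Proof. by apply: sub_lspan; exists (x, y). Qed.

(** The clause on adjoints serves [inner_graphP], where c <ux, uy> = <(ux) c^*, uy> = <u(x b^* ),
    uy> turns a bound on b into one on the product. *)
Lemma inner_graphE S S' : inner_graph_of S S' -> exists b c,
  [/\ S = lmulop b, S' = lmulop c, lspan (@inner_values R B E) b,
    lspan (@inner_values R C F) c &
    forall x, u (ract x b) = ract (u x) c /\ u (ract x (cstar b)) = ract (u x) (cstar c)].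
Proof.
pose P (p : adjointable (selfmod B) * adjointable (selfmod C)) := exists b c,
  [/\ p.1 = lmulop b, p.2 = lmulop c, lspan (@inner_values R B E) b,
    lspan (@inner_values R C F) c &
    forall x, u (ract x b) = ract (u x) c /\ u (ract x (cstar b)) = ract (u x) (cstar c)].
move=> SS; apply: (lspan_ind _ _ _ SS (P := P)).
- exists 0, 0; split=> [|||| x]; try exact: lspan0.
  + by rewrite -(scale0r (0 : B)) lmulopZ scale0r.
  + by rewrite -(scale0r (0 : C)) lmulopZ scale0r.
  have s0 (A : cstarAlgType R) : cstar (0 : A) = 0.
    by rewrite -(scale0r (0 : A)) cstarZ conjc0 !scale0r.
  have r0 (A : cstarAlgType R) (V : hilbertModType A) (z : V) : ract z (0 : A) = 0.
    by rewrite -(scale0r (0 : A)) ractZr scale0r.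
  by rewrite !s0 !r0 (ternary0 tmu).
- move=> [S1 S1'] [S2 S2'] [b [c [/= -> -> bE cF bc]]] [b' [c' [/= -> -> bE' cF' bc']]].
  exists (b + b'), (c + c'); split=> [|||| x]; rewrite ?lmulopD//; try exact: lspanD.
  rewrite !cstarD !ractDr !(ternaryD tmu).
  by have [-> ->] := bc x; have [-> ->] := bc' x.
move=> a _ [[y z] _ <-]; exists (a *: inner y z), (a *: inner (u y) (u z)).
split=> [|||| x] /=; rewrite ?lmulopZ//; try (apply/lspanZ/sub_lspan).
- by exists (y, z).
- by exists (u y, u z).
- rewrite !cstarZ !ractZr !(ternaryZ tmu) !inner_star.
  by rewrite !tu.2.
Qed.

Lemma inner_graphP : op_graph inner_graph_of.
Proof.
apply: op_graph_lspan; [exact: self_hilbertian|exact: self_hilbertian| | | | ].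
- move=> S S' [[x y] _ [<- <-]]; rewrite !adjop_lmulop !inner_star.
  exact: inner_graph_mem.
- move=> S S' T T' [[x y] _ [<- <-]] [[z w] _ [<- <-]] /=.
  rewrite -!lmulopM -!inner_ract -tu.2; exact: inner_graph_mem.
- move=> S S' [[x y] _ [<- <-]].
  by split; apply: bounded_op_bnd; exact: lmulop_bnd.
- move=> S S' [[x y] _ [_ <-]] /=; exists (hnrm x * hnrm y).
    by rewrite mulr_ge0 ?hnrm_ge0.
  move=> T T' d d0 TT; have [b [c [-> -> _ _ bc]]] := inner_graphE TT.
  move=> /(nrm_le_lmulop d0) bd; rewrite -lmulopM; apply: bndW (lmulop_bnd _).
  rewrite -[c]cstarK -inner_ractl -(bc x).2 (le_trans (csF _ _))// mulrA.
  apply: ler_pM; rewrite ?hnrm_ge0 ?(ternary_contractive hE hF tmu)//.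
  apply: le_trans (ternary_contractive hE hF tmu _) _.
  apply: le_trans (hnrm_ract _ _) _; rewrite nrm_star mulrC.
  by rewrite ler_wpM2r ?hnrm_ge0.
Qed.

Definition range_rel (b : B) (c : C) :=
  graph_closure inner_graph_of (lmulop b) (lmulop c).

Lemma range_rel_functional b c d : range_rel b c -> range_rel b d -> c = d.
Proof.
move=> bc bd; apply: lmulop_inj.
exact: (graph_closure_functional hB hC inner_graphP bc bd).
Qed.

Lemma range_rel_total (b : range_ideal E) :
  exists c : range_ideal F, range_rel (val b) (val c).
Proof.
have [|T' TT'] := graph_closure_total hB hC inner_graphP (T := lmulop (val b)).
  move=> e e0; have /range_idealP/(_ _ e0)[c cE bc] := valP b.
  suff [S' SS'] : exists S', inner_graph_of (lmulop c) S'.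
    exists (lmulop c), S'; split; first exact: graph_closure_sub.
    by rewrite -lmulopB; apply: bndW bc _; exact: lmulop_bnd.
  apply: (@lspan_ind _ _ _ (fun c => exists S', inner_graph_of (lmulop c) S') _ _ _ _ cE)
    => [|y z [S yS] [T zT]|a _ [[y z] _ <-]].
  - exists 0; rewrite -(scale0r (0 : B)) lmulopZ scale0r.
    exact: op_graph0 inner_graphP.
  - by exists (S + T); rewrite lmulopD; exact: op_graphD inner_graphP _ _ _ _ yS zT.
  - exists (a *: lmulop (inner (u y) (u z))); rewrite lmulopZ.
    by apply: (op_graphZ inner_graphP); exact: inner_graph_mem.
have [|c cE cF] := @lmulop_closed _ _ T' (lspan (@inner_values R C F)).
  move=> e e0; have [S [S' [SS _ Se]]] := TT' _ e0.
  have [_ [c [_ cE _ cF _]]] := inner_graphE SS.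
  by exists c => //; rewrite -cE.
have cP : c \in range_ideal_pred F by apply/range_idealP.
by exists (RangeIdeal cP); rewrite /range_rel -cE.
Qed.

Definition range_map (b : range_ideal E) : range_ideal F :=
  projT1 (cid (range_rel_total b)).

Lemma range_mapP b : range_rel (val b) (val (range_map b)).
Proof. exact: (projT2 (cid (range_rel_total b))). Qed.

Lemma range_map_unique b c : range_rel (val b) (val c) -> range_map b = c.
Proof. by move=> bc; apply: val_inj; apply: range_rel_functional (range_mapP b) bc. Qed.

Lemma range_map_linear (a : R[i]) b c :
  range_map (a *: b + c) = a *: range_map b + range_map c.
Proof.
apply: range_map_unique; rewrite /range_rel /= !lmulopD !lmulopZ.
apply: (graph_closureD hB hC inner_graphP) (range_mapP c).
exact: (graph_closureZ inner_graphP) (range_mapP b).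
Qed.

Lemma range_relM b c b' c' : range_rel b b' -> range_rel c c' ->
  range_rel (cmul b c) (cmul b' c').
Proof.
move=> bb cc; rewrite /range_rel !lmulopM.
exact: (graph_closureM hB hC inner_graphP bb cc).
Qed.

Lemma range_relD b c b' c' : range_rel b b' -> range_rel c c' ->
  range_rel (b + c) (b' + c').
Proof.
move=> bb cc; rewrite /range_rel !lmulopD.
exact: (graph_closureD hB hC inner_graphP bb cc).
Qed.

Lemma range_rel_inner x y : range_rel (inner x y) (inner (u x) (u y)).
Proof. exact/graph_closure_sub/inner_graph_mem. Qed.

Lemma range_map_inner x y : range_map (innerI x y) = innerI (u x) (u y).
Proof. exact/range_map_unique/range_rel_inner. Qed.

Lemma range_rel_cstar b c : range_rel b c -> range_rel (cstar b) (cstar c).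
Proof.
by move=> bc; rewrite /range_rel -!adjop_lmulop; exact: (graph_closure_adjop hB hC inner_graphP bc).
Qed.

Lemma range_map_cstar b : range_map (range_ideal_cstar b) = range_ideal_cstar (range_map b).
Proof. exact/range_map_unique/range_rel_cstar/range_mapP. Qed.

Lemma range_map_ract b (c : range_ideal E) :
  range_map (range_ideal_ract b (val c)) = range_ideal_ract (range_map b) (val (range_map c)).
Proof. by apply: range_map_unique; apply: range_relM; exact: range_mapP. Qed.

Lemma range_rel_contractive b c : range_rel b c -> nrm c <= nrm b.
Proof.
move=> bc; apply: nrm_le_lmulop; first exact: nrm_ge0.
exact: (graph_closure_contractive hB hC inner_graphP bc (nrm_ge0 _) (lmulop_bnd b)).
Qed.

Lemma range_rel_ract x b c : range_rel b c -> u (ract x b) = ract (u x) c.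
Proof.
move=> bc; apply/eqP; rewrite -subr_eq0; apply/eqP/(hnrm_eq0 csF).
apply/eqP; rewrite eq_le hnrm_ge0 andbT; apply/ler_addgt0Pr => e e0; rewrite add0r.
pose k := hnrm x + hnrm x + 1; have k0 : 0 < k by rewrite ltr_wpDl ?addr_ge0 ?hnrm_ge0.
have ek0 : 0 < e / k by rewrite divr_gt0.
have [_ [_ [/inner_graphE[s [t [-> -> _ _ st]]] Se Te]]] := bc _ ek0.
have be : nrm (b - s) <= e / k by apply: nrm_le_lmulop; rewrite ?(ltW ek0)// lmulopB.
have ce : nrm (t - c) <= e / k.
  by apply: nrm_le_lmulop; rewrite ?(ltW ek0)// lmulopB; exact: bndBC.
have ractB (A : cstarAlgType R) (V : hilbertModType A) (z : V) (p q : A) :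
    ract z (p - q) = ract z p - ract z q.
  by rewrite ractDr -[- q]scaleN1r ractZr scaleN1r.
have -> : u (ract x b) - ract (u x) c = u (ract x (b - s)) + ract (u x) (t - c).
  by rewrite !ractB (ternaryB tmu) (st x).1 addrA subrK.
apply: le_trans (hnrmD csF _ _) _.
apply: (@le_trans _ _ (hnrm x * (e / k) + hnrm x * (e / k))).
  apply: lerD.
    apply: le_trans (ternary_contractive hE hF tmu _) _.
    by apply: le_trans (hnrm_ract _ _) _; rewrite ler_wpM2l ?hnrm_ge0.
  apply: le_trans (hnrm_ract _ _) _; apply: ler_pM; rewrite ?hnrm_ge0 ?nrm_ge0//.
  exact: ternary_contractive.
by rewrite -mulrDl mulrCA ler_piMr ?(ltW e0)// ler_pdivrMr// mul1r lerDl.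
Qed.

Lemma range_map_mod x (b : range_ideal E) :
  u (ract x (val b)) = ract (u x) (val (range_map b)).
Proof. exact/range_rel_ract/range_mapP. Qed.

Definition linking_map (p : (range_ideal E * E)%type) : (range_ideal F * F)%type :=
  (range_map p.1, u p.2).

Lemma linking_inner_rel (p q : (range_ideal E * E)%type) :
  range_rel (inner p q) (inner (linking_map p) (linking_map q)).
Proof.
rewrite !dsum_innerE; apply: range_relD; last exact: range_rel_inner.
apply: range_relM; last exact: range_mapP.
by apply: range_rel_cstar; exact: range_mapP.
Qed.

Lemma linking_map_ternary : ternary_map linking_map.
Proof.
split=> [a p q|p q r]; congr pair; rewrite /= ?range_map_linear ?tu.1//.
  by apply: range_map_unique; apply: range_relM (linking_inner_rel _ _); exact: range_mapP.
by apply: range_rel_ract; exact: linking_inner_rel.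
Qed.

End RangeIdealMap.

Section LinkingHilbertian.
Context (R : realType) (B : cstarAlgType R) (E : hilbertModType B).

Lemma linking_hilbertian : hilbertian (range_ideal E * E)%type.
Proof.
by apply: dsum_hilbertian; [exact: range_ideal_hilbertian|exact: hilbert_hilbertian].
Qed.

(** <x, y> b = <x, y b> = 0, and b^* is a limit of combinations of such <x, y>, so b^* b = 0. *)
Lemma range_ideal_annihilated (b : B) : b \in range_ideal_pred E ->
  (forall x : E, ract x b = 0) -> b = 0.
Proof.
move=> bE xb; apply: nrm_eq0; apply/eqP; rewrite eq_le nrm_ge0 andbT.
apply/ler_addgt0Pr => e e0; rewrite add0r.
have /range_idealP/(_ _ e0)[c cE bc] := range_ideal_star bE.
have cb : cmul c b = 0.
  apply: (lspan_ind _ _ _ cE (P := fun c => cmul c b = 0)).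
  - exact: cmul0l.
  - by move=> x y xb0 yb0; rewrite cmulDl xb0 yb0 addr0.
  by move=> a _ [[x y] _ <-]; rewrite cmulZl -inner_ract xb inner0r scaler0.
have [->|b0] := eqVneq (nrm b) 0; first exact: ltW.
have b_gt0 : 0 < nrm b by rewrite lt_def b0 nrm_ge0.
rewrite -(ler_pM2r b_gt0) -expr2 -nrm_cstar -[cmul _ _](subr0) -cb -cmulBl.
by rewrite (le_trans (nrmM _ _))// ler_wpM2r ?nrm_ge0.
Qed.

(** With T the square root of <x, x>, the inner squares of x - x b and T - T b coincide, so
    [op_approx] for T applies; its polynomials in T^2 = <x, x> lie in the range ideal. *)
Lemma approx_unit (x : E) (e : R) : 0 < e ->
  exists b : range_ideal E, hnrm (x - ract x (val b)) <= e.
Proof.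
move=> e0; have hB := @self_hilbertian R B; have cs := hilbertian_cs hB.
set a : B := inner x x.
have ap : posop (lmulop a) by exact: (hilbert_hilbertian E).1.
have [T [Tp TE _]] := posop_sqrt cs hB.2 ap.
pose P (Z : adjointable (selfmod B)) := exists b : range_ideal E, Z = lmulop (val b).
have [||||Z [b ->] Tb] := op_approx hB (T := T) (P := P) _ _ _ _ e0.
- exact: posop_bounded.
- by exists (innerI x x); rewrite (posop_adjop Tp) TE.
- move=> s Y Z [b ->] [c ->]; exists (s *: b + c).
  by rewrite /= lmulopD lmulopZ.
- move=> Z [b ->]; exists (range_ideal_ract (innerI x x) (val b)).
  by rewrite (posop_adjop Tp) TE -lmulopM.
exists b; rewrite -(ler_pXn2r (n := 2))// ?nnegrE ?hnrm_ge0 ?(ltW e0)// hnrm_sqr.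
apply: nrm_le_lmulop; first by rewrite exprn_ge0// ltW.
have -> : lmulop (inner (x - ract x (val b)) (x - ract x (val b)) : B) =
    adjop (T - T * lmulop (val b)) * (T - T * lmulop (val b)).
  rewrite innerBl !innerBr !inner_ractl !inner_ract -/a.
  rewrite adjopB adjopM adjop_lmulop (posop_adjop Tp) mulrBl !mulrBr.
  by rewrite !lmulopB !lmulopM !mulrA -(mulrA _ T T) TE.
by rewrite expr2; apply: bndM; rewrite ?(ltW e0)//; apply: bnd_adjop; rewrite ?(ltW e0).
Qed.

(** The polynomials of [op_approx] in b^* b all have the form c b. Having b on both sides of c is
    what [linking_kernel_approximable] uses. *)
Lemma range_approx_unit (b : range_ideal E) (e : R) : 0 < e ->
  exists c : range_ideal E, nrm (val b - cmul (val b) (cmul (val c) (val b))) <= e.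
Proof.
move=> e0; have hB := @self_hilbertian R B; have cs := hilbertian_cs hB.
pose P (Z : adjointable (selfmod B)) :=
  exists c : range_ideal E, Z = lmulop (cmul (val c) (val b)).
have [||||Z [c ->] Tc] := op_approx hB (T := lmulop (val b)) (P := P) _ _ _ _ e0.
- exact: bounded_op_bnd (lmulop_bnd _).
- by exists (range_ideal_cstar b); rewrite adjop_lmulop lmulopM.
- move=> s Y Z [c ->] [d ->]; exists (s *: c + d).
  by rewrite -lmulopZ -lmulopD /= cmulDl cmulZl.
- move=> Z [c ->].
  exists (range_ideal_ract (range_ideal_cstar b) (cmul (val b) (val c))).
  by rewrite adjop_lmulop -!lmulopM /= !cmulA.
exists c; apply: nrm_le_lmulop; first exact: ltW.
by rewrite lmulopB lmulopM.
Qed.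

End LinkingHilbertian.

(** * Preimages of compact operators *)

Section RangeClosure.
Context (R : realType) (B C : cstarAlgType R) (H : innerModType B).
Context (K : innerModType C) (hH : hilbertian H) (hK : hilbertian K).
Let csH := hilbertian_cs hH.
Let csK := hilbertian_cs hK.

Section Graph.
Context (Gr : adjointable H -> adjointable K -> Prop) (GrP : op_graph Gr).
Local Notation rc := (range_closure Gr).

Lemma range_closure0 : rc 0.
Proof.
move=> e e0; exists 0, 0; split; first exact/graph_closure_sub/(op_graph0 GrP).
by rewrite subrr; apply: bnd0; exact: ltW.
Qed.

Lemma range_closureD S' T' : rc S' -> rc T' -> rc (S' + T').
Proof.
move=> rS rT e e0; have e20 : 0 < e / 2 by rewrite divr_gt0.
have [S1 [S1' [SS Se]]] := rS _ e20; have [T1 [T1' [TT Te]]] := rT _ e20.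
exists (S1 + T1), (S1' + T1'); split; first exact: graph_closureD.
by rewrite opprD addrACA [e]splitr; exact: bndD.
Qed.

Lemma range_closureZ (a : R[i]) T' : rc T' -> rc (a *: T').
Proof.
move=> rT e e0; have a1 : 0 < modc a + 1 by rewrite ltr_wpDl ?modc_ge0.
have [S [S' [SS Se]]] := rT _ (divr_gt0 e0 a1).
exists (a *: S), (a *: S'); split; first exact: graph_closureZ.
rewrite -scalerBr; apply: bndW (bndZ a Se).
by rewrite mulrCA ler_piMr ?(ltW e0)// ler_pdivrMr// mul1r lerDl.
Qed.

Lemma range_closure_limit T' :
  (forall e : R, 0 < e -> exists2 S', rc S' & bnd (T' - S') e) -> rc T'.
Proof.
move=> rT e e0; have e20 : 0 < e / 2 by rewrite divr_gt0.
have [S' rS Se] := rT _ e20; have [S1 [S1' [SS S1e]]] := rS _ e20.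
exists S1, S1'; split=> //.
by rewrite -(subrK S' T') -addrA [e]splitr; exact: bndD.
Qed.

Lemma range_closure_lspan (X : set (adjointable K)) :
  (forall S', X S' -> rc S') -> forall S', lspan X S' -> rc S'.
Proof.
move=> Xr; apply: lspan_ind; [exact: range_closure0|exact: range_closureD|].
by move=> a S' XS; apply: range_closureZ; exact: Xr.
Qed.

End Graph.

Lemma bnd_rank1_sub (p q r s : K) :
  bnd (rank1 p q - rank1 r s) (hnrm (p - r) * hnrm q + hnrm r * hnrm (q - s)).
Proof.
have -> : rank1 p q - rank1 r s = rank1 (p - r) q + rank1 r (q - s).
  apply: adj_inj => z; rewrite !addopE oppopE !rank1E innerBl.
  rewrite ractDr ractDl -[- r]scaleN1r ractZl scaleN1r.
  by rewrite -[- inner s z]scaleN1r ractZr scaleN1r addrA subrK.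
by apply: (bndD csK); exact: bnd_rank1.
Qed.

Context (U : H -> K) (tU : ternary_map U).

Definition approximable (p : K) : Prop :=
  forall e : R, 0 < e -> exists x, hnrm (p - U x) <= e.

Lemma range_closure_rank1 p q : approximable p -> approximable q ->
  range_closure (op_graph_of U) (rank1 p q).
Proof.
move=> pU qU e e0.
have d1 : 0 < e / 2 / (hnrm q + 1) by rewrite !divr_gt0 ?ltr_wpDl ?hnrm_ge0.
have [x px] := pU _ d1.
have d2 : 0 < e / 2 / (hnrm (U x) + 1) by rewrite !divr_gt0 ?ltr_wpDl ?hnrm_ge0.
have [y qy] := qU _ d2.
exists (rank1 x y), (rank1 (U x) (U y)); split.
  exact/graph_closure_sub/op_graph_rank1.
have half (c d : R) : 0 <= c -> d <= e / 2 / (c + 1) -> d * c <= e / 2.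
  move=> c0 dc; have c1 : 0 < c + 1 by rewrite ltr_wpDl.
  apply: le_trans (ler_wpM2r c0 dc) _; rewrite mulrAC ler_pdivrMr//.
  by rewrite ler_wpM2l ?divr_ge0 ?(ltW e0)// lerDl.
apply: bndW (bnd_rank1_sub p q (U x) (U y)); rewrite [e]splitr; apply: lerD.
  by apply: half => //; exact: hnrm_ge0.
by rewrite mulrC; apply: half => //; exact: hnrm_ge0.
Qed.

(** Approximating vectors by values of U places T' in the closure of the range;
    [range_closure_closed] then gives an exact preimage. *)
Lemma compact_rel_surjective (D : set K) (T' : adjointable K) :
    (forall p, D p -> approximable p) ->
    (forall e : R, 0 < e -> exists2 S', lspan [set rank1 p.1 p.2 | p in D `*` D] S' &
      bnd (T' - S') e) ->
  exists T, compact_rel U T T'.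
Proof.
move=> DU T'D; have GrP := op_graph_ofP hH hK tU.
have rS S' : lspan [set rank1 p.1 p.2 | p in D `*` D] S' -> range_closure (op_graph_of U) S'.
  apply: (range_closure_lspan GrP) => _ [[p q] [/= Dp Dq] <-].
  by apply: range_closure_rank1; exact: DU.
apply: (range_closure_closed hH hK GrP).
  have [S' S'D S1] := T'D _ ltr01.
  have [_ [S2 [/(graph_closure_bounded hH hK GrP)[_ S2b] S12]]] := rS _ S'D _ ltr01.
  rewrite -(subrK S' T') -(subrK S2 S'); apply: (bounded_opD csK).
    by rewrite subrK; exact: bounded_op_bnd S1.
  by apply: (bounded_opD csK) => //; exact: bounded_op_bnd S12.
apply: range_closure_limit => e e0; have [S' S'D Se] := T'D _ e0.
by exists S' => //; exact: rS.
Qed.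

End RangeClosure.

(** * Linking algebras *)

Section Entries.
Context (R : realType) (B : cstarAlgType R) (E : hilbertModType B).
Local Notation BE := (range_ideal E * E)%type.
Local Notation "<< b , x >>" := ((b, x) : BE) (at level 0).

Lemma entry11E (b : range_ideal E) p :
  entry11 b p = (range_ideal_ract b (val p.1), 0).
Proof. by []. Qed.

Lemma entry12E (x : E) p : entry12 x p = (innerI x p.2, 0).
Proof. by []. Qed.

Lemma entry21E (x : E) p : entry21 x p = (0, ract x (val p.1)).
Proof. by []. Qed.

Lemma entry22E (k : adjointable E) p : entry22 k p = (0, k p.2).
Proof. by []. Qed.

Lemma adjop_entry21 (x : E) : adjop (entry21 x) = entry12 x.
Proof. by apply: adjop_unique; exact/is_adjoint_sym/entry12_adjoint. Qed.

Lemma ract0r (H : innerModType B) (x : H) : ract x (0 : B) = 0.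
Proof. by rewrite -(scale0r (0 : B)) ractZr scale0r. Qed.

Lemma dsum_ractE (H1 H2 : innerModType B) (p : (H1 * H2)%type) (b : B) :
  ract p b = (ract p.1 b, ract p.2 b).
Proof. by []. Qed.

Lemma range_innerE (b c : range_ideal E) : inner b c = cmul (cstar (val b)) (val c).
Proof. by []. Qed.

(** [entry21 x] itself need not be of rank one, as the range ideal may lack a unit; [approx_unit]
    makes it a limit of these operators. *)
Lemma entry21_rank1 (x : E) (c : range_ideal E) :
  entry21 (ract x (val c)) = rank1 <<0, x>> <<range_ideal_cstar c, 0>>.
Proof.
apply: adj_inj => p; rewrite entry21E rank1E dsum_innerE /= inner0l addr0.
by rewrite dsum_ractE /= ract0l range_innerE /= cstarK -ractM.
Qed.

Lemma entry11_rank1 (b c : range_ideal E) :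
  entry11 (range_ideal_ract b (val c)) = rank1 <<b, 0>> <<range_ideal_cstar c, 0>>.
Proof.
apply: adj_inj => p; rewrite entry11E rank1E dsum_innerE /= inner0l addr0.
rewrite dsum_ractE /= ract0l range_innerE /= cstarK; congr pair.
by apply: val_inj; rewrite /= cmulA.
Qed.

Lemma entry22_rank1 (x y : E) : entry22 (rank1 x y) = rank1 <<0, x>> <<0, y>>.
Proof.
apply: adj_inj => p; rewrite entry22E [RHS]rank1E dsum_innerE /= inner0l add0r.
by rewrite dsum_ractE /= ract0l.
Qed.

Lemma entry22_linear (a : R[i]) (k l : adjointable E) :
  entry22 (a *: k + l) = a *: entry22 k + entry22 l.
Proof.
apply: adj_inj => p; rewrite addopE scaleopE !entry22E; congr pair.
by rewrite /= scaler0 addr0.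
Qed.

Lemma entry22B (k l : adjointable E) : entry22 (k - l) = entry22 k - entry22 l.
Proof.
by have := entry22_linear (-1) l k; rewrite !scaleN1r addrC => ->; rewrite addrC.
Qed.

Lemma entry21_linear (a : R[i]) (x y : E) :
  entry21 (a *: x + y) = a *: entry21 x + entry21 y.
Proof.
apply: adj_inj => p; rewrite addopE scaleopE !entry21E; congr pair.
  by rewrite /= scaler0 addr0.
by rewrite ractDl ractZl.
Qed.

Lemma entry21B (x y : E) : entry21 (x - y) = entry21 x - entry21 y.
Proof.
by have := entry21_linear (-1) y x; rewrite !scaleN1r addrC => ->; rewrite addrC.
Qed.

Lemma entry11B (b c : range_ideal E) : entry11 (b - c) = entry11 b - entry11 c.
Proof.
apply: adj_inj => p; rewrite subopE !entry11E; congr pair.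
  by apply: val_inj; rewrite /= cmulBl.
by rewrite /= subr0.
Qed.

Lemma entry21_inj : injective (@entry21 R B E).
Proof.
move=> x y xy; apply/eqP; rewrite -subr_eq0; apply/eqP; set z := x - y.
have D0 : entry21 z = 0 by rewrite entry21B xy subrr.
have z0 (b : range_ideal E) : ract z (val b) = 0.
  exact: (congr1 (fun T : adjointable BE => (T <<b, 0>>).2) D0).
have := z0 (innerI z z); rewrite /= => zz.
have : hnrm (z : E) ^+ 2 ^+ 2 = 0.
  rewrite hnrm_sqr -nrm_cstar inner_star -inner_ract zz.
  by rewrite inner0r nrm0.
move/eqP; rewrite !expf_eq0 /= => /eqP.
exact/hnrm_eq0/hilbertian_cs/hilbert_hilbertian.
Qed.

Lemma bnd_entry11 (b : range_ideal E) : bnd (entry11 b) (nrm (val b)).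
Proof.
move=> p; rewrite entry11E hnrm_inl hnrm_range_ideal /=.
apply: le_trans (nrmM _ _) _; rewrite ler_wpM2l ?nrm_ge0// -hnrm_range_ideal.
by apply: hnrm_fst; [exact: range_ideal_hilbertian|exact: hilbert_hilbertian].
Qed.

Lemma bnd_entry21 (x : E) : bnd (entry21 x) (hnrm x).
Proof.
move=> p; rewrite entry21E hnrm_inr; apply: le_trans (hnrm_ract _ _) _.
rewrite ler_wpM2l ?hnrm_ge0// -hnrm_range_ideal.
by apply: hnrm_fst; [exact: range_ideal_hilbertian|exact: hilbert_hilbertian].
Qed.

Lemma bnd_entry22 (k : adjointable E) (c : R) : 0 <= c -> bnd k c -> bnd (entry22 k) c.
Proof.
move=> c0 kc p; rewrite entry22E hnrm_inr; apply: le_trans (kc _) _.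
rewrite ler_wpM2l//.
by apply: hnrm_snd; [exact: range_ideal_hilbertian|exact: hilbert_hilbertian].
Qed.

Lemma entry21_mul_entry11 (x : E) (b : range_ideal E) :
  entry21 x * entry11 b = entry21 (ract x (val b)).
Proof. by apply: adj_inj => p; rewrite mulopE entry11E !entry21E /= ractM. Qed.

Lemma entry12_mul_entry11 (x : E) (b : range_ideal E) : entry12 x * entry11 b = 0.
Proof.
apply: adj_inj => p; rewrite mulopE entry11E entry12E; congr pair.
by apply: val_inj; rewrite /= inner0r.
Qed.

Lemma entry21_mul_entry22 (x : E) (k : adjointable E) : entry21 x * entry22 k = 0.
Proof.
by apply: adj_inj => p; rewrite mulopE entry22E entry21E; congr pair; exact: ract0r.
Qed.

Lemma entry12_mul_entry22 (x : E) (k : adjointable E) :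
  entry12 x * entry22 k = entry12 (adjop k x).
Proof.
apply: adj_inj => p; rewrite mulopE entry22E !entry12E; congr pair.
by apply: val_inj; rewrite /= inner_adjr.
Qed.

(** The products read off x (D p).1 and <x, (D p).2>; the first are enough for the range ideal by
    [range_ideal_annihilated]. *)
Lemma entries_separate (D : adjointable BE) :
  (forall x, entry21 x * D = 0) -> (forall x, entry12 x * D = 0) -> D = 0.
Proof.
move=> D21 D12; apply: adj_inj => p; rewrite zeroopE [D p]surjective_pairing.
congr pair.
  apply: val_inj; apply: (@range_ideal_annihilated _ _ E); first exact: valP.
  by move=> x; exact: (congr1 (fun T : adjointable BE => (T p).2) (D21 x)).
apply: (@inner_inj _ B) => x; rewrite inner0r.
exact: (congr1 (fun T : adjointable BE => val (T p).1) (D12 x)).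
Qed.

End Entries.

(** * The homomorphism induced by a ternary homomorphism *)

Section LinkingRelation.
Context (R : realType) (B C : cstarAlgType R).
Context (E : hilbertModType B) (F : hilbertModType C).
Context (u : E -> F) (tu : ternary_homomorphism u).
Local Notation BE := (range_ideal E * E)%type.
Local Notation CF := (range_ideal F * F)%type.
Let hE := hilbert_hilbertian E.
Let hF := hilbert_hilbertian F.
Let hBE := linking_hilbertian E.
Let hCF := linking_hilbertian F.
Let tmu : ternary_map u := tu.
Let tU := linking_map_ternary tu.

Definition linking_rel := compact_rel (linking_map tu).

Let relP : op_graph (op_graph_of (linking_map tu)) := op_graph_ofP hBE hCF tU.

Lemma range_map0 : range_map tu 0 = 0.
Proof. by have [] := ternary0 tU. Qed.

Lemma linking_rel_rank1 (p q : BE) :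
  linking_rel (rank1 p q) (rank1 (linking_map tu p) (linking_map tu q)).
Proof. exact/graph_closure_sub/op_graph_rank1. Qed.

Lemma linking_rel_entry21 x : linking_rel (entry21 x) (entry21 (u x)).
Proof.
apply: (graph_closure_closed hBE hCF) => e e0; have [b xb] := approx_unit x e0.
exists (entry21 (ract x (val b))), (entry21 (u (ract x (val b)))); split.
- rewrite range_map_mod !entry21_rank1.
  have := linking_rel_rank1 (0, x) (range_ideal_cstar b, 0).
  by rewrite /linking_map /= range_map0 range_map_cstar (ternary0 tmu).
- by rewrite -entry21B; apply: bndW (bnd_entry21 _).
rewrite -entry21B -(ternaryB tmu); apply: bndW (bnd_entry21 _).
exact: le_trans (ternary_contractive hE hF tmu _) xb.
Qed.

Lemma linking_rel_entry12 x : linking_rel (entry12 x) (entry12 (u x)).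
Proof.
rewrite -!adjop_entry21; apply: (graph_closure_adjop hBE hCF relP).
exact: linking_rel_entry21.
Qed.

Lemma linking_rel_entry11 b : linking_rel (entry11 b) (entry11 (range_map tu b)).
Proof.
apply: (graph_closure_closed hBE hCF) => e e0; have [c bc] := range_approx_unit b e0.
pose d := range_ideal_ract b (val (range_ideal_ract c (val b))).
exists (entry11 d), (entry11 (range_map tu d)); split.
- rewrite /d range_map_ract !entry11_rank1.
  have := linking_rel_rank1 (b, 0) (range_ideal_cstar (range_ideal_ract c (val b)), 0).
  by rewrite /linking_map /= range_map_cstar (ternary0 tmu).
- by rewrite -entry11B; apply: bndW (bnd_entry11 _).
rewrite -entry11B; apply: bndW (bnd_entry11 _).
apply: le_trans bc; have -> : range_map tu b - range_map tu d = range_map tu (b - d).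
  by have := range_map_linear tu (-1) d b; rewrite !scaleN1r addrC => ->; rewrite addrC.
apply: le_trans (range_rel_contractive tu (range_mapP tu _)) _.
by rewrite /d.
Qed.

Lemma linking_rel_entry22 (k : adjointable E) l :
  compact_rel u k l -> linking_rel (entry22 k) (entry22 l).
Proof.
move=> kl e e0; have [S [S' [SS Se Se']]] := kl _ e0.
exists (entry22 S), (entry22 S'); split.
- pose f (p : adjointable E * adjointable F) := (entry22 p.1, entry22 p.2).
  apply: (lspan_image _ _ SS (f := f)) => [a p q|_ [[x y] _ <-]].
    by rewrite /f !entry22_linear.
  rewrite /f /= !entry22_rank1; apply: sub_lspan; exists ((0, x), (0, y)) => //=.
  by rewrite /linking_map /= range_map0.
- by rewrite -entry22B; apply: bnd_entry22 => //; exact: ltW.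
- by rewrite -entry22B; apply: bnd_entry22 => //; exact: ltW.
Qed.

Lemma linking_rel_total T : linking_algebra E T -> exists T', linking_rel T T'.
Proof. exact: compact_rel_total. Qed.

Lemma linking_rel_fst T T' : linking_rel T T' -> linking_algebra E T.
Proof. exact: compact_rel_fst. Qed.

Lemma linking_rel_snd T T' : linking_rel T T' -> linking_algebra F T'.
Proof. exact: compact_rel_snd. Qed.

Lemma linking_rel_functional T T1 T2 : linking_rel T T1 -> linking_rel T T2 -> T1 = T2.
Proof. by move=> h1 h2; exact: (graph_closure_functional hBE hCF relP h1 h2). Qed.

Lemma linking_relZD (a : R[i]) S S' T T' : linking_rel S S' -> linking_rel T T' ->
  linking_rel (a *: S + T) (a *: S' + T').
Proof.
by move=> SS TT; exact: (graph_closureD hBE hCF relP (graph_closureZ relP a SS) TT).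
Qed.

(* 0 outside the linking algebra *)
Definition linking_functor (T : adjointable BE) : adjointable CF :=
  if pselect (exists T', linking_rel T T') is left h then projT1 (cid h) else 0.

Lemma linking_functor_eq T T' : linking_rel T T' -> linking_functor T = T'.
Proof.
rewrite /linking_functor => TT; case: pselect => [h|[]]; last by exists T'.
exact: linking_rel_functional (projT2 (cid h)) TT.
Qed.

Lemma linking_functorP T : linking_algebra E T -> linking_rel T (linking_functor T).
Proof. by move=> /linking_rel_total[T' TT]; rewrite (linking_functor_eq TT). Qed.

Lemma linking_functor_hom :
  star_homomorphism (linking_algebra E) (linking_algebra F) linking_functor.
Proof.
split=> [T /linking_functorP/linking_rel_snd//|a S T LS LT|S T LS LT|T LT].
- by apply: linking_functor_eq; apply: linking_relZD; exact: linking_functorP.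
- apply: linking_functor_eq.
  exact: (graph_closureM hBE hCF relP (linking_functorP LS) (linking_functorP LT)).
apply: linking_functor_eq.
exact: (graph_closure_adjop hBE hCF relP (linking_functorP LT)).
Qed.

Lemma linking_functor_restricts21 : restricts21 linking_functor u.
Proof. by move=> x; apply: linking_functor_eq; exact: linking_rel_entry21. Qed.

Lemma linking_functor_blockwise : blockwise linking_functor.
Proof.
split.
- move=> _ [b _ <-]; exists (range_map tu b) => //.
  exact/esym/linking_functor_eq/linking_rel_entry11.
- move=> _ [x _ <-]; exists (u x) => //.
  exact/esym/linking_functor_eq/linking_rel_entry12.
- move=> _ [x _ <-]; exists (u x) => //.
  exact/esym/linking_functor_eq/linking_rel_entry21.
move=> _ [k kE <-]; have [l kl] := compact_rel_total hE hF tmu kE.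
exists l; first exact: compact_rel_snd kl.
exact/esym/linking_functor_eq/linking_rel_entry22.
Qed.

End LinkingRelation.

(** * Decomposition of the linking algebra into corners *)

Section Blocks.
Context (R : realType) (B : cstarAlgType R) (E : hilbertModType B).
Local Notation BE := (range_ideal E * E)%type.
Let hE := hilbert_hilbertian E.
Let hBE := linking_hilbertian E.
Let cs := hilbertian_cs hBE.

(** The linking algebra is the domain of the relation induced by the identity; closure under the
    operations and membership of the corners are read off from that relation. *)
Lemma ternary_homomorphism_id : ternary_homomorphism (@id E).
Proof. by []. Qed.

Lemma linking_entry11 b : linking_algebra E (entry11 b).
Proof. exact: linking_rel_fst (linking_rel_entry11 ternary_homomorphism_id b). Qed.

Lemma linking_entry12 x : linking_algebra E (entry12 x).
Proof. exact: linking_rel_fst (linking_rel_entry12 ternary_homomorphism_id x). Qed.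

Lemma linking_entry21 x : linking_algebra E (entry21 x).
Proof. exact: linking_rel_fst (linking_rel_entry21 ternary_homomorphism_id x). Qed.

Lemma linking_entry22 (k : adjointable E) : compact_ops k -> linking_algebra E (entry22 k).
Proof.
move=> kE; have [l kl] := compact_rel_total hE hE ternary_homomorphism_id kE.
exact: linking_rel_fst (linking_rel_entry22 ternary_homomorphism_id kl).
Qed.

Lemma linking_algebraZD (a : R[i]) (S T : adjointable BE) : linking_algebra E S ->
  linking_algebra E T -> linking_algebra E (a *: S + T).
Proof.
have tid := ternary_homomorphism_id.
move=> /(linking_rel_total tid)[S' SS] /(linking_rel_total tid)[T' TT].
exact: linking_rel_fst (linking_relZD a SS TT).
Qed.

Lemma linking_algebra0 : linking_algebra E 0.
Proof.
apply/compact_opsP => e e0; exists 0; first exact: lspan0.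
by rewrite subrr; apply: bnd0; exact: ltW.
Qed.

Lemma linking_algebraD (S T : adjointable BE) : linking_algebra E S ->
  linking_algebra E T -> linking_algebra E (S + T).
Proof. by move=> LS; rewrite -[S]scale1r; exact: linking_algebraZD. Qed.

Lemma linking_algebraB (S T : adjointable BE) : linking_algebra E S ->
  linking_algebra E T -> linking_algebra E (S - T).
Proof. by move=> LS LT; rewrite addrC -scaleN1r; exact: linking_algebraZD. Qed.

Lemma linking_algebraM (S T : adjointable BE) : linking_algebra E S ->
  linking_algebra E T -> linking_algebra E (S * T).
Proof.
have tid := ternary_homomorphism_id; have tU := linking_map_ternary tid.
move=> /(linking_rel_total tid)[S' SS] /(linking_rel_total tid)[T' TT].
apply: (linking_rel_fst (tu := tid) (T' := S' * T')).
exact: (graph_closureM hBE hBE (op_graph_ofP hBE hBE tU) SS TT).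
Qed.

Lemma linking_algebra_adjop (T : adjointable BE) :
  linking_algebra E T -> linking_algebra E (adjop T).
Proof.
have tid := ternary_homomorphism_id; have tU := linking_map_ternary tid.
move=> /(linking_rel_total tid)[T' TT]; apply: (linking_rel_fst (tu := tid) (T' := adjop T')).
exact: (graph_closure_adjop hBE hBE (op_graph_ofP hBE hBE tU) TT).
Qed.

Lemma linking_algebra_bounded (T : adjointable BE) : linking_algebra E T -> bounded_op T.
Proof.
have tid := ternary_homomorphism_id; have tU := linking_map_ternary tid.
move=> /(linking_rel_total tid)[T' TT].
by have [] := graph_closure_bounded hBE hBE (op_graph_ofP hBE hBE tU) TT.
Qed.

(** Tested on a = <p, p>, which lies in the range ideal: |p|^4 = |<p, p a>| <= |p| e |p|^2. *)
Lemma column_norm (p : BE) (e : R) : 0 <= e ->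
  (forall b : range_ideal E, hnrm (ract p (val b)) <= e * nrm (val b)) -> hnrm p <= e.
Proof.
move=> e0 pe; have [->|p0] := eqVneq (hnrm p) 0; first by [].
have pp : 0 < hnrm p by rewrite lt_def p0 hnrm_ge0.
pose a := range_ideal_ract (range_ideal_cstar p.1) (val p.1) + innerI p.2 p.2.
have aE : val a = inner p p by [].
have a2 : nrm (val a) = hnrm p ^+ 2 by rewrite hnrm_sqr aE.
have := cs p (ract p (val a)); rewrite inner_ract -aE.
have -> : nrm (cmul (val a) (val a)) = hnrm p ^+ 2 ^+ 2.
  by rewrite -a2 -nrm_cstar aE inner_star.
move=> h1; have := pe a; rewrite a2 => h2.
have h3 : hnrm p ^+ 2 ^+ 2 <= hnrm p * (e * hnrm p ^+ 2).
  by apply: le_trans h1 _; rewrite ler_wpM2l ?hnrm_ge0.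
have p3 : 0 < hnrm p ^+ 3 by rewrite exprn_gt0.
rewrite -(ler_pM2l p3); move: h3; clear.
by rewrite !exprS expr0; move: (hnrm p) => x; nra.
Qed.

(** p takes the place of T (1, 0) where there is no unit. The operator p q^* has column p q.1^*, and
    the columns of a convergent sequence converge by [column_norm]. *)
Lemma linking_column (T : adjointable BE) : linking_algebra E T ->
  exists p : BE, forall b : range_ideal E, T (b, 0) = ract p (val b).
Proof.
move=> /compact_opsP LT; pose d n : R := n.+1%:R^-1.
have d0 n : 0 < d n by rewrite invr_gt0.
have col (S : adjointable BE) : lspan [set rank1 p.1 p.2 | p in [set: BE * BE]] S ->
    exists p : BE, forall b : range_ideal E, S (b, 0) = ract p (val b).
  apply: (@lspan_ind _ _ _ (fun S : adjointable BE =>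
    exists p : BE, forall b : range_ideal E, S (b, 0) = ract p (val b)))
    => [|S1 S2 [p pE] [q qE]|a _ [[p q] _ <-]].
  - by exists 0 => b; rewrite zeroopE ract0l.
  - by exists (p + q) => b; rewrite addopE pE qE ractDl.
  exists (a *: ract p (cstar (val q.1))) => b.
  by rewrite scaleopE rank1E dsum_innerE /= inner0r addr0 range_innerE ractM ractZl.
have /choice[f fP] : forall n, exists Sp : adjointable BE * BE, bnd (T - Sp.1) (d n) /\
    forall b : range_ideal E, Sp.1 (b, 0) = ract Sp.2 (val b).
  move=> n; have [S /col[p pE] Se] := LT _ (d0 n).
  by exists (S, p).
have ve : vanishing (fun n => 2 / n.+1%:R : R) by exact: vanishing_harmonic.
have diff m n : (n <= m)%N -> hnrm ((f m).2 - (f n).2) <= 2 / n.+1%:R.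
  move=> nm; apply: column_norm => [|b]; first by rewrite divr_ge0.
  have [Tm pm] := fP m; have [Tn pn] := fP n.
  have -> : ract ((f m).2 - (f n).2) (val b) = ((f m).1 - (f n).1) (b, 0).
    by rewrite subopE pm pn ractDl -[- (f n).2]scaleN1r ractZl scaleN1r.
  suff : bnd ((f m).1 - (f n).1) (2 / n.+1%:R).
    by move=> /(_ (b, 0)); rewrite hnrm_inl hnrm_range_ideal.
  rewrite -(subrK T (f m).1) -addrA mulrDl mul1r; apply: (bndD cs) => //.
  by apply: bndBC; apply: bndW Tm; rewrite lef_pV2 ?posrE ?ltr0n// ler_nat ltnS.
have [p pf] := hBE.2 _ _ ve diff; exists p => b.
apply/eqP; rewrite -subr_eq0; apply/eqP/(hnrm_eq0 cs).
apply/eqP; rewrite eq_le hnrm_ge0 andbT.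
apply: (vanishing_le0 (c := 2 * nrm (val b)) ve); first by rewrite mulr_ge0 ?nrm_ge0.
move=> n; have [Tn pn] := fP n.
have -> : T (b, 0) - ract p (val b) =
    (T - (f n).1) (b, 0) + ract ((f n).2 - p) (val b).
  rewrite subopE pn ractDl -[- p]scaleN1r ractZl scaleN1r addrA.
  by rewrite subrK.
rewrite mulrA mulr_natr mulr2n mulrDl; apply: le_trans (hnrmD cs _ _) _; apply: lerD.
  apply: le_trans (Tn _) _; rewrite hnrm_inl hnrm_range_ideal ler_wpM2r ?nrm_ge0//.
  by rewrite ler_peMl ?ler1n// ltW.
apply: le_trans (hnrm_ract _ _) _; rewrite ler_wpM2r ?nrm_ge0// hnrmBC.
exact: pf.
Qed.

Lemma is_adjoint_corner22 (T : adjointable BE) : is_adjoint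
  (fun x : E => (T ((0, x) : BE)).2) (fun x : E => (adjop T ((0, x) : BE)).2).
Proof.
move=> x y; have := adjopP T (0, x) (0, y); rewrite !dsum_innerE /=.
by rewrite inner0r inner0l !add0r.
Qed.

Definition comp22 (T : adjointable BE) : adjointable E :=
  mk_adjointable (is_adjoint_corner22 T).

Lemma compact_comp22 T : linking_algebra E T -> compact_ops (comp22 T).
Proof.
move=> /compact_opsP LT; apply/compact_opsP => e e0; have [S SE Se] := LT _ e0.
exists (comp22 S).
  apply: (lspan_image _ _ SE (f := comp22)) => [a S1 S2|_ [[p q] _ <-]].
    by apply: adj_inj.
  apply: sub_lspan; exists (p.2, q.2) => //; apply: adj_inj => x.
  change (ract p.2 (inner q.2 x : B) =
    ract p.2 (inner q.1 (0 : range_ideal E) + inner q.2 x : B)).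
  by rewrite inner0r add0r.
move=> x; apply: le_trans (_ : hnrm ((T - S) (0, x)) <= _).
  exact: (hnrm_snd (range_ideal_hilbertian E) hE ((T - S) (0, x))).
by have := Se (0, x); rewrite hnrm_inr.
Qed.

(** [linking_column] describes first columns only, so the 12-entry is taken from the first column of
    T^*. *)
Lemma linking_blocks T : linking_algebra E T -> exists b x y (k : adjointable E),
  compact_ops k /\ T = entry11 b + entry12 y + entry21 x + entry22 k.
Proof.
move=> LT; have [[b x] colT] := linking_column LT.
have [[c y] colT'] := linking_column (linking_algebra_adjop LT).
exists b, x, y, (comp22 T); split; first exact: compact_comp22.
apply: adj_inj => p; have -> : p = (p.1, 0) + (0, p.2).
  by rewrite [LHS]surjective_pairing; congr pair; rewrite /= ?addr0 ?add0r.
rewrite opD colT; set q : E := p.2; set d := p.1.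
have -> : T (0, q) = (innerI y q, comp22 T q).
  rewrite [LHS]surjective_pairing; congr pair.
  apply: inner_inj => e; have := adjopP T (0, q) (e, 0).
  rewrite colT' !dsum_innerE /= inner0l inner0r addr0 add0r => h.
  rewrite -[LHS]inner_star [X in cstar X]h inner_ract cstarM inner_star.
  by rewrite range_innerE.
rewrite !addopE entry11E entry12E entry21E entry22E /=; congr pair.
  rewrite /= !addr0 add0r.
  by congr (_ + _); apply: val_inj.
by rewrite /= !add0r addr0.
Qed.

End Blocks.

Lemma op_double_approx (R : realType) (B : cstarAlgType R) (E : hilbertModType B)
    (T : adjointable (range_ideal E * E)%type) (D : set (range_ideal E * E)%type) :
    linking_algebra E T -> (forall p, D (T p)) -> (forall p, D (adjop T p)) ->
  forall e : R, 0 < e -> exists2 S, lspan [set rank1 p.1 p.2 | p in D `*` D] S &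
    bnd (T - S) e.
Proof.
move=> LT DT DT' e e0; have hBE := linking_hilbertian E.
have cs := hilbertian_cs hBE.
have [c c0 Tc] := linking_algebra_bounded LT.
have LT' := linking_algebra_adjop LT.
(* Polynomials in T^* T without constant term end in T, so the approximants T Z have the form T Y
   T. *)
pose P (Z : adjointable (range_ideal E * E)%type) :=
  exists2 Y, linking_algebra E Y & Z = Y * T.
have e20 : 0 < e / 2 by rewrite divr_gt0.
have [||||Z [Y LY ->] TZ] := op_approx hBE (T := T) (P := P) _ _ _ _ e20.
- by exists c.
- by exists (adjop T).
- move=> a _ _ [Y1 L1 ->] [Y2 L2 ->]; exists (a *: Y1 + Y2).
    exact: linking_algebraZD.
  by rewrite mulrDl scaleopAl.
- move=> _ [Y LY ->]; exists (adjop T * T * Y); last by rewrite mulrA.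
  exact: (linking_algebraM (linking_algebraM LT' LT) LY).
(* T (Y - S) T has norm at most c^2 times that of Y - S. *)
have d0 : 0 < e / 2 / (c * c) by apply: divr_gt0 => //; exact: mulr_gt0.
have [S SE YS] := (compact_opsP Y).1 LY _ d0.
exists (T * S * T).
  apply: (lspan_image _ _ SE (f := fun S => T * S * T)) => [a S1 S2|_ [[p q] _ <-]].
    by rewrite mulrDr mulrDl -scaleopAr -scaleopAl.
  rewrite mul_rank1 rank1_mul; apply: sub_lspan.
  by exists (T p, adjop T q); [split; [exact: DT|exact: DT']|].
have -> : T - T * S * T = (T - T * (Y * T)) + (T * (Y * T) - T * S * T).
  by rewrite addrA subrK.
rewrite [e]splitr; apply: (bndD cs TZ).
have -> : T * (Y * T) - T * S * T = T * ((Y - S) * T).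
  by rewrite mulrBl mulrBr !mulrA.
have -> : e / 2 = c * (e / 2 / (c * c) * c) by field; exact: lt0r_neq0.
by apply: bndM; rewrite ?(ltW c0)//; apply: bndM => //; exact: ltW.
Qed.

(** * Exactness and uniqueness *)

Section Exactness.
Context (R : realType) (A B C : cstarAlgType R).
Context (G : hilbertModType A) (E : hilbertModType B) (F : hilbertModType C).
Context (v : G -> E) (u : E -> F) (tv : ternary_homomorphism v) (tu : ternary_homomorphism u).
Let hAG := linking_hilbertian G.
Let hBE := linking_hilbertian E.
Let hCF := linking_hilbertian F.
Let tV := linking_map_ternary tv.
Let tU := linking_map_ternary tu.

(** The second component of a generator for v is a rank one operator whose vectors are killed by
    [linking_map tu], so it is related to 0 under u; spans and limits follow. The same argument on
    inner products settles the range ideals first. *)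
Lemma linking_rel_comp0 S T : (forall x, u (v x) = 0) ->
  linking_rel tv S T -> linking_rel tu T 0.
Proof.
move=> uv0.
have phi0 a : range_map tu (range_map tv a) = 0.
  apply: range_map_unique => e e0.
  have [S1 [S1' [SS _ Se]]] := range_mapP tv a e0.
  exists S1', 0; split=> //; last first.
    by rewrite [lmulop _](lmulop0 C) subr0; apply: bnd0; exact: ltW.
  apply: (lspan_image _ _ SS (f := fun p => (p.2, 0))) => [b p q|_ [[x y] _ <-]].
    by congr pair; rewrite /= scaler0 addr0.
  apply: sub_lspan; exists (v x, v y) => //=.
  by rewrite !uv0 inner0l lmulop0.
have UV0 p : linking_map tu (linking_map tv p) = 0.
  by rewrite /linking_map /= phi0 uv0.
move=> ST e e0; have [S1 [S1' [SS _ Se]]] := ST _ e0.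
exists S1', 0; split=> //; last by rewrite subr0; apply: bnd0; exact: ltW.
apply: (lspan_image _ _ SS (f := fun p => (p.2, 0))) => [b p q|_ [[x y] _ <-]].
  by congr pair; rewrite /= scaler0 addr0.
apply: sub_lspan; exists (linking_map tv x, linking_map tv y) => //=.
by rewrite !UV0; congr pair; apply: adj_inj => z; rewrite rank1E ract0l.
Qed.

(** By intertwining, [linking_map tv] kills every value of T. It is injective: if the image of a in
    the range ideal of E is 0, then v(y a) = 0, hence y a = 0, for all y. *)
Lemma linking_rel_injective T : (forall x, v x = 0 -> x = 0) ->
  linking_rel tv T 0 -> T = 0.
Proof.
move=> v0 T0; apply: adj_inj => p; rewrite zeroopE.
have := compact_rel_intertwine hAG hBE tV T0 p; rewrite zeroopE => /esym.
case: (T p) => a x [/(congr1 val) /= a0 /v0 ->]; congr pair; apply: val_inj.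
apply: (@range_ideal_annihilated _ _ G); first exact: valP.
by move=> y; apply: v0; rewrite range_map_mod [X in ract _ X]a0 ract0r.
Qed.

Hypotheses (kuv : forall y, u y = 0 -> exists x, v x = y).

(** b is near b c b, and c is near a combination of inner products. Since b <y, z> b = <y b^*, z b>
    with y b^* and z b in the kernel of u, hence in the range of v, the result comes from the range
    ideal of G. *)
Lemma linking_kernel_approximable p :
  linking_map tu p = 0 -> approximable (linking_map tv) p.
Proof.
case: p => b x [/(congr1 val) /= b0 /kuv[g gE]] e e0.
have e20 : 0 < e / 2 by rewrite divr_gt0.
have [c bc] := range_approx_unit b e20.
have b1 : 0 < nrm (val b) ^+ 2 + 1 by rewrite ltr_wpDl ?exprn_ge0 ?nrm_ge0.
have d0 : 0 < e / 2 / (nrm (val b) ^+ 2 + 1) by rewrite divr_gt0.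
have /range_idealP/(_ _ d0)[s sE cs] := valP c.
have kact (y : E) (w : range_ideal E) : val (range_map tu w) = 0 ->
    exists z, v z = ract y (val w).
  by move=> w0; apply: kuv; rewrite range_map_mod w0 ract0r.
have bs0 : val (range_map tu (range_ideal_cstar b)) = 0.
  rewrite range_map_cstar /= b0 -[X in cstar X](scale0r (0 : C)) cstarZ.
  by rewrite conjc0 scale0r.
have [a aE] : exists a : range_ideal G, val (range_map tv a) =
    cmul (val b) (cmul s (val b)).
  apply: (lspan_ind _ _ _ sE (P := fun s => exists a : range_ideal G,
      val (range_map tv a) = cmul (val b) (cmul s (val b)))).
  - exists 0; rewrite (range_map0 tv) cmul0l cmul0r //.
  - move=> s1 s2 [a1 a1E] [a2 a2E]; exists (a1 + a2).
    have := range_map_linear tv 1 a1 a2; rewrite !scale1r => ->.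
    by rewrite /= a1E a2E cmulDl cmulDr.
  move=> k _ [[y z] _ <-] /=.
  have [y' yE] := kact y _ bs0; have [z' zE] := kact z _ b0.
  exists (k *: innerI y' z').
  have := range_map_linear tv k (innerI y' z') 0.
  rewrite (range_map0 tv) !addr0 => ->; rewrite range_map_inner /= yE zE.
  by rewrite inner_ractl inner_ract /= cstarK cmulZl cmulZr.
exists (a, g).
have -> : (b, x) - linking_map tv (a, g) = (b - range_map tv a, 0).
  by congr pair; rewrite /= gE subrr.
rewrite hnrm_inl hnrm_range_ideal.
have -> : val (b - range_map tv a) = (val b - cmul (val b) (cmul (val c) (val b))) +
    cmul (val b) (cmul (val c - s) (val b)).
  by rewrite /= aE cmulBl cmulBr addrA subrK.
rewrite [e]splitr; apply: le_trans (nrmD _ _) _; apply: lerD => //.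
apply: le_trans (nrmM _ _) _.
apply: le_trans (ler_wpM2l (nrm_ge0 _) (nrmM _ _)) _.
apply: (@le_trans _ _ (nrm (val b) * (e / 2 / (nrm (val b) ^+ 2 + 1) * nrm (val b)))).
  by rewrite ler_wpM2l ?nrm_ge0// ler_wpM2r ?nrm_ge0.
rewrite mulrCA -expr2 mulrAC ler_pdivrMr// ler_wpM2l ?(ltW e20)//.
by rewrite lerDl.
Qed.

Lemma linking_rel_kernel T : linking_rel tu T 0 -> exists S, linking_rel tv S T.
Proof.
move=> T0; have LT := linking_rel_fst T0.
have T0' : linking_rel tu (adjop T) 0.
  rewrite -(adjop0 (range_ideal F * F)%type).
  exact: (graph_closure_adjop hBE hCF (op_graph_ofP hBE hCF tU) T0).
have ker S : linking_rel tu S 0 -> forall p, linking_map tu (S p) = 0.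
  by move=> S0 p; rewrite -(compact_rel_intertwine hBE hCF tU S0).
apply: (compact_rel_surjective hAG hBE tV (D := [set p | linking_map tu p = 0])).
  exact: linking_kernel_approximable.
exact: (op_double_approx LT (ker _ T0) (ker _ T0')).
Qed.

Lemma linking_rel_surjective T' : (forall y, exists x, u x = y) ->
  linking_algebra F T' -> exists T, linking_rel tu T T'.
Proof.
move=> su /compact_opsP LT'.
apply: (compact_rel_surjective hBE hCF tU (D := setT)).
  move=> [c y] _ e e0; have [x xE] := su y.
  have /range_idealP/(_ _ e0)[s sF cs] := valP c.
  have [b bE] : exists b : range_ideal E, val (range_map tu b) = s.
    apply: (lspan_ind _ _ _ sF (P := fun s => exists b : range_ideal E,
      val (range_map tu b) = s)).
    - by exists 0; rewrite range_map0.
    - move=> s1 s2 [b1 b1E] [b2 b2E]; exists (b1 + b2).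
      have := range_map_linear tu 1 b1 b2; rewrite !scale1r => ->.
      by rewrite /= b1E b2E.
    move=> k _ [[y1 y2] _ <-] /=; have [x1 <-] := su y1; have [x2 <-] := su y2.
    exists (k *: innerI x1 x2); have := range_map_linear tu k (innerI x1 x2) 0.
    by rewrite range_map0 !addr0 => ->; rewrite range_map_inner.
  exists (b, x); have -> : (c, y) - linking_map tu (b, x) = (c - range_map tu b, 0).
    by congr pair; rewrite /= xE subrr.
  by rewrite hnrm_inl hnrm_range_ideal /= bE.
move=> e e0; have [S SF Se] := LT' _ e0; exists S => //.
apply: (lspan_image _ _ SF (f := id)) => // _ [p _ <-].
by apply: sub_lspan; exists p.
Qed.

End Exactness.

(** * Homomorphisms between linking algebras *)

Section LinkingHom.
Context (R : realType) (B C : cstarAlgType R).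
Context (E : hilbertModType B) (F : hilbertModType C).
Local Notation BE := (range_ideal E * E)%type.
Local Notation CF := (range_ideal F * F)%type.
Context (f : adjointable BE -> adjointable CF).
Hypothesis hf : star_homomorphism (linking_algebra E) (linking_algebra F) f.

Lemma linking_hom_in T : linking_algebra E T -> linking_algebra F (f T).
Proof. by case: hf => f1 _ _ _ /f1. Qed.

Lemma linking_homZD (a : R[i]) S T : linking_algebra E S -> linking_algebra E T ->
  f (a *: S + T) = a *: f S + f T.
Proof. by case: hf => _ f2 _ _; exact: f2. Qed.

Lemma linking_homM S T : linking_algebra E S -> linking_algebra E T ->
  f (S * T) = f S * f T.
Proof. by case: hf => _ _ f3 _; exact: f3. Qed.

Lemma linking_hom_adjop T : linking_algebra E T -> f (adjop T) = adjop (f T).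
Proof. by case: hf => _ _ _ f4; exact: f4. Qed.

Lemma linking_hom0 : f 0 = 0.
Proof.
have := linking_homZD (-1) (linking_algebra0 E) (linking_algebra0 E).
by rewrite scaler0 addr0 scaleN1r addNr.
Qed.

Lemma linking_homD S T : linking_algebra E S -> linking_algebra E T ->
  f (S + T) = f S + f T.
Proof.
by move=> LS LT; have := linking_homZD 1 LS LT; rewrite !scale1r.
Qed.

Lemma linking_homB S T : linking_algebra E S -> linking_algebra E T ->
  f (S - T) = f S - f T.
Proof.
move=> LS LT; have := linking_homZD (-1) LT LS.
by rewrite !scaleN1r addrC => ->; rewrite addrC.
Qed.

Lemma linking_hom_entry12 (u : E -> F) x : restricts21 f u ->
  f (entry12 x) = entry12 (u x).
Proof.
move=> fu; rewrite -!adjop_entry21 (linking_hom_adjop (linking_entry21 x)).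
by rewrite fu.
Qed.

End LinkingHom.

Section Uniqueness.
Context (R : realType) (B C : cstarAlgType R).
Context (E : hilbertModType B) (F : hilbertModType C).
Local Notation BE := (range_ideal E * E)%type.
Local Notation CF := (range_ideal F * F)%type.
Context (f g : adjointable BE -> adjointable CF).
Hypothesis hf : star_homomorphism (linking_algebra E) (linking_algebra F) f.
Hypothesis hg : star_homomorphism (linking_algebra E) (linking_algebra F) g.
Context (u : E -> F) (fu : restricts21 f u) (gu : restricts21 g u).

(** The 11- and 22-corners are compared after multiplication by 21- and 12-corners. Separation is
    left as a hypothesis: a surjective u provides every 21-corner of the target, whereas the corners
    coming from v need not separate the linking algebra of E, and exactness has to intervene. *)
Lemma linking_hom_agree :
    (forall S, linking_algebra E S ->
      (forall x, entry21 (u x) * (g S - f S) = 0) ->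
      (forall x, entry12 (u x) * (g S - f S) = 0) -> g S = f S) ->
  {in linking_algebra E, g =1 f}.
Proof.
move=> sep T; rewrite inE => LT; have [b [x [y [k [kE ->]]]]] := linking_blocks LT.
have L11 := linking_entry11 b; have L12 := linking_entry12 y.
have L21 := linking_entry21 x; have L22 := linking_entry22 kE.
have L2 := linking_algebraD L11 L12; have L3 := linking_algebraD L2 L21.
have e11 : g (entry11 b) = f (entry11 b).
  apply: (sep _ L11) => z.
    rewrite mulrBr -{1}gu -fu -(linking_homM hg (linking_entry21 z) L11).
    rewrite -(linking_homM hf (linking_entry21 z) L11) entry21_mul_entry11 fu gu.
    exact: subrr.
  rewrite mulrBr -{1}(linking_hom_entry12 hg z gu) -(linking_hom_entry12 hf z fu).
  rewrite -(linking_homM hg (linking_entry12 z) L11).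
  rewrite -(linking_homM hf (linking_entry12 z) L11) entry12_mul_entry11.
  by rewrite (linking_hom0 hf) (linking_hom0 hg) subrr.
have e22 : g (entry22 k) = f (entry22 k).
  apply: (sep _ L22) => z.
    rewrite mulrBr -{1}gu -fu -(linking_homM hg (linking_entry21 z) L22).
    rewrite -(linking_homM hf (linking_entry21 z) L22) entry21_mul_entry22.
    by rewrite (linking_hom0 hf) (linking_hom0 hg) subrr.
  rewrite mulrBr -{1}(linking_hom_entry12 hg z gu) -(linking_hom_entry12 hf z fu).
  rewrite -(linking_homM hg (linking_entry12 z) L22).
  rewrite -(linking_homM hf (linking_entry12 z) L22) entry12_mul_entry22.
  rewrite (linking_hom_entry12 hf _ fu) (linking_hom_entry12 hg _ gu).
  exact: subrr.
rewrite (linking_homD hf L3 L22) (linking_homD hf L2 L21) (linking_homD hf L11 L12).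
rewrite (linking_homD hg L3 L22) (linking_homD hg L2 L21) (linking_homD hg L11 L12).
by rewrite (linking_hom_entry12 hf y fu) (linking_hom_entry12 hg y gu) fu gu e11 e22.
Qed.

End Uniqueness.

Section Blockwise.
Context (R : realType) (B C : cstarAlgType R).
Context (E : hilbertModType B) (F : hilbertModType C).
Local Notation BE := (range_ideal E * E)%type.
Local Notation CF := (range_ideal F * F)%type.
Context (f : adjointable BE -> adjointable CF).
Hypothesis hf : star_homomorphism (linking_algebra E) (linking_algebra F) f.
Hypothesis bf : blockwise f.
Context (u : E -> F) (fu : restricts21 f u).

(** The other three corners of T are sent to operators without 21-entry, so y is the image of the
    21-entry of T. *)
Lemma blockwise_corner21 T y : linking_algebra E T -> f T = entry21 y ->
  exists x, u x = y.
Proof.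
move=> LT; have [b [x [z [k [kE ->]]]]] := linking_blocks LT.
have L11 := linking_entry11 b; have L12 := linking_entry12 z.
have L21 := linking_entry21 x; have L22 := linking_entry22 kE.
have L2 := linking_algebraD L11 L12; have L3 := linking_algebraD L2 L21.
rewrite (linking_homD hf L3 L22) (linking_homD hf L2 L21) (linking_homD hf L11 L12).
case: bf => f11 _ _ f22.
have [c _ <-] := f11 _ (ex_intro2 _ _ b I erefl : corner11 E (entry11 b)).
have [l _ <-] := f22 _ (ex_intro2 _ _ k kE erefl : corner22 E (entry22 k)).
rewrite (linking_hom_entry12 hf z fu) fu => fT; exists x; apply: entry21_inj.
apply: adj_inj => p; rewrite !entry21E.
have := congr1 (fun T : adjointable CF => (T (p.1, 0)).2) fT.
rewrite !addopE entry11E entry12E !entry21E entry22E /= op0 addr0 !add0r.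
by move=> ->.
Qed.

(** The ternary product x <y, z> is the 21-corner of a product of corners x, y^*, z, which f
    preserves. *)
Lemma restricts21_ternary : ternary_homomorphism u.
Proof.
split=> [a x y|x y z]; apply: entry21_inj.
  rewrite -fu !entry21_linear -!fu.
  by apply: (linking_homZD hf); exact: linking_entry21.
have triple (A : cstarAlgType R) (V : hilbertModType A) (p q r : V) :
    entry21 (ract p (inner q r : A)) = entry21 p * (entry12 q * entry21 r).
  apply: adj_inj => w; rewrite !mulopE entry12E !entry21E /= -ractM.
  by rewrite inner_ract.
rewrite -fu !triple -!fu -!(linking_hom_entry12 hf _ fu).
have L21 := linking_entry21; have L12 := linking_entry12 y.
rewrite (linking_homM hf (L21 _ _ _ x) (linking_algebraM L12 (L21 _ _ _ z))).
by rewrite (linking_homM hf L12 (L21 _ _ _ z)).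
Qed.

End Blockwise.

Lemma corner21_restriction (R : realType) (B C : cstarAlgType R)
    (E : hilbertModType B) (F : hilbertModType C)
    (f : adjointable (range_ideal E * E)%type -> adjointable (range_ideal F * F)%type) :
  blockwise f -> exists u, restricts21 f u.
Proof.
case=> _ _ f21 _.
have /choice[u fu] : forall x : E, exists y : F, f (entry21 x) = entry21 y.
  move=> x; have [y _ <-] := f21 _ (ex_intro2 _ _ x I erefl : corner21 E (entry21 x)).
  by exists y.
by exists u.
Qed.

Lemma restricts21_unique (R : realType) (B C : cstarAlgType R)
    (E : hilbertModType B) (F : hilbertModType C)
    (f : adjointable (range_ideal E * E)%type -> adjointable (range_ideal F * F)%type)
    (u u' : E -> F) :
  restricts21 f u -> restricts21 f u' -> u = u'.
Proof.
by move=> fu fu'; apply/funext => x; apply: entry21_inj; rewrite -fu -fu'.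
Qed.

Theorem theorem4p3 (R : realType) (A B C : cstarAlgType R)
    (G : hilbertModType A) (E : hilbertModType B) (F : hilbertModType C) :
  (forall (v : G -> E) (u : E -> F),
    hilbert_extension v u ->
    exists Psi Phi,
      [/\ blockwise_extension Psi Phi, restricts21 Psi v, restricts21 Phi u &
          forall Psi' Phi',
            blockwise_extension Psi' Phi' ->
            restricts21 Psi' v -> restricts21 Phi' u ->
            {in linking_algebra G, Psi' =1 Psi} /\
            {in linking_algebra E, Phi' =1 Phi}])
  /\
  (forall Psi Phi,
    blockwise_extension (G := G) (E := E) (F := F) Psi Phi ->
    exists! vu : (G -> E) * (E -> F),
      [/\ hilbert_extension vu.1 vu.2,
          restricts21 Psi vu.1 & restricts21 Phi vu.2]).
Proof.
split=> [v u [tv tu [kerv imv imu]]|Psi Phi [hPsi hPhi bPsi bPhi [kerPsi imPsi imPhi]]].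
  have v0 x : v x = 0 -> x = 0.
    by move=> vx; have : [set x | [set: G] x /\ v x = 0] x by []; rewrite kerv.
  have uv0 x : u (v x) = 0.
    have : (v @` [set: G]) (v x) by exists x.
    by rewrite imv => -[].
  have kuv y : u y = 0 -> exists x, v x = y.
    move=> uy; have : [set y | [set: E] y /\ u y = 0] y by [].
    by rewrite -imv => -[x _ <-]; exists x.
  have su y : exists x, u x = y.
    have : [set: F] y by [].
    by rewrite -imu => -[x _ <-]; exists x.
  have hPsi := linking_functor_hom tv; have hPhi := linking_functor_hom tu.
  have Psiv := linking_functor_restricts21 tv.
  have Phiu := linking_functor_restricts21 tu.
  have injPsi T : linking_algebra G T -> linking_functor tv T = 0 -> T = 0.
    move=> LT T0; apply: (linking_rel_injective (tv := tv)) => //.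
    by rewrite -T0; exact: linking_functorP.
  have kerPhi T : linking_algebra E T -> linking_functor tu T = 0 ->
      exists2 S, linking_algebra G S & linking_functor tv S = T.
    move=> LT T0; have := linking_functorP tu LT; rewrite T0 => relT0.
    have [S ST] := linking_rel_kernel tv kuv relT0.
    by exists S; [exact: linking_rel_fst ST|exact: linking_functor_eq].
  have PhiPsi T : linking_algebra G T -> linking_functor tu (linking_functor tv T) = 0.
    move=> LT; apply: linking_functor_eq.
    exact: linking_rel_comp0 uv0 (linking_functorP tv LT).
  exists (linking_functor tv), (linking_functor tu); split=> //.
    split=> //; [exact: linking_functor_blockwise|exact: linking_functor_blockwise|].
    split.
    - apply/seteqP; split=> [T [LT T0]|_ ->]; first exact: injPsi.
      by split; [exact: linking_algebra0|exact: linking_hom0].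
    - apply/seteqP; split=> [_ [T LT <-]|T [LT T0]].
        by split; [exact: linking_hom_in|exact: PhiPsi].
      by have [S LS <-] := kerPhi _ LT T0; exists S.
    apply/seteqP; split=> [_ [T LT <-]|T LT]; first exact: linking_hom_in.
    have [S ST] := linking_rel_surjective tu su LT.
    by exists S; [exact: linking_rel_fst ST|exact: linking_functor_eq].
  move=> Psi' Phi' [hPsi' hPhi' _ _ [_ imPsi' _]] Psi'v Phi'u.
  have PhiE : {in linking_algebra E, Phi' =1 linking_functor tu}.
    apply: (linking_hom_agree hPhi hPhi' Phiu Phi'u) => S LS S21 S12.
    apply/eqP; rewrite -subr_eq0; apply/eqP/entries_separate => y.
      by have [x <-] := su y.
    by have [x <-] := su y.
  split=> //; apply: (linking_hom_agree hPsi hPsi' Psiv Psi'v) => S LS S21 S12.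
  (* Phi kills Psi S, and also Psi' S because Phi agrees with Phi' there. So the difference is Psi Z
     for some Z; corners of G annihilate Z because Psi is injective, and within its own linking
     algebra they do separate. *)
  have LD := linking_algebraB (linking_hom_in hPsi' LS) (linking_hom_in hPsi LS).
  have [|Z LZ ZD] := kerPhi _ LD.
    rewrite (linking_homB hPhi (linking_hom_in hPsi' LS) (linking_hom_in hPsi LS)).
    rewrite (PhiPsi _ LS) subr0 -PhiE ?inE; last exact: linking_hom_in.
    have : (Psi' @` linking_algebra G) (Psi' S) by exists S.
    by rewrite imPsi' => -[].
  suff Z0 : Z = 0.
    by apply/eqP; rewrite -subr_eq0 -ZD Z0; apply/eqP; exact: linking_hom0.
  apply: entries_separate => x; apply: injPsi.
  - exact: (linking_algebraM (linking_entry21 x) LZ).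
  - by rewrite (linking_homM hPsi (linking_entry21 x) LZ) Psiv ZD S21.
  - exact: (linking_algebraM (linking_entry12 x) LZ).
  rewrite (linking_homM hPsi (linking_entry12 x) LZ).
  by rewrite (linking_hom_entry12 hPsi x Psiv) ZD S12.
have [v Psiv] := corner21_restriction bPsi; have [u Phiu] := corner21_restriction bPhi.
exists (v, u); split; last first.
  move=> [v' u'] [_ /= Psiv' Phiu'].
  by rewrite (restricts21_unique Psiv Psiv') (restricts21_unique Phiu Phiu').
have PhiPsi T : linking_algebra G T -> Phi (Psi T) = 0.
  move=> LT; have : (Psi @` linking_algebra G) (Psi T) by exists T.
  by rewrite imPsi => -[].
have e0 (S : cstarAlgType R) (V : hilbertModType S) (x : V) : entry21 x = 0 -> x = 0.
  move=> x0; apply: entry21_inj; rewrite x0.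
  by have := entry21B (0 : V) 0; rewrite !subrr.
split=> //; split.
- exact: (restricts21_ternary hPsi Psiv).
- exact: (restricts21_ternary hPhi Phiu).
have e00 (S : cstarAlgType R) (V : hilbertModType S) : entry21 (0 : V) = 0.
  by have := entry21B (0 : V) 0; rewrite !subrr.
have u0 : u 0 = 0 by apply: e0; rewrite -Phiu e00; exact: linking_hom0 hPhi.
have v0 : v 0 = 0 by apply: e0; rewrite -Psiv e00; exact: linking_hom0 hPsi.
split.
- apply/seteqP; split=> [x [_ /= vx]|_ ->]; last by split.
  apply: e0; have : [set T | linking_algebra G T /\ Psi T = 0] (entry21 x).
    by split; [exact: linking_entry21|rewrite Psiv vx e00].
  by rewrite kerPsi.
- apply/seteqP; split=> [_ [x _ <-]|y [_ /= uy]].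
    split=> //; apply: e0; rewrite -Phiu -Psiv; apply: PhiPsi.
    exact: linking_entry21.
  have : [set T | linking_algebra E T /\ Phi T = 0] (entry21 y).
    by split; [exact: linking_entry21|rewrite Phiu uy e00].
  rewrite -imPsi => -[T LT Ty].
  by have [x <-] := blockwise_corner21 hPsi bPsi Psiv LT Ty; exists x.
apply/seteqP; split=> // y _.
have : linking_algebra F (entry21 y) by exact: linking_entry21.
rewrite -imPhi => -[T LT Ty].
by have [x <-] := blockwise_corner21 hPhi bPhi Phiu LT Ty; exists x.
Qed.
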